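(* Consider the SISO Rayleigh fading channel with delay spread with $K$ taps described in the context. If the channel is nonephemeral and no average power constraint is imposed (i.e. $\beta=1$), then, writing $C_{ds}(\rho)=C_{ds}(\rho,1)$, $$\limsup_{\rho\to0}\frac{C_{ds}(\rho)}{\rho^2}\le K\sum_{k=0}^{K-1}\phi_k$$ and $$\liminf_{\rho\to0}\frac{C_{ds}(\rho)}{\rho^2}\ge\sum_{n=1}^{\infty}\left|\sum_{k=0}^{K-1}R_k(n)\right|^2 .$$
   Context: Channel model. The complex scalar input $Z(n)$ and output $Y(n)$ are related by $$Y(n)=\sqrt{\rho}\sum_{k=0}^{K-1}H_k(n)Z(n-k)+W(n),\qquad \rho>0 .$$ The fading processes $H_k=(H_k(n):n\in\mathbb{Z})$, $0\le k\le K-1$, are mutually independent, zero-mean, stationary and ergodic, proper complex normal (i.e. circularly symmetric complex Gaussian) processes; $H_k$ has autocorrelation function $R_k(n)=E[H_k(n)H_k^*(0)]$ and a spectral density. $W$ is an iid proper complex normal process with zero mean and unit variance, independent of the fading and the input; the input is independent of the fading (neither transmitter nor receiver observes the fading). Information is measured in nats. Define $\phi_k=\sum_{n=1}^\infty|R_k(n)|^2$ (assumed finite for all $k$). The process $H_k$ is ephemeral if $2\phi_k\le R_k^2(0)$ and nonephemeral otherwise; the channel is nonephemeral if all the $H_k$ are nonephemeral. Input constraints: $|Z(n)|\le1$ for all $n$ and $E[|Z(n)|^2]\le1/\beta$ for all $n$, where $\beta\ge1$. $C_{ds}(\rho,\beta)$ denotes the information theoretic capacity under these constraints, i.e. $\lim_{N\to\infty}\frac1N\sup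 I(Z(1),\dots,Z(N);Y(1),\dots,Y(N))$, the supremum being over joint distributions of $(Z(1),\dots,Z(N))$ satisfying the constraints for $1\le n\le N$, with $Z(n)=0$ for $n\le0$. *)

(* Defs.v *)
From HB Require Import structures.
From mathcomp Require Import all_boot all_order all_algebra.
From mathcomp Require Import all_classical all_reals all_analysis.
From mathcomp Require Import measurable_realfun complex.

Set Implicit Arguments.
Unset Strict Implicit.
Unset Printing Implicit Defensive.

Import Order.TTheory GRing.Theory Num.Theory.
Import numFieldNormedType.Exports.

Local Open Scope classical_set_scope.
Local Open Scope ring_scope.
Local Open Scope complex_scope.

(** R[i] carries the sigma-algebra of R * R, that is, the Borel sigma-algebra
    of the complex plane. *)
Definition complex_display : measure_display.
Proof. by constructor. Qed.

HB.instance Definition _ (R : realType) := isPointed.Build R[i] 0.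

Section complex_measurable.
Variable R : realType.

Definition complex_pair (z : R[i]) : R * R := (complex.Re z, complex.Im z).

Definition complex_measurable : set (set R[i]) :=
  preimage_set_system [set: R[i]] complex_pair (@measurable _ (R * R)%type).

Let complex_sigma : sigma_algebra [set: R[i]] complex_measurable.
Proof. by apply: sigma_algebra_preimage; exact: sigma_algebra_measurable. Qed.

Let complex_measurable0 : complex_measurable set0.
Proof. by case: complex_sigma. Qed.

Let complex_measurableC (A : set R[i]) :
  complex_measurable A -> complex_measurable (~` A).
Proof. by case: complex_sigma => _ h _ /h; rewrite setTD. Qed.

Let complex_measurable_bigcup (F : (set R[i])^nat) :
  (forall i, complex_measurable (F i)) -> complex_measurable (\bigcup_i F i).
Proof. by case: complex_sigma => _ _; exact. Qed.

HB.instance Definition _ := @isMeasurable.Build complex_display R[i]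
  complex_measurable complex_measurable0 complex_measurableC
  complex_measurable_bigcup.

End complex_measurable.

Section complex_measurability.
Context d (T : measurableType d) (R : realType).
Implicit Types f g : T -> R[i].

Lemma measurable_fun_complexP f : measurable_fun [set: T] f <->
  measurable_fun [set: T] (fun x => complex.Re (f x)) /\
  measurable_fun [set: T] (fun x => complex.Im (f x)).
Proof.
split=> [mf|mf].
- have : measurable_fun [set: T] (@complex_pair R \o f).
    move=> _ Y mY; rewrite comp_preimage; apply: mf => //.
    by exists Y => //; rewrite setTI.
  by move=> /measurable_fun_pairP.
- move=> _ _ [Y mY <-]; rewrite setTI -comp_preimage.
  by have /measurable_fun_pairP/(_ measurableT _ mY) :
    measurable_fun [set: T] (fst \o (@complex_pair R \o f)) /\
    measurable_fun [set: T] (snd \o (@complex_pair R \o f)) by [].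
Qed.

Lemma measurable_fun_complexD f g :
  measurable_fun [set: T] f -> measurable_fun [set: T] g ->
  measurable_fun [set: T] (fun x => f x + g x).
Proof.
move=> /measurable_fun_complexP[rf mf] /measurable_fun_complexP[rg mg].
apply/measurable_fun_complexP; split.
- apply: eq_measurable_fun (measurable_funD rf rg) => x _ /=.
  by case: (f x) (g x) => [? ?] [].
- apply: eq_measurable_fun (measurable_funD mf mg) => x _ /=.
  by case: (f x) (g x) => [? ?] [].
Qed.

Lemma measurable_fun_complexM f g :
  measurable_fun [set: T] f -> measurable_fun [set: T] g ->
  measurable_fun [set: T] (fun x => f x * g x).
Proof.
move=> /measurable_fun_complexP[rf mf] /measurable_fun_complexP[rg mg].
apply/measurable_fun_complexP; split.
- apply: eq_measurable_fun
    (measurable_funB (measurable_funM rf rg) (measurable_funM mf mg)) => x _ /=.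
  by case: (f x) (g x) => [? ?] [].
- apply: eq_measurable_fun
    (measurable_funD (measurable_funM rf mg) (measurable_funM mf rg)) => x _ /=.
  by case: (f x) (g x) => [? ?] [].
Qed.

Lemma measurable_fun_complex_sum n (h : 'I_n -> T -> R[i]) :
  (forall i, measurable_fun [set: T] (h i)) ->
  measurable_fun [set: T] (fun x => \sum_(i < n) h i x).
Proof.
elim: n h => [|n IH] h mh.
  by under eq_fun do rewrite big_ord0; exact: measurable_cst.
under eq_fun do rewrite big_ord_recl.
by apply: measurable_fun_complexD => //; exact: IH.
Qed.

End complex_measurability.

Definition cintegral d (T : measurableType d) (R : realType)
    (mu : {measure set T -> \bar R}) (D : set T) (f : T -> R[i]) : R[i] :=
  Rintegral mu D (fun x => complex.Re (f x)) +i*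
  Rintegral mu D (fun x => complex.Im (f x)).

Section processes.
Context d (T : measurableType d) (R : realType) (P : probability T R).
Implicit Types X : int -> {RV P >-> R[i]}.

Definition cexpectation (f : T -> R[i]) : R[i] := cintegral P [set: T] f.

Definition path X (w : T) : int -> R[i] := fun n => X n w.

Definition path_measurable : set (set (int -> R[i])) :=
  <<s [set A | exists n (B : set R[i]),
         measurable B /\ A = [set x | B (x n)]] >>.

(** Mutual independence of a finite family of processes.  The product rule for
    subfamilies is the case where some of the [A i] are the full path space. *)
Definition independent_processes (I : finType)
    (X : I -> int -> {RV P >-> R[i]}) : Prop :=
  forall A : I -> set (int -> R[i]), (forall i, path_measurable (A i)) ->
  P (\bigcap_(i in [set: I]) (path (X i) @^-1` A i)) =
  (\prod_(i : I) P (path (X i) @^-1` A i))%E.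

Definition stationary X : Prop :=
  forall (m : int) (A : set (int -> R[i])), path_measurable A ->
  P [set w | A (fun n => X (n + m) w)] = P [set w | A (path X w)].

(** Triviality of the shift-invariant events; used together with
    [stationary]. *)
Definition ergodic X : Prop :=
  forall A : set (int -> R[i]), path_measurable A ->
  [set x | A (fun n => x (n + 1))] = A ->
  P [set w | A (path X w)] = 0%E \/ P [set w | A (path X w)] = 1%E.

Definition iid X : Prop :=
  (forall (s : seq int) (A : int -> set R[i]), uniq s ->
     (forall n, measurable (A n)) ->
     P (\bigcap_(n in [set` s]) (X n @^-1` A n)) =
     (\prod_(n <- s) P (X n @^-1` A n))%E) /\
  (forall (n : int) (A : set R[i]), measurable A ->
     P (X n @^-1` A) = P (X 0 @^-1` A)).

(** Real normal variables, point masses included.  [normal_prob m s] is not the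
    point mass at [m] when [s = 0], so that case is listed separately. *)
Definition normal_rv (f : T -> R) : Prop :=
  (exists m : R, P [set w | f w = m] = 1%E) \/
  (exists m s : R, 0 < s /\ forall A : set R, measurable A ->
     P (f @^-1` A) = normal_prob m s A).

(** Joint normality of the real and imaginary parts at all times, through
    their real linear combinations. *)
Definition complex_normal X : Prop :=
  forall (n : nat) (t : 'I_n -> int) (a b : 'I_n -> R),
  normal_rv (fun w => \sum_(i < n)
    (a i * complex.Re (X (t i) w) + b i * complex.Im (X (t i) w))).

Definition cmean X (n : int) : R[i] := cexpectation (X n).

(** Proper: the pseudo-covariances vanish. *)
Definition proper X : Prop := forall m n : int,
  cexpectation (fun w => (X m w - cmean X m) * (X n w - cmean X n)) = 0.

Definition zero_mean X : Prop := forall n : int, cmean X n = 0.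

Definition unit_variance X : Prop := forall n : int,
  cexpectation (fun w => (X n w - cmean X n) * conjc (X n w - cmean X n)) = 1.

Definition autocorrelation X (n : int) : R[i] :=
  cexpectation (fun w => X n w * conjc (X 0 w)).

Definition has_spectral_density X : Prop :=
  exists S : R -> R,
    [/\ {in `[- pi, pi], forall t, 0 <= S t},
        (@lebesgue_measure R).-integrable `[- pi, pi] (EFin \o S) &
        forall n : int, autocorrelation X n =
          ((2 * pi)^-1)%:C * cintegral (@lebesgue_measure R) `[- pi, pi]
            (fun t => (S t)%:C * (cos (n%:~R * t) +i* sin (n%:~R * t)))].

Definition phi X : \bar R :=
  (\sum_(1 <= n <oo) ((Normc.normc (autocorrelation X n%:Z)) ^+ 2)%:E)%E.

(** [autocorrelation X 0] is E|X(0)|^2, hence real. *)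
Definition ephemeral X : Prop :=
  (2%:E * phi X <= ((complex.Re (autocorrelation X 0)) ^+ 2)%:E)%E.

Definition nonephemeral X : Prop := ~ ephemeral X.

End processes.

(** [lne] is the natural logarithm, so that information is in nats. *)
Definition kl_divergence d (T : measurableType d) (R : realType)
    (mu nu : probability T R) : \bar R :=
  if `[< mu `<< nu >] then
    (\int[mu]_x lne (Radon_Nikodym (charge_of_finite_measure mu) nu x))%E
  else +oo%E.

Section mutual_information.
Context d (T : measurableType d) (R : realType) (P : probability T R).
Context d1 (T1 : measurableType d1) d2 (T2 : measurableType d2).
Variables (X : {RV P >-> T1}) (Y : {RV P >-> T2}).

Definition pair_rv (w : T) : T1 * T2 := (X w, Y w).

Let measurable_pair_rv : measurable_fun [set: T] pair_rv.
Proof. by apply: measurable_fun_pair; exact: measurable_funP. Qed.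

HB.instance Definition _ :=
  isMeasurableFun.Build _ _ _ _ pair_rv measurable_pair_rv.

Definition mutual_information : \bar R :=
  kl_divergence (distribution P pair_rv)
                (distribution P X \x distribution P Y)%E.

End mutual_information.

Section channel.
Context d (T : measurableType d) (R : realType) (P : probability T R).
Context (K : nat).
Variables (H : 'I_K -> int -> {RV P >-> R[i]}) (W : int -> {RV P >-> R[i]}).

Definition rayleigh_channel : Prop :=
  [/\ forall k, [/\ zero_mean (H k), complex_normal (H k), proper (H k),
                    stationary (H k) & ergodic (H k)],
      forall k, has_spectral_density (H k),
      [/\ iid W, complex_normal W, proper W, zero_mean W & unit_variance W] &
      independent_processes
        (fun i : option 'I_K => if i is Some k then H k else W)].

Section block.
Variable N : nat.

(** The input Z(m) of a block (Z(1), ..., Z(N)), stored with indices from 0;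
    Z(m) = 0 for m <= 0. *)
Definition input_at (z : N.-tuple R[i]) (m : int) : R[i] :=
  if m is Posz j.+1 then nth 0 z j else 0.

Definition output_at (rho : R) (z : N.-tuple R[i]) (w : T) (n : int) : R[i] :=
  (Num.sqrt rho)%:C * (\sum_(k < K) H k n w * input_at z (n - k%:Z)) + W n w.

Definition output (rho : R) (zw : N.-tuple R[i] * T) : N.-tuple R[i] :=
  [tuple output_at rho zw.1 zw.2 i.+1%:Z | i < N].

Definition input (zw : N.-tuple R[i] * T) : N.-tuple R[i] := zw.1.

Let measurable_input_at (m : int) :
  measurable_fun [set: N.-tuple R[i]] (input_at^~ m).
Proof.
case: m => [[|j]|j] /=; [exact: measurable_cst| |exact: measurable_cst].
have [jN|Nj] := ltnP j N.
- apply: eq_measurable_fun (measurable_tnth (Ordinal jN)) => z _ /=.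
  by rewrite (tnth_nth 0).
- apply: eq_measurable_fun (measurable_cst (0 : R[i])) => z _ /=.
  by rewrite nth_default ?size_tuple.
Qed.

Let measurable_output (rho : R) :
  measurable_fun [set: N.-tuple R[i] * T] (output rho).
Proof.
apply/measurable_fun_tnthP => i.
rewrite (_ : _ \o _ = fun zw => output_at rho zw.1 zw.2 i.+1%:Z); last first.
  by apply/funext => zw; exact: tnth_mktuple.
apply: measurable_fun_complexD.
- apply: measurable_fun_complexM; first exact: measurable_cst.
  apply: measurable_fun_complex_sum => k; apply: measurable_fun_complexM.
  + by apply: measurableT_comp => //; exact: measurable_funP.
  + exact: (measurableT_comp (measurable_input_at _) measurable_fst).
- by apply: measurableT_comp => //; exact: measurable_funP.
Qed.

HB.instance Definition _ :=
  isMeasurableFun.Build _ _ _ _ input measurable_fst.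

HB.instance Definition _ (rho : R) :=
  isMeasurableFun.Build _ _ _ _ (output rho) (measurable_output rho).

(** [mu] is the joint distribution of (Z(1), ..., Z(N)).  Fading and noise live
    on [T]; under [mu \x P] they keep their law and are independent of the
    input. *)
Definition block_information (rho : R)
    (mu : probability (N.-tuple R[i]) R) : \bar R :=
  @mutual_information _ _ R (mu \x P)%E _ _ _ _ input (output rho).

Definition admissible_input (beta : R)
    (mu : probability (N.-tuple R[i]) R) : Prop :=
  (forall i : 'I_N, {ae mu, forall z, Normc.normc (tnth z i) <= 1}) /\
  (forall i : 'I_N,
     (\int[mu]_z ((Normc.normc (tnth z i)) ^+ 2)%:E <= (beta^-1)%:E)%E).

Definition max_block_information (rho beta : R) : \bar R :=
  ereal_sup [set block_information rho mu | mu in admissible_input beta].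

End block.

Definition C_ds (rho beta : R) : \bar R :=
  limn (fun N : nat => ((N%:R^-1)%:E * max_block_information N rho beta)%E).

End channel.

(* Main.v *)
Require Import Defs.
From HB Require Import structures.
From mathcomp Require Import all_boot all_order all_algebra.
From mathcomp Require Import all_classical all_reals all_analysis.
From mathcomp Require Import finmap measurable_realfun complex spectral.
From mathcomp Require Import ring lra zify.

Set Implicit Arguments.
Unset Strict Implicit.
Unset Printing Implicit Defensive.

Import Order.TTheory GRing.Theory Num.Theory.
Import numFieldNormedType.Exports.
Import HBNNSimple.

Local Open Scope classical_set_scope.
Local Open Scope ring_scope.

(** Given the input block z, the output block is a centered proper normal vector
    with covariance I + rho S(z).  Diagonalizing S(z) shows that its law has a
    density q(z, .) with respect to the law of the noise, a product of
    one-dimensional gains, and that E ln q <= rho^2/2 sum_mn |S_mn|^2.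

    Upper bound.  By Gibbs' inequality the law of the output may be replaced, in
    the definition of the information, by the product normal law of variance
    1 + rho t with t = sum_k R_k(0).  Cauchy-Schwarz over the taps bounds the off-diagonal
    part of sum |S_mn|^2, and R_k(0)^2 <= 2 phi_k makes the missing input energy,
    which costs (t - S_nn)^2 on the diagonal, no better than full input energy.

    Existence of the limit.  Separated by K - 1 zeros, two input blocks do not
    interfere, so the block information is superadditive up to guard zeros and
    Fekete's lemma applies.

    Lower bound.  The input z_n = e^(i n theta), theta uniform on [-pi, pi], gives
    S(z)_mn = e^(i(m-n)theta) sum_k R_k(m - n) away from the boundary of the block.
    The variational formula for the divergence is applied to the test function
    1 + f + f^2/2, where f is rho times the quadratic form of the outputs whose
    matrix is the off-diagonal part of S(z); averaging over theta makes f centered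
    under the product of the marginals. *)

(** * Bounds for the logarithm *)

(** Normality is given only through real linear combinations, so no multivariate density is at hand.
    Laws are compared as linear functionals of bounded functions; a signed functional that kills all
    cosines is shown to vanish, and both the independence of uncorrelated normal coordinates and the
    density of the output come from this. That density is kept in two forms: as an average of
    likelihood ratios over the fading it is jointly measurable in input and output, as a product in
    an eigenbasis it gives the bounds. The two bounds use the block length N differently. The upper
    bound is N times a quantity free of N. In the lower bound N stays fixed while rho tends to 0, so
    constants may grow badly with N; this is legitimate because superadditivity bounds the capacity
    below by the information of any single block divided by N + K - 1. The test function is a
    polynomial so that its average over theta involves only two moments of f. With B the sum of the
    squared moduli of the entries of the matrix, the gain rho^2 B minus the price rho^2 B / 2 of
    normalization leaves rho^2 B / 2. *)

Section logarithm_bounds.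
Variable R : realType.
Implicit Types x u f : R.

Lemma nonneg_of_derivative (f f' : R -> R) : (forall x, 0 <= x -> is_derive x 1 f (f' x)) ->
  (forall x, 0 <= x -> 0 <= f' x) -> 0 <= f 0 -> forall x, 0 <= x -> 0 <= f x.
Proof.
move=> df f'0 f0 x x0.
have [c cx E] : exists2 c, c \in `[0, x]%R & f x - f 0 = f' c * (x - 0).
  apply: MVT_segment => //.
    by move=> y; rewrite in_itv /= => /andP[y0 _]; apply: df; exact: ltW.
  apply: derivable_within_continuous => y; rewrite in_itv /= => /andP[y0 _].
  by have := df _ y0 => -[].
apply: le_trans f0 _; rewrite -subr_ge0 E subr0 mulr_ge0// f'0//.
by move: cx; rewrite in_itv /= => /andP[].
Qed.

Lemma is_derive_ln_comp (g : R -> R) x dg : 0 < g x -> is_derive x 1 g dg ->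
  is_derive x 1 (fun y => ln (g y)) (dg / g x).
Proof.
move=> g0 Hg; have h := is_derive1_ln g0.
by have := is_derive1_comp h Hg; rewrite mulrC.
Qed.

Lemma is_derive_funD (f g : R -> R) x df dg : is_derive x 1 f df -> is_derive x 1 g dg ->
  is_derive x 1 (fun y => f y + g y) (df + dg).
Proof. by move=> hf hg; exact: is_deriveD. Qed.

Lemma is_derive_funZ c n x : is_derive x 1 (fun y : R => c * y ^+ n.+1) (c * (n.+1%:R * x ^+ n)).
Proof.
have h := @is_deriveX _ _ (@id R) n.+1 x 1 1 (is_derive_id _ _).
have -> : (fun y : R => c * y ^+ n.+1) = c *: ((@id R) ^+ n.+1).
  by apply/funext => y; rewrite !fctE.
apply: (is_derive_eq (is_deriveZ c h)).
by rewrite /GRing.scale /= mulr1.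
Qed.

Lemma is_derive_poly3 (a b c d x : R) :
  is_derive x 1 (fun y => a + (b * y ^+ 1 + (c * y ^+ 2 + d * y ^+ 3))) (b + 2 * c * x + 3 * d * x ^+ 2).
Proof.
have h := is_derive_funD (is_derive_cst a x 1) (is_derive_funD (is_derive_funZ b 0 x)
  (is_derive_funD (is_derive_funZ c 1 x) (is_derive_funZ d 2 x))).
by apply: is_derive_eq h _; rewrite expr0 expr1; ring.
Qed.

(** Common pattern of the logarithmic inequalities below: the expression vanishes at 0 and the
    second hypothesis says that its derivative is nonnegative. The factor [s] chooses between lower
    and upper bounds. *)
Lemma ln_cubic_nonneg (s a b c d : R) (p1 p2 p3 : R) :
  (forall x, 0 <= x -> 0 < 1 + a * x + b * x ^+ 2) ->
  (forall x, 0 <= x -> 0 <= s * ((a + 2 * b * x) / (1 + a * x + b * x ^+ 2)) + (p1 + 2 * p2 * x + 3 * p3 * x ^+ 2)) ->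
  forall x, 0 <= x -> 0 <= s * ln (1 + a * x + b * x ^+ 2) + (p1 * x + p2 * x ^+ 2 + p3 * x ^+ 3).
Proof.
move=> h0 d0; apply: (nonneg_of_derivative (f' := fun x => s * ((a + 2 * b * x) / (1 + a * x + b * x ^+ 2)) + (p1 + 2 * p2 * x + 3 * p3 * x ^+ 2))) => //; last first.
  by rewrite !mulr0 !expr0n /= !mulr0 !addr0 ln1 mulr0.
move=> x x0.
have hg : is_derive x 1 (fun y => 1 + a * y + b * y ^+ 2) (a + 2 * b * x).
  have := is_derive_poly3 1 a b 0 x; rewrite mulr0 mul0r addr0.
  by congr (is_derive _ _ _ _); apply/funext => y; rewrite expr1 mul0r addr0 addrA.
have hl := @is_derive_ln_comp (fun y => 1 + a * y + b * y ^+ 2) x _ (h0 _ x0) hg.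
have hp : is_derive x 1 (fun y => p1 * y + p2 * y ^+ 2 + p3 * y ^+ 3) (p1 + 2 * p2 * x + 3 * p3 * x ^+ 2).
  have := is_derive_poly3 0 p1 p2 p3 x.
  by congr (is_derive _ _ _ _); apply/funext => y; rewrite expr1 add0r addrA.
apply: is_derive_funD hp.
Qed.

Lemma ln1D_ge_quadratic u : 0 <= u -> u - u ^+ 2 / 2 <= ln (1 + u).
Proof.
move=> u0; have := @ln_cubic_nonneg 1 1 0 0 0 (-1) 2^-1 0 _ _ u u0.
rewrite !mul1r !mul0r !addr0 => /(_ _ _) H; rewrite -subr_ge0; apply: le_trans (H _ _) _; last by lra.
- by move=> x x0; rewrite mul0r mul1r; lra.
- move=> x x0; rewrite [X in 0 <= X](_ : _ = x ^+ 2 / (1 + x)); last by field; lra.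
  by rewrite divr_ge0 ?sqr_ge0//; lra.
Qed.

Lemma ln1D_le_cubic x : 0 <= x -> ln (1 + x) <= x - x ^+ 2 / 2 + x ^+ 3 / 3.
Proof.
move=> u0; have := @ln_cubic_nonneg (-1) 1 0 0 0 1 (- 2^-1) 3^-1 _ _ x u0.
rewrite !mul1r !mul0r !addr0 => /(_ _ _) H; rewrite -subr_ge0; apply: le_trans (H _ _) _; last by lra.
- by move=> y y0; rewrite mul0r mul1r; lra.
- move=> y y0; rewrite [X in 0 <= X](_ : _ = y ^+ 3 / (1 + y)); last by field; lra.
  by rewrite divr_ge0 ?exprn_ge0//; lra.
Qed.

Lemma taylor2_ge_half f : 2^-1 <= 1 + f + f ^+ 2 / 2.
Proof. by have := sqr_ge0 (1 + f); rewrite sqrrD; nra. Qed.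

(** The quadratic polynomial stays above 1/2, so its logarithm makes sense for every real f, unlike
    that of 1 + f. For f >= 0 the loss is at most f^3 / 6; for f < 0 there is none. *)
Lemma ln_taylor2_ge f : f - `|f| ^+ 3 <= ln (1 + f + f ^+ 2 / 2).
Proof.
have [f0|f0] := lerP 0 f.
- have := @ln_cubic_nonneg 1 1 2^-1 0 0 (-1) 0 6^-1 _ _ f f0.
  rewrite !mul1r !mul0r addr0 => /(_ _ _) H.
  have : 0 <= ln (1 + f + 2^-1 * f ^+ 2) + (-1 * f + 6^-1 * f ^+ 3).
    apply: H.
    + by move=> y y0; have := taylor2_ge_half y; rewrite mul1r; lra.
    + move=> y y0; have h := taylor2_ge_half y.
      rewrite [X in 0 <= X](_ : _ = (y ^+ 2 / 2) * ((y + y ^+ 2 / 2) / (1 + y + 2^-1 * y ^+ 2))); last by field; lra.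
      rewrite mulr_ge0 ?divr_ge0 ?sqr_ge0//; last by lra.
      by rewrite addr_ge0// divr_ge0 ?sqr_ge0.
  rewrite ger0_norm// (mulrC _ (f ^+ 2)) => {}H.
  have f3 : 0 <= f ^+ 3 by rewrite exprn_ge0.
  by rewrite -subr_ge0; apply: le_trans H _; lra.
- have g0 : 0 <= - f by lra.
  have := @ln_cubic_nonneg 1 (-1) 2^-1 0 0 1 0 0 _ _ (- f) g0.
  rewrite !mul1r !mul0r !addr0 => /(_ _ _) H.
  have : 0 <= ln (1 + -1 * - f + 2^-1 * (- f) ^+ 2) + - f.
    apply: H.
    + by move=> y y0; have := taylor2_ge_half (- y); rewrite sqrrN; lra.
    + move=> y y0; have h := taylor2_ge_half (- y); rewrite sqrrN in h.
      rewrite [X in 0 <= X](_ : _ = (y ^+ 2 / 2) / (1 + -1 * y + 2^-1 * y ^+ 2)); last by field; lra.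
      by rewrite !divr_ge0 ?sqr_ge0//; lra.
  rewrite sqrrN mulN1r opprK (mulrC _ (f ^+ 2)) => {}H.
  have f3 : 0 <= `|f| ^+ 3 by rewrite exprn_ge0.
  by rewrite -subr_ge0; apply: le_trans H _; lra.
Qed.

End logarithm_bounds.

(** * Uniqueness of finite laws through cosines *)

Section bounded_functionals.
Context d (E : measurableType d) (R : realType).
Implicit Types (f g : E -> R) (L : (E -> R) -> R).

Definition bounded_measurable f :=
  measurable_fun [set: E] f /\ exists M : R, forall x, `|f x| <= M.

(** Linear functionals continuous under bounded pointwise convergence, that is, finite signed
    measures. The difference of two weighted laws living on different spaces is of this kind, and
    equality of laws becomes the vanishing of one functional. *)
Definition bounded_continuous L :=
  (forall (a : R) f g, bounded_measurable f -> bounded_measurable g ->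
     L (fun x => a * f x + g x) = a * L f + L g) /\
  (forall (f_ : nat -> E -> R) f (M : R),
     (forall n, measurable_fun [set: E] (f_ n)) ->
     (forall n x, `|f_ n x| <= M) ->
     (forall x, f_ n x @[n --> \oo] --> f x) ->
     L (f_ n) @[n --> \oo] --> L f).

Lemma bounded_measurable_cst (c : R) : bounded_measurable (fun _ : E => c).
Proof. by split; [exact: measurable_cst|exists `|c|]. Qed.

Lemma bounded_measurableD f g : bounded_measurable f -> bounded_measurable g ->
  bounded_measurable (fun x => f x + g x).
Proof.
move=> [mf [a fa]] [mg [b gb]]; split; first exact: measurable_funD.
exists (a + b) => x; exact: le_trans (ler_normD _ _) (lerD _ _).
Qed.

Lemma bounded_measurableM f g : bounded_measurable f -> bounded_measurable g ->
  bounded_measurable (fun x => f x * g x).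
Proof.
move=> [mf [a fa]] [mg [b gb]]; split; first exact: measurable_funM.
by exists (a * b) => x; rewrite normrM ler_pM.
Qed.

Lemma bounded_measurableZ (c : R) f : bounded_measurable f ->
  bounded_measurable (fun x => c * f x).
Proof. exact/bounded_measurableM/bounded_measurable_cst. Qed.

Lemma bounded_measurableN f : bounded_measurable f ->
  bounded_measurable (fun x => - f x).
Proof.
move=> /(bounded_measurableZ (-1)).
by under eq_fun do rewrite mulN1r.
Qed.

Lemma bounded_measurable_indic (A : set E) : measurable A ->
  bounded_measurable (\1_A : E -> R).
Proof.
move=> mA; split; first exact: measurable_indic.
by exists 1 => x; rewrite indicE; case: (x \in A); rewrite ?normr1 ?normr0.
Qed.

Lemma bounded_measurable_sum (I : Type) (r : seq I) (F : I -> E -> R) :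
  (forall i, bounded_measurable (F i)) ->
  bounded_measurable (fun x => \sum_(i <- r) F i x).
Proof.
move=> bF; elim: r => [|i r IH].
  by under eq_fun do rewrite big_nil; exact: bounded_measurable_cst.
by under eq_fun do rewrite big_cons; exact: bounded_measurableD.
Qed.

Lemma bounded_measurable_prod (I : Type) (r : seq I) (p : pred I)
    (F : I -> E -> R) :
  (forall i, bounded_measurable (F i)) ->
  bounded_measurable (fun x => \prod_(i <- r | p i) F i x).
Proof.
move=> bF; elim: r => [|i r IH].
  by under eq_fun do rewrite big_nil; exact: bounded_measurable_cst.
under eq_fun do rewrite big_cons.
by case: (p i) => //; exact: bounded_measurableM.
Qed.

Section theory.
Variable L : (E -> R) -> R.
Hypothesis LC : bounded_continuous L.

Lemma bcont0 : L (fun _ => 0) = 0.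
Proof.
have [+ _] := LC => /(_ 1 _ _ (bounded_measurable_cst 0) (bounded_measurable_cst 0)).
under eq_fun do rewrite mulr0 addr0.
by rewrite mul1r => /eqP; rewrite -subr_eq0 opprD addNKr oppr_eq0 => /eqP.
Qed.

Lemma bcontZ (a : R) f : bounded_measurable f -> L (fun x => a * f x) = a * L f.
Proof.
move=> bf; have [+ _] := LC => /(_ a _ _ bf (bounded_measurable_cst 0)).
by under eq_fun do rewrite addr0; rewrite bcont0 addr0.
Qed.

Lemma bcontD f g : bounded_measurable f -> bounded_measurable g ->
  L (fun x => f x + g x) = L f + L g.
Proof.
move=> bf bg; have [+ _] := LC => /(_ 1 _ _ bf bg).
by under eq_fun do rewrite mul1r; rewrite mul1r.
Qed.

Lemma bcontB f g : bounded_measurable f -> bounded_measurable g ->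
  L (fun x => f x - g x) = L f - L g.
Proof.
move=> bf bg; rewrite bcontD//; last exact: bounded_measurableN.
congr (_ + _); rewrite -mulN1r -bcontZ//; congr L.
by apply/funext => x; rewrite mulN1r.
Qed.

Lemma bcont_sum (I : Type) (r : seq I) (F : I -> E -> R) :
  (forall i, bounded_measurable (F i)) ->
  L (fun x => \sum_(i <- r) F i x) = \sum_(i <- r) L (F i).
Proof.
move=> bF; elim: r => [|i r IH].
  by rewrite big_nil -[RHS]bcont0; congr L; apply/funext => x; rewrite big_nil.
rewrite big_cons -IH -bcontD//; last exact: bounded_measurable_sum.
by congr L; apply/funext => x; rewrite big_cons.
Qed.

Lemma bcont_lim0 (f_ : nat -> E -> R) f (M : R) :
  (forall n, measurable_fun [set: E] (f_ n)) ->
  (forall n x, `|f_ n x| <= M) ->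
  (forall x, f_ n x @[n --> \oo] --> f x) ->
  (forall n, L (f_ n) = 0) -> L f = 0.
Proof.
move=> mf fM ff Lf; have [_ /(_ _ _ _ mf fM ff)] := LC.
under eq_fun do rewrite Lf.
by move=> /(cvg_unique _ (cvg_cst _)) => <-.
Qed.

(** Dynkin's argument: the sets whose indicator is killed form a lambda-system, by linearity for
    proper differences and by bounded convergence for increasing unions. *)
Lemma bcont_indic0 (G : set (set E)) : @measurable _ E = <<s G >> ->
  setI_closed G -> L (\1_[set: E]) = 0 ->
  (forall A, G A -> L (\1_A) = 0) -> forall A, measurable A -> L (\1_A) = 0.
Proof.
move=> mG GI LT LG A mA.
pose H := [set A : set E | measurable A /\ L (\1_A) = 0].
suff GH : <<s G >> `<=` H by have [] : H A by apply: GH; rewrite -mG.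
apply: lambda_system_subset => //.
- split => //=.
  + move=> B C BC [mB LB] [mC LC']; split; first exact: measurableD.
    rewrite (_ : \1_(B `\` C) = fun x => \1_B x - \1_C x).
      by rewrite bcontB ?LB ?LC' ?subr0//; exact: bounded_measurable_indic.
    apply/funext => x; rewrite !indicE in_setD.
    have [xC|xC] /= := boolP (x \in C); last by rewrite andbT subr0.
    by rewrite andbF (mem_set (BC _ (set_mem xC))) subrr.
  + move=> F ndF FH; split; first by apply: bigcup_measurable => i _; case: (FH i).
    apply: (@bcont_lim0 (fun n => \1_(F n)) _ 1).
    * by move=> n; apply: measurable_indic; case: (FH n).
    * by move=> n x; rewrite indicE; case: (_ \in _); rewrite ?normr1 ?normr0.
    * move=> x; have [[n _ Fnx]|nx] := pselect ((\bigcup_i F i) x).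
        apply: cvg_near_cst; exists n => // m /= nm.
        rewrite !indicE !mem_set//; first by exists n.
        by move/subsetPset : (ndF _ _ nm); exact.
      apply: cvg_near_cst; near=> m.
      rewrite !indicE !memNset// => Fmx; apply: nx; by exists m.
    * by move=> n; case: (FH n).
- by move=> B GB; split; [rewrite mG; exact: sub_sigma_algebra|exact: LG].
Unshelve. all: end_near. Qed.

(** Adding the bound [M] makes the function nonnegative, so that it is an increasing limit of simple
    functions; the constant is removed at the end through the indicator of the whole space. *)
Lemma bcont_bounded0 : (forall A, measurable A -> L (\1_A) = 0) ->
  forall f, bounded_measurable f -> L f = 0.
Proof.
move=> L1 f [mf [M fM]].
have M0 x : 0 <= f x + M by have := fM x; rewrite ler_norml => /andP[]; lra.
pose g x := (f x + M)%:E.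
have mg : measurable_fun [set: E] g.
  by apply/measurable_EFinP; exact: measurable_funD.
have g0 x : [set: E] x -> (0 <= g x)%E by move=> _; rewrite lee_fin.
pose h := nnsfun_approx measurableT mg.
have Lh n : L (fun x => h n x) = 0.
  rewrite (_ : (fun x => h n x) =
      fun x => \sum_(y <- fset_set (range (h n))) y * \1_(h n @^-1` [set y]) x).
    rewrite bcont_sum.
      rewrite big1// => y _; rewrite bcontZ ?L1 ?mulr0//.
      exact: bounded_measurable_indic.
    by move=> y; apply: bounded_measurableZ; exact: bounded_measurable_indic.
  by apply/funext => x; rewrite [LHS]fimfunE fsbig_finite.
have hle n x : h n x <= f x + M.
  by rewrite -lee_fin nnsfun_approxE; exact: le_approx.
suff : L (fun x => f x + M) = 0.
  move=> LfM; rewrite (_ : f = fun x => (f x + M) - M * \1_[set: E] x).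
    rewrite bcontB ?LfM ?bcontZ ?L1 ?mulr0 ?subr0//.
    - exact: bounded_measurable_indic.
    - apply: bounded_measurableD; [by split; [|exists M]|].
      exact: bounded_measurable_cst.
    - by apply: bounded_measurableZ; exact: bounded_measurable_indic.
  by apply/funext => x; rewrite indicT mulr1 addrK.
apply: (@bcont_lim0 (fun n x => h n x) _ (M + M)) => //.
- move=> n x; rewrite ger0_norm//; apply: le_trans (hle n x) _.
  by rewrite lerD2r; apply: le_trans (fM x); exact: ler_norm.
- move=> x; have := cvg_nnsfun_approx measurableT mg g0 (x := x) I.
  by move/fine_cvg => /=.
Qed.

End theory.
End bounded_functionals.

Section real_integrable.
Context d (T : measurableType d) (R : realType) (mu : {measure set T -> \bar R}).
Implicit Types f g : T -> R.

Definition rintegrable f := mu.-integrable [set: T] (EFin \o f).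

Lemma rintegrable_measurable f : rintegrable f -> measurable_fun [set: T] f.
Proof. by move=> fi; apply/measurable_EFinP; exact: measurable_int fi. Qed.

Lemma rintegrable_eq f g : f =1 g -> rintegrable f -> rintegrable g.
Proof. by move=> /funext ->. Qed.

Lemma rintegrableZ c f : rintegrable f -> rintegrable (fun x => c * f x).
Proof. exact: (integrableZl measurableT c). Qed.

Lemma rintegrableD f g : rintegrable f -> rintegrable g ->
  rintegrable (fun x => f x + g x).
Proof. exact: (integrableD measurableT). Qed.

Lemma rintegrableB f g : rintegrable f -> rintegrable g ->
  rintegrable (fun x => f x - g x).
Proof. exact: (integrableB measurableT). Qed.

Lemma rintegrable_le f g : measurable_fun [set: T] f -> rintegrable g ->
  (forall x, `|f x| <= g x) -> rintegrable f.
Proof.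
move=> mf ig fg; apply: (@le_integrable _ _ _ mu _ measurableT _ (EFin \o g)) => //.
- exact/measurable_EFinP.
- move=> x _ /=; rewrite lee_fin; exact: le_trans (ler_norm _).
Qed.

Lemma rintegrable_norm f : rintegrable f -> rintegrable (fun x => `|f x|).
Proof.
move=> fi; apply: rintegrable_eq (integrable_norm fi) => //.
Qed.

Lemma rintegrable_sum (I : Type) (r : seq I) (F : I -> T -> R) :
  rintegrable (fun _ => 0) -> (forall i, rintegrable (F i)) ->
  rintegrable (fun x => \sum_(i <- r) F i x).
Proof.
move=> i0 iF; elim: r => [|i r IH].
  by apply: rintegrable_eq i0 => x; rewrite big_nil.
by apply: rintegrable_eq (rintegrableD (iF i) IH) => x; rewrite big_cons.
Qed.

Lemma rintegral_sum (I : Type) (r : seq I) (F : I -> T -> R) :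
  (forall i, rintegrable (F i)) ->
  \int[mu]_x (\sum_(i <- r) F i x) = \sum_(i <- r) \int[mu]_x F i x.
Proof.
move=> iF; elim: r => [|i r IH].
  rewrite big_nil; under eq_Rintegral do rewrite big_nil.
  by rewrite /Rintegral integral0.
rewrite big_cons -IH -RintegralD//.
- by apply: eq_Rintegral => x _; rewrite big_cons.
- exact: iF.
apply: rintegrable_sum => //.
by apply: rintegrable_eq (rintegrableZ 0 (iF i)) => x; rewrite mul0r.
Qed.

Lemma rintegralE f : rintegrable f -> (\int[mu]_x (f x)%:E)%E = (\int[mu]_x f x)%:E.
Proof. by move=> fi; rewrite /Rintegral fineK//; exact: integrable_fin_num fi. Qed.

End real_integrable.

Section functional_examples.
Context d (E : measurableType d) (R : realType).

Lemma bounded_continuous_integral d' (T : measurableType d')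
    (mu : {measure set T -> \bar R}) (V : T -> R) (phi : T -> E) :
  rintegrable mu V -> measurable_fun [set: T] phi ->
  bounded_continuous (fun f => \int[mu]_x (V x * f (phi x))).
Proof.
move=> iV mphi; have mV := rintegrable_measurable iV.
have bI f : bounded_measurable f -> rintegrable mu (fun x => V x * f (phi x)).
  move=> [mf [M fM]].
  apply: rintegrable_le (rintegrableZ M (rintegrable_norm iV)) _.
    by apply: measurable_funM => //; exact: measurableT_comp mf mphi.
  by move=> x; rewrite normrM mulrC ler_wpM2r.
split.
- move=> a f g bf bg.
  under eq_Rintegral => x _ do rewrite mulrDr mulrCA.
  rewrite RintegralD//; last exact: bI.
    by rewrite RintegralZl//; exact: bI.
  exact: rintegrableZ (bI _ bf).
- move=> f_ f M mf_ fM ff.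
  have mf : measurable_fun [set: E] f.
    by apply: measurable_fun_cvg mf_ _ => x _; exact: ff.
  have [] := @dominated_convergence _ _ _ mu _ measurableT
     (fun n x => (V x * f_ n (phi x))%:E) (fun x => (V x * f (phi x))%:E)
     (fun x => (M * `|V x|)%:E).
  + move=> n; apply/measurable_EFinP/measurable_funM => //.
    exact: measurableT_comp (mf_ n) mphi.
  + apply/measurable_EFinP/measurable_funM => //.
    exact: measurableT_comp mf mphi.
  + apply: aeW => x _; apply: cvg_EFin; first exact: nearW.
    exact: cvgMr (ff (phi x)).
  + exact: rintegrableZ (rintegrable_norm iV).
  + apply: aeW => x n _ /=; rewrite lee_fin normrM mulrC ler_wpM2r//.
  + by move=> fi _; rewrite rintegralE// => /fine_cvg.
Qed.

Lemma bounded_continuousB (L1 L2 : (E -> R) -> R) (c : R) :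
  bounded_continuous L1 -> bounded_continuous L2 ->
  bounded_continuous (fun f => L1 f - c * L2 f).
Proof.
move=> [l1 c1] [l2 c2]; split.
- by move=> a f g bf bg; rewrite l1// l2//; ring.
- move=> f_ f M mf fM ff; apply: cvgB; first exact: c1 ff.
  by apply: cvgMr; exact: c2 ff.
Qed.

End functional_examples.

(** * Polynomials converging to a step, and uniqueness through cosines *)

Section step_limit.
Variable R : realType.
Implicit Types u x : R.

Lemma bernoulli_le1 u m : 0 <= u <= 1 -> 1 - m%:R * u <= (1 - u) ^+ m.
Proof.
move=> /andP[u0 u1]; elim: m => [|m IH]; first by rewrite mul0r subr0 expr0.
rewrite exprSr; apply: le_trans (_ : (1 - m%:R * u) * (1 - u) <= _); last first.
  by rewrite ler_wpM2r// subr_ge0.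
rewrite -natr1; have : 0 <= m%:R * u * u by rewrite !mulr_ge0.
nra.
Qed.

Lemma exp_1B_le u m : 0 <= u <= 1 -> (1 - u) ^+ m <= (1 + m%:R * u)^-1.
Proof.
move=> /andP[u0 u1]; elim: m => [|m IH]; first by rewrite mul0r addr0 invr1.
have p k : 0 < 1 + k%:R * u by rewrite ltr_pwDl// mulr_ge0.
rewrite exprSr; apply: le_trans (_ : (1 + m%:R * u)^-1 * (1 - u) <= _).
  by rewrite ler_wpM2r// subr_ge0.
rewrite mulrC ler_pdivrMr// ler_pdivlMl// -natr1.
have : 0 <= m%:R * u * u by rewrite !mulr_ge0.
nra.
Qed.

(** Each of the n terms of the geometric sum is at least u^n. *)
Lemma natr_mul_expr_le u n : 0 <= u < 1 -> n%:R * u ^+ n <= (1 - u)^-1.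
Proof.
move=> /andP[u0 u1]; rewrite -[leRHS]mul1r ler_pdivlMr ?subr_gt0//.
apply: le_trans (_ : (\sum_(i < n) u ^+ i) * (1 - u) <= _).
  rewrite ler_wpM2r ?subr_ge0 ?(ltW u1)//.
  rewrite -[n in n%:R]card_ord mulr_natl -sumr_const ler_sum// => i _.
  by apply: ler_wiXn2l; [|exact: ltW|exact: ltnW].
have -> : (\sum_(i < n) u ^+ i) * (1 - u) = 1 - u ^+ n.
  by rewrite -[RHS]opprB subrX1 mulrC -mulNr opprB.
by rewrite lerBlDr lerDl exprn_ge0.
Qed.

Lemma cvg_natr_mul_expr u : 0 <= u < 1 -> n%:R * u ^+ n @[n --> \oo] --> 0.
Proof.
move=> /andP[u0 u1].
(* With u = v^2, one factor v^n absorbs the factor n and the other one tends to 0. *)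
set v := Num.sqrt u.
have v1 : v < 1 by rewrite -[ltRHS]sqrtr1 ltr_sqrt.
have uE : u = v * v by rewrite -expr2 sqr_sqrtr.
apply: (@squeeze_cvgr _ _ _ _ (fun=> 0) (fun n => (1 - v)^-1 * v ^+ n)).
- apply: nearW => n; rewrite mulr_ge0 ?exprn_ge0//=.
  rewrite {1}uE exprMn mulrA ler_wpM2r ?exprn_ge0 ?sqrtr_ge0//.
  by apply: natr_mul_expr_le; rewrite sqrtr_ge0.
- exact: cvg_cst.
- rewrite -[0 in X in _ --> X](mulr0 (1 - v)^-1); apply: cvgMr.
  by apply: cvg_expr; rewrite ger0_norm ?sqrtr_ge0.
Qed.

(* The multiplicity [n * 2 ^ n] makes the limit at the threshold [u = 1/2] equal to 0. *)
Lemma cvg_step u : 0 <= u <= 1 ->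
  (1 - u ^+ n) ^+ (n * 2 ^ n)%N @[n --> \oo] --> ((u < 2^-1)%R%:R : R).
Proof.
move=> /andP[u0 u1].
have un n : 0 <= u ^+ n <= 1 by rewrite exprn_ge0// exprn_ile1.
have [u2|u2] := ltP u 2^-1.
- apply: (@squeeze_cvgr _ _ _ _ (fun n => 1 - n%:R * (2 * u) ^+ n) (fun=> 1)).
  + apply: nearW => n; apply/andP; split.
      have := bernoulli_le1 (n * 2 ^ n)%N (un n).
      by rewrite natrM natrX -mulrA -exprMn.
    have /andP[a b] := un n.
    by apply: exprn_ile1; [rewrite subr_ge0|rewrite lerBlDr lerDl].
  + rewrite -[1%:R]subr0; apply: cvgB; first exact: cvg_cst.
    by apply: cvg_natr_mul_expr; lra.
  + exact: cvg_cst.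
- apply: (@squeeze_cvgr _ _ _ _ (fun=> 0) (fun n => (n.+1%:R)^-1)).
  + apply: nearW => n; have /andP[a b] := un n.
    rewrite exprn_ge0 ?subr_ge0//=; apply: le_trans (exp_1B_le _ (un n)) _.
    rewrite lef_pV2 ?posrE ?ltr0n//; last by rewrite ltr_pwDl// mulr_ge0.
    rewrite -natr1 addrC lerD2l natrM natrX -mulrA -exprMn ler_peMr//.
    by rewrite exprn_ege1//; lra.
  + exact: cvg_cst.
  + exact: cvg_harmonic.
Qed.

End step_limit.

Section trigonometric_uniqueness.
Variables (R : realType) (L : (R -> R) -> R).
Hypothesis LC : bounded_continuous L.
Hypothesis Lcos : forall t a, L (fun x => cos (t * x + a)) = 0.

Let cosine (t a : R) : R -> R := fun x => cos (t * x + a).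

Let bm_cosine t a : bounded_measurable (cosine t a).
Proof.
split; last by exists 1 => x; rewrite ler_norml cos_geN1 cos_le1.
apply: measurableT_comp; first exact: (continuous_measurable_fun (@continuous_cos R)).
by apply: measurable_funD => //; exact: measurable_funM.
Qed.

(* The bounded functions [g] such that [L] vanishes on all [g * cos]; this class is
   stable under multiplication by cosines, unlike the kernel of [L]. *)
Let W (g : R -> R) := bounded_measurable g /\
  forall t a, L (fun x => g x * cosine t a x) = 0.

Let W1 : W (fun=> 1).
Proof.
split; first exact: bounded_measurable_cst.
by move=> t a; under eq_fun do rewrite mul1r; exact: Lcos.
Qed.

Let WD f g : W f -> W g -> W (fun x => f x + g x).
Proof.
move=> [bf Lf] [bg Lg]; split; first exact: bounded_measurableD.
move=> t a; under eq_fun do rewrite mulrDl.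
by rewrite bcontD ?Lf ?Lg ?addr0//; exact: bounded_measurableM.
Qed.

Let WZ c f : W f -> W (fun x => c * f x).
Proof.
move=> [bf Lf]; split; first exact: bounded_measurableZ.
move=> t a; under eq_fun do rewrite -mulrA.
by rewrite bcontZ ?Lf ?mulr0//; exact: bounded_measurableM.
Qed.

Let WB f g : W f -> W g -> W (fun x => f x - g x).
Proof.
move=> wf /(WZ (-1)) wg; have := WD wf wg.
by under eq_fun do rewrite mulN1r.
Qed.

Let Wcos s b f : W f -> W (fun x => f x * cosine s b x).
Proof.
move=> [bf Lf]; split; first exact: bounded_measurableM.
move=> t a.
rewrite (_ : (fun x => _) = fun x => 2^-1 * (f x * cosine (s + t) (b + a) x +
    f x * cosine (s - t) (b - a) x)).
  rewrite bcontZ ?bcontD ?Lf ?addr0 ?mulr0//; try exact: bounded_measurableM.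
  by apply: bounded_measurableD; exact: bounded_measurableM.
apply/funext => x; rewrite /cosine.
have -> : (s + t) * x + (b + a) = (s * x + b) + (t * x + a) by ring.
have -> : (s - t) * x + (b - a) = (s * x + b) - (t * x + a) by ring.
by move: (s * x + b) (t * x + a) => p q; rewrite cosD cosB; field.
Qed.

Let W_lim (f_ : nat -> R -> R) f (M : R) :
  (forall n, W (f_ n)) -> (forall n x, `|f_ n x| <= M) ->
  (forall x, f_ n x @[n --> \oo] --> f x) -> W f.
Proof.
move=> Wf fM ff.
have mf : measurable_fun [set: R] f.
  by apply: (@measurable_fun_cvg _ _ _ _ f_) => [m|x _]; [by case: (Wf m) => -[]|exact: ff].
split.
  split=> //; exists M => x.
  rewrite -(cvg_lim _ (cvg_norm (ff x)))//; apply: limr_le; first by apply/cvg_ex; exists `|f x|; exact: cvg_norm (ff x).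
  exact: nearW.
move=> t a.
apply: (bcont_lim0 LC (f_ := fun n x => f_ n x * cosine t a x) (M := M)).
- move=> n; apply: measurable_funM; first by case: (Wf n) => -[].
  by case: (bm_cosine t a).
- move=> n x; rewrite normrM -[leRHS]mulr1 ler_pM// ler_norml cos_geN1.
  exact: cos_le1.
- by move=> x; apply: cvgMl; exact: ff.
- by move=> n; case: (Wf n).
Qed.

Let square_wave s b : R -> R := fun x => (0 < sin (s * x + b))%R%:R.

Let W_square s b f : W f -> W (fun x => f x * square_wave s b x).
Proof.
move=> wf.
(* The sine is positive exactly when u < 1/2, so the step limit turns polynomials in u, which
   preserve the class, into the square wave. *)
pose u x := (1 - sin (s * x + b)) / 2.
have u01 x : 0 <= u x <= 1.
  by have := sin_le1 (s * x + b); have := sin_geN1 (s * x + b); rewrite /u; lra.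
have Wu g : W g -> W (fun x => g x * u x).
  move=> wg; rewrite (_ : (fun x => _) = fun x => 2^-1 * (g x - g x * cosine s (b - pi / 2) x)).
    by apply: WZ; apply: WB => //; exact: Wcos.
  by apply/funext => x; rewrite /cosine /u addrA cosBpihalf; field.
have Wun g n : W g -> W (fun x => g x * u x ^+ n).
  move=> wg; elim: n => [|n IH]; first by under eq_fun do rewrite expr0 mulr1.
  by under eq_fun do rewrite exprSr mulrA; exact: Wu.
have W1un g n m : W g -> W (fun x => g x * (1 - u x ^+ n) ^+ m).
  move=> wg; elim: m => [|m IH]; first by under eq_fun do rewrite expr0 mulr1.
  under eq_fun do rewrite exprSr mulrA mulrBr mulr1.
  by apply: WB => //; exact: Wun.
have [[mf [M fM]] _] := wf.
apply: (@W_lim (fun n x => f x * (1 - u x ^+ n) ^+ (n * 2 ^ n)%N) _ M).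
- by move=> n; exact: W1un.
- move=> n x; rewrite normrM -[leRHS]mulr1 ler_pM// ger0_norm.
    by apply: exprn_ile1; rewrite ?subr_ge0 ?lerBlDr ?lerDl ?exprn_ge0 ?exprn_ile1//;
      have /andP[] := u01 x.
  by rewrite exprn_ge0// subr_ge0 exprn_ile1//; have /andP[] := u01 x.
- move=> x; apply: cvgMr.
  rewrite /square_wave (_ : (0 < _) = (u x < 2^-1)); first exact: cvg_step.
  by rewrite /u; apply/idP/idP; lra.
Qed.

(** Square waves centred at a, with periods tending to infinity: once |x - a| < n + 1 the angle (x -
    a) / (n + 1) lies within (-pi, pi), and its sine has the sign of x - a. *)
Let W_halfline a : W (\1_[set x | a < x]).
Proof.
apply: (@W_lim (fun n x => 1 * square_wave (n.+1%:R^-1) (- (a / n.+1%:R)) x) _ 1).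
- by move=> n; exact: W_square.
- by move=> n x; rewrite mul1r /square_wave; case: (0 < _); rewrite ?normr1 ?normr0.
- move=> x; apply: cvg_near_cst; near=> n.
  rewrite mul1r /square_wave indicE.
  have -> : n.+1%:R^-1 * x - a / n.+1%:R = (x - a) / n.+1%:R by field.
  have xn : `|x - a| < n.+1%:R.
    apply: (@lt_le_trans _ _ n%:R); last by rewrite ler_nat.
    by near: n; exact: nbhs_infty_gtr.
  have xn1 : `|(x - a) / n.+1%:R| < 1.
    by rewrite normrM [X in _ * X]ger0_norm ?invr_ge0// ltr_pdivrMr ?ltr0n// mul1r.
  have pi1 : (1 : R) < pi by apply: lt_le_trans (pi_ge2 _); lra.
  move: xn1; rewrite ltr_norml => /andP[y1 y2].
  have [ax|xa] := ltP a x.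
    rewrite mem_set// sin_gt0_pi//; rewrite divr_gt0 ?subr_gt0 ?ltr0n//=.
    exact: lt_trans pi1.
  rewrite memNset/=; last by apply/negP; rewrite -leNgt.
  rewrite (_ : (0 < _) = false)//; apply/negbTE.
  rewrite -leNgt -oppr_ge0 -sinN; apply: sin_ge0_pi.
  rewrite oppr_ge0 pmulr_lle0 ?invr_gt0 ?ltr0n// subr_le0 xa/=.
  by rewrite lerNl ltW// (lt_trans _ y1)// ltrN2.
Unshelve. all: end_near. Qed.

(** Injectivity of the Fourier transform of a finite signed measure, with a phase in the cosine in
    place of complex exponentials. Half-lines generate the Borel sets and are stable under
    intersection. *)
Lemma trigonometric_uniqueness g : bounded_measurable g -> L g = 0.
Proof.
have L1 a : L (\1_[set x | a < x]) = 0.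
  have [_ /(_ 0 0)] := W_halfline a.
  rewrite /cosine; under eq_fun do rewrite mul0r addr0 cos0 mulr1.
  by [].
have LT : L (\1_[set: R]) = 0.
  rewrite (_ : \1_[set: R] = fun x => cos (0 * x + 0)) ?Lcos//.
  by apply/funext => x; rewrite indicT mul0r addr0 cos0.
move: g; apply: (bcont_bounded0 LC) => A.
apply: (bcont_indic0 LC (G := RGenOInfty.G (R := R))) => // {A}.
- exact: RGenOInfty.measurableE.
- move=> _ _ [a ->] [b ->]; exists (Num.max a b).
  by apply/seteqP; split => x /=; rewrite !in_itv/= !andbT gt_max; [case=> -> ->|move/andP].
- move=> _ [a ->]; rewrite (_ : [set` _] = [set x | a < x]) ?L1//.
  by apply/seteqP; split => x /=; rewrite in_itv/= andbT.
Qed.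

End trigonometric_uniqueness.

Section nonnegative_extension.
Context d (E : measurableType d) (R : realType).
Context d1 (T1 : measurableType d1) (mu1 : {measure set T1 -> \bar R}).
Context d2 (T2 : measurableType d2) (mu2 : {measure set T2 -> \bar R}).
Variables (V1 : T1 -> R) (V2 : T2 -> R) (phi1 : T1 -> E) (phi2 : T2 -> E).
Hypotheses (iV1 : rintegrable mu1 V1) (iV2 : rintegrable mu2 V2).
Hypotheses (mphi1 : measurable_fun [set: T1] phi1) (mphi2 : measurable_fun [set: T2] phi2).

Let Ldiff (f : E -> R) :=
  \int[mu1]_x (V1 x * f (phi1 x)) - 1 * \int[mu2]_x (V2 x * f (phi2 x)).

Lemma bounded_continuous_diff : bounded_continuous Ldiff.
Proof. by apply: bounded_continuousB; exact: bounded_continuous_integral. Qed.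

Lemma eq_bounded_integral :
  (forall A, measurable A ->
    \int[mu1]_x (V1 x * \1_A (phi1 x)) = \int[mu2]_x (V2 x * \1_A (phi2 x))) ->
  forall f, bounded_measurable f ->
    \int[mu1]_x (V1 x * f (phi1 x)) = \int[mu2]_x (V2 x * f (phi2 x)).
Proof.
move=> H f bf; apply/eqP; rewrite -subr_eq0 -[X in _ - X]mul1r; apply/eqP.
apply: (bcont_bounded0 bounded_continuous_diff) bf => A mA.
by rewrite /Ldiff H// mul1r subrr.
Qed.

Hypotheses (V1_ge0 : forall x, 0 <= V1 x) (V2_ge0 : forall x, 0 <= V2 x).

Lemma eq_ge0_integral :
  (forall f, bounded_measurable f ->
    \int[mu1]_x (V1 x * f (phi1 x)) = \int[mu2]_x (V2 x * f (phi2 x))) ->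
  forall f : E -> R, measurable_fun [set: E] f -> (forall x, 0 <= f x) ->
    (\int[mu1]_x (V1 x * f (phi1 x))%:E = \int[mu2]_x (V2 x * f (phi2 x))%:E)%E.
Proof.
move=> H f mf f0.
have mV1 := rintegrable_measurable iV1; have mV2 := rintegrable_measurable iV2.
pose g n x := Num.min (f x) n%:R.
have mg n : measurable_fun [set: E] (g n) by apply: measurable_minr.
have g0 n x : 0 <= g n x by rewrite le_min f0 ler0n.
have bg n : bounded_measurable (g n).
  by split=> //; exists n%:R => x; rewrite ger0_norm// ge_min lexx orbT.
have gf x : limn (fun n => (g n x)%:E) = (f x)%:E.
  apply/cvg_lim => //; apply: cvg_near_cst; near=> n; congr EFin.
  by apply/min_idPl; apply: ltW; near: n; exact: nbhs_infty_gtr.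
have key d' (T : measurableType d') (mu : {measure set T -> \bar R}) (V : T -> R) (phi : T -> E) :
    rintegrable mu V -> measurable_fun [set: T] phi -> (forall x, 0 <= V x) ->
    (\int[mu]_x (V x * f (phi x))%:E = limn (fun n => (\int[mu]_x (V x * g n (phi x)))%:E))%E.
  move=> iV mphi V0; have mV := rintegrable_measurable iV.
  transitivity (limn (fun n => (\int[mu]_x (V x * g n (phi x))%:E)%E)).
    rewrite -monotone_convergence//.
    - apply: eq_integral => x _; apply/esym/cvg_lim => //.
      under eq_fun do rewrite EFinM.
      rewrite EFinM; apply: cvgeZl => //; rewrite -gf; apply/cvg_ex; exists (f (phi x))%:E.
      apply: cvg_near_cst; near=> n; congr EFin.
      by apply/min_idPl; apply: ltW; near: n; exact: nbhs_infty_gtr.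
    - by move=> n; apply/measurable_EFinP/measurable_funM => //; exact: measurableT_comp (mg n) mphi.
    - by move=> n x _; rewrite lee_fin mulr_ge0.
    - move=> x _ m n mn; rewrite lee_fin ler_wpM2l// /g le_min ge_min lexx/= ge_min.
      by rewrite ler_nat mn orbT.
  congr (limn _); apply/funext => n; rewrite rintegralE//.
  apply: rintegrable_le (rintegrableZ n%:R iV) _.
    by apply: measurable_funM => //; exact: measurableT_comp (mg n) mphi.
  move=> x; rewrite normrM ger0_norm// ger0_norm// mulrC ler_wpM2r//.
  by rewrite ge_min lexx orbT.
rewrite (key _ _ mu1)// (key _ _ mu2)//; congr (limn _); apply/funext => n.
by rewrite H.
Unshelve. all: end_near. Qed.

Lemma eq_ge0_integral_indic :
  (forall A, measurable A ->
    \int[mu1]_x (V1 x * \1_A (phi1 x)) = \int[mu2]_x (V2 x * \1_A (phi2 x))) ->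
  forall f : E -> R, measurable_fun [set: E] f -> (forall x, 0 <= f x) ->
    (\int[mu1]_x (V1 x * f (phi1 x))%:E = \int[mu2]_x (V2 x * f (phi2 x))%:E)%E.
Proof. by move=> H; apply: eq_ge0_integral; exact: eq_bounded_integral. Qed.

End nonnegative_extension.

(** * Real normal variables and independence *)

Section probability_integrals.
Context d (T : measurableType d) (R : realType) (P : probability T R).

Lemma rintegrable_cst (c : R) : rintegrable P (fun=> c).
Proof. exact: finite_measure_integrable_cst. Qed.

Lemma Rintegral_prob_cst (c : R) : \int[P]_x c = c.
Proof.
rewrite Rintegral_cst; last exact: measurableT.
by rewrite [X in fine X](@probability_setT _ _ _ P) mulr1.
Qed.

Lemma rintegrable_bounded d' (E : measurableType d') (U : T -> E) (f : E -> R) :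
  measurable_fun [set: T] U -> bounded_measurable f ->
  rintegrable P (fun x => f (U x)).
Proof.
move=> mU [mf [M fM]]; apply: rintegrable_le (rintegrable_cst M) _.
- exact: (measurableT_comp mf).
- by move=> x; exact: fM.
Qed.

End probability_integrals.

Section same_law.
Context d (E : measurableType d) (R : realType).
Context d1 (T1 : measurableType d1) (P1 : probability T1 R).
Context d2 (T2 : measurableType d2) (P2 : probability T2 R).
Variables (phi1 : T1 -> E) (phi2 : T2 -> E).
Hypotheses (mphi1 : measurable_fun [set: T1] phi1) (mphi2 : measurable_fun [set: T2] phi2).

(** Equality of the laws of two random elements that may live on different probability spaces.
    Bounded test functions avoid integrability conditions; the lemmas below extend the identity to
    nonnegative and to arbitrary measurable functions. *)
Definition same_law := forall f : E -> R, bounded_measurable f ->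
  \int[P1]_x f (phi1 x) = \int[P2]_x f (phi2 x).

Let i1 : rintegrable P1 (fun=> 1). Proof. exact: finite_measure_integrable_cst. Qed.
Let i2 : rintegrable P2 (fun=> 1). Proof. exact: finite_measure_integrable_cst. Qed.

Lemma same_law_set :
  (forall A, measurable A -> P1 (phi1 @^-1` A) = P2 (phi2 @^-1` A)) -> same_law.
Proof.
move=> H f bf.
have := eq_bounded_integral i1 i2 mphi1 mphi2 _ bf.
under eq_Rintegral do rewrite mul1r.
under [in X in _ = X]eq_Rintegral do rewrite mul1r.
apply=> A mA.
under eq_Rintegral do rewrite mul1r.
under [in RHS]eq_Rintegral do rewrite mul1r.
rewrite /Rintegral; congr fine.
transitivity (P1 (phi1 @^-1` A)).
  by rewrite -(setIT (phi1 @^-1` A)) -integral_indic//; rewrite -[X in measurable X]setTI; exact: mphi1.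
by rewrite H// -(setIT (phi2 @^-1` A)) -integral_indic//; rewrite -[X in measurable X]setTI; exact: mphi2.
Qed.

Lemma same_law_ge0 : same_law ->
  forall f : E -> R, measurable_fun [set: E] f -> (forall x, 0 <= f x) ->
  (\int[P1]_x (f (phi1 x))%:E = \int[P2]_x (f (phi2 x))%:E)%E.
Proof.
move=> H f mf f0.
have := eq_ge0_integral i1 i2 mphi1 mphi2 (fun=> ler01) (fun=> ler01) _ mf f0.
under eq_integral do rewrite mul1r.
under [in X in _ = X]eq_integral do rewrite mul1r.
apply=> g bg.
under eq_Rintegral do rewrite mul1r.
under [in RHS]eq_Rintegral do rewrite mul1r.
exact: H.
Qed.

Lemma same_law_of_ge0 :
  (forall f : E -> R, measurable_fun [set: E] f -> (forall x, 0 <= f x) ->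
  (\int[P1]_x (f (phi1 x))%:E = \int[P2]_x (f (phi2 x))%:E)%E) -> same_law.
Proof.
move=> H; apply: same_law_set => A mA.
have mA1 : measurable (phi1 @^-1` A) by rewrite -[X in measurable X]setTI; exact: mphi1.
have mA2 : measurable (phi2 @^-1` A) by rewrite -[X in measurable X]setTI; exact: mphi2.
transitivity (\int[P1]_x (\1_A (phi1 x))%:E)%E.
  by rewrite -(setIT (phi1 @^-1` A)) -integral_indic.
rewrite H//.
by rewrite -(setIT (phi2 @^-1` A)) -integral_indic.
Qed.

Lemma same_law_integral : same_law -> forall f : E -> R, measurable_fun [set: E] f ->
  (\int[P1]_x (f (phi1 x))%:E = \int[P2]_x (f (phi2 x))%:E)%E.
Proof.
move=> H f mf; rewrite integralE [RHS]integralE.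
have mp : measurable_fun [set: E] (fun x => Num.max (f x) 0) by exact: measurable_maxr.
have mn : measurable_fun [set: E] (fun x => Num.max (- f x) 0).
  by apply: measurable_maxr => //; exact: (measurableT_comp (@oppr_measurable R _)).
congr (_ - _)%E.
- transitivity (\int[P1]_x (Num.max (f (phi1 x)) 0)%:E)%E.
    by apply: eq_integral => x _; rewrite funeposE EFin_max.
  rewrite (same_law_ge0 H mp); last by move=> x; rewrite le_max lexx orbT.
  by apply: eq_integral => x _; rewrite funeposE EFin_max.
- transitivity (\int[P1]_x (Num.max (- f (phi1 x)) 0)%:E)%E.
    by apply: eq_integral => x _; rewrite funenegE EFin_max.
  rewrite (same_law_ge0 H mn); last by move=> x; rewrite le_max lexx orbT.
  by apply: eq_integral => x _; rewrite funenegE EFin_max.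
Qed.

Lemma same_law_rintegrable : same_law -> forall f : E -> R, measurable_fun [set: E] f ->
  rintegrable P2 (fun x => f (phi2 x)) -> rintegrable P1 (fun x => f (phi1 x)).
Proof.
move=> H f mf /integrableP[_ fi]; apply/integrableP; split.
  by apply/measurable_EFinP; exact: (measurableT_comp mf).
move: fi; have := same_law_ge0 H (measurableT_comp (@normr_measurable R setT) mf) (fun x => normr_ge0 _).
by move=> <-.
Qed.

End same_law.

Lemma same_law_Rintegral d (E : measurableType d) (R : realType)
  d1 (T1 : measurableType d1) (P1 : probability T1 R)
  d2 (T2 : measurableType d2) (P2 : probability T2 R)
  (phi1 : T1 -> E) (phi2 : T2 -> E) (f : E -> R) :
  same_law P1 P2 phi1 phi2 -> measurable_fun [set: T1] phi1 ->
  measurable_fun [set: T2] phi2 -> measurable_fun [set: E] f ->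
  \int[P1]_x f (phi1 x) = \int[P2]_x f (phi2 x).
Proof.
by move=> L m1 m2 mf; rewrite /Rintegral; congr fine; exact: same_law_integral.
Qed.

Ltac mfun :=
  repeat first
    [ exact: measurable_cst | exact: measurable_id | assumption
    | apply: measurable_funB | apply: measurable_funD | apply: measurable_funM
    | apply: measurable_funX | apply: (measurableT_comp (measurable_normal_pdf _ _))
    | apply: (measurableT_comp (@measurable_expR _))
    | apply: (measurableT_comp (@oppr_measurable _ _))
    | match goal with H : measurable_fun _ _ |- _ =>
        apply: (measurableT_comp H) end ].

(** * The standard normal law: change of variables, moments, cosines *)

Section real_gaussian.
Variable R : realType.
Implicit Types (f : R -> R) (a b c m s t x y : R).
Local Notation leb := (@lebesgue_measure R).

(** The scaled image of Lebesgue measure gives half-open intervals their length, and uniqueness of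
    Lebesgue measure concludes. *)
Lemma lebesgue_affine f m s : 0 < s -> measurable_fun [set: R] f ->
  (forall x, 0 <= f x) ->
  (\int[leb]_x (f x)%:E = s%:E * \int[leb]_x (f (m + s * x))%:E)%E.
Proof.
move=> s0 mf f0.
pose phi (x : measurableTypeR R) : measurableTypeR R := m + s * x.
have mphi : measurable_fun [set: measurableTypeR R] phi.
  by apply: measurable_funD => //; exact: measurable_funM.
have -> : (\int[leb]_x (f (m + s * x))%:E = \int[pushforward leb phi]_x (f x)%:E)%E.
  by rewrite ge0_integral_pushforward//; [exact/measurable_EFinP|move=> x _; rewrite lee_fin].
have s0' : 0 <= s by exact: ltW.
rewrite -(ge0_integral_mscale _ _ (NngNum s0'))//; last 2 first.
- exact/measurable_EFinP.
- by move=> x _; rewrite lee_fin.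
apply: eq_measure_integral => A mA _.
apply: lebesgue_measure_unique => // _ [[a b]] _ <-.
change (leb `]a, b] = s%:E * leb (phi @^-1` `]a, b]%classic))%E.
rewrite (_ : phi @^-1` _ = `](a - m) / s, (b - m) / s]%classic).
  rewrite !lebesgue_measure_itv/= !lte_fin ltr_pM2r ?invr_gt0// ltrD2r.
  case: ifP => ab; last by rewrite mule0.
  by rewrite -!EFinB -EFinM; congr EFin; field; exact: lt0r_neq0.
by apply/seteqP; split => x; rewrite /phi/= !in_itv/= ltr_pdivrMr// ler_pdivlMr// ltrBlDl lerBrDl (mulrC x).
Qed.

Definition gauss : probability (measurableTypeR R) R := normal_prob 0 1.

Lemma normal_integral f m s : measurable_fun [set: R] f -> (forall x, 0 <= f x) ->
  (\int[normal_prob m s]_x (f x)%:E = \int[leb]_x (normal_pdf m s x * f x)%:E)%E.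
Proof.
move=> mf f0.
have -> : (\int[normal_prob m s]_x (f x)%:E = \int[normal_prob m s]_x (1 * f x)%:E)%E.
  by apply: eq_integral => x _; rewrite mul1r.
apply: (@eq_ge0_integral_indic _ (measurableTypeR R) R _ _ (normal_prob m s) _ _ leb (fun=> 1) (normal_pdf m s) id id) => //.
- exact: finite_measure_integrable_cst.
- exact: integrable_normal_pdf.
- by move=> x; exact: normal_pdf_ge0.
move=> A mA.
transitivity (fine (normal_prob m s A)).
  congr fine; under eq_integral do rewrite mul1r.
  by rewrite integral_indic// setIT.
rewrite /Rintegral; congr fine; rewrite [LHS]/normal_prob [LHS]integral_mkcond; apply: eq_integral => x _.
by rewrite patchE indicE; case: ifP; rewrite ?mulr1 ?mulr0.
Qed.

Lemma normal_integral_gauss f m s : 0 < s -> measurable_fun [set: R] f ->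
  (forall x, 0 <= f x) ->
  (\int[normal_prob m s]_x (f x)%:E = \int[gauss]_x (f (m + s * x))%:E)%E.
Proof.
move=> s0 mf f0; rewrite !normal_integral//; last first.
  by apply: measurableT_comp => //; apply: measurable_funD => //; exact: measurable_funM.
rewrite (lebesgue_affine m s0); last 2 first.
- by apply: measurable_funM => //; exact: measurable_normal_pdf.
- by move=> x; rewrite mulr_ge0 ?normal_pdf_ge0.
rewrite -ge0_integralZl//; last 3 first.
- apply/measurable_EFinP/measurable_funM.
    apply: measurableT_comp; first exact: measurable_normal_pdf.
    by apply: measurable_funD => //; exact: measurable_funM.
  by apply: measurableT_comp => //; apply: measurable_funD => //; exact: measurable_funM.
- by move=> x _; rewrite lee_fin mulr_ge0 ?normal_pdf_ge0.
- by rewrite lee_fin ltW.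
apply: eq_integral => x _; rewrite -EFinM mulrA; congr (_ * _)%:E.
rewrite /normal_pdf oner_eq0 (gt_eqF s0) mulrA; congr (_ * _).
  rewrite /normal_peak -!mulrnAr 2!(sqrtrM _ (sqr_ge0 _)) !sqrtr_sqr normr1 mul1r.
  by rewrite gtr0_norm// invfM mulrA divff ?mul1r// gt_eqF.
rewrite /normal_fun; congr expR; rewrite subr0; field.
by rewrite gt_eqF.
Qed.

(* Cameron-Martin formula and rescaling, by completing the square in the Gaussian density. *)
Lemma gauss_quadratic f t k : -1 < k -> measurable_fun [set: R] f ->
  (forall x, 0 <= f x) ->
  (\int[gauss]_x (f x * expR (t * x - k * x ^+ 2 / 2))%:E =
   ((Num.sqrt (1 + k))^-1 * expR (t ^+ 2 / (2 * (1 + k))))%:E *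
   \int[gauss]_x (f ((t / (1 + k)) + (Num.sqrt (1 + k))^-1 * x))%:E)%E.
Proof.
move=> k1 mf f0; have k0 : 0 < 1 + k by lra.
set s := (Num.sqrt (1 + k))^-1; have s0 : 0 < s by rewrite invr_gt0 sqrtr_gt0.
have sE : 1 + k = s ^- 2 by rewrite exprVn sqr_sqrtr ?ltW// invrK.
rewrite !normal_integral//; last 3 first.
- by mfun.
- by mfun.
- by move=> x; rewrite mulr_ge0 ?expR_ge0.
rewrite (lebesgue_affine (t / (1 + k)) s0); last 2 first.
- by mfun.
- by move=> x; rewrite !mulr_ge0 ?normal_pdf_ge0 ?expR_ge0.
rewrite -!ge0_integralZl//; try (by apply/measurable_EFinP; mfun);
  try (by move=> y _; rewrite lee_fin !mulr_ge0 ?normal_pdf_ge0 ?expR_ge0);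
  try (by rewrite lee_fin ?mulr_ge0 ?expR_ge0 ?ltW).
apply: eq_integral => x _; rewrite -!EFinM; congr EFin.
rewrite [LHS](_ : _ = s * f (t / (1 + k) + s * x) * (normal_pdf 0 1 (t / (1 + k) + s * x) * expR (t * (t / (1 + k) + s * x) - k * (t / (1 + k) + s * x) ^+ 2 / 2))); last by ring.
rewrite [RHS](_ : _ = s * f (t / (1 + k) + s * x) * (expR (t ^+ 2 / (2 * (1 + k))) * normal_pdf 0 1 x)); last by ring.
congr (_ * _); rewrite /normal_pdf oner_eq0 -[LHS]mulrA [RHS]mulrCA; congr (_ * _).
rewrite /normal_fun -!expRD; congr expR.
rewrite sE expr1n !subr0 -(mulr_natr 1 2) mul1r.
have -> : k = s ^- 2 - 1 by rewrite -sE; ring.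
by field; rewrite gt_eqF.
Qed.

End real_gaussian.

Section gaussian_moments.
Variable R : realType.
Implicit Types (f : R -> R) (a b c m s t x y : R).
Local Notation leb := (@lebesgue_measure R).
Local Notation gauss := (gauss R).

Lemma gauss_cst c : \int[gauss]_x c = c.
Proof.
rewrite Rintegral_cst; last exact: measurableT.
by rewrite [X in fine X](@probability_setT _ _ _ gauss) mulr1.
Qed.

Lemma rintegrable_gauss_cst c : rintegrable gauss (fun=> c).
Proof. exact: finite_measure_integrable_cst. Qed.

Lemma gauss_exp t k : -1 < k ->
  (\int[gauss]_x (expR (t * x - k * x ^+ 2 / 2))%:E =
   ((Num.sqrt (1 + k))^-1 * expR (t ^+ 2 / (2 * (1 + k))))%:E)%E.
Proof.
move=> k1; have := @gauss_quadratic R (fun=> 1) t k k1 (measurable_cst _) (fun=> ler01).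
under eq_integral do rewrite mul1r.
move=> ->; rewrite integral_cst//= ?mul1e ?probability_setT ?mule1//.
Qed.

Lemma gauss_sym f : measurable_fun [set: R] f -> (forall x, 0 <= f x) ->
  (\int[gauss]_x (f (- x))%:E = \int[gauss]_x (f x)%:E)%E.
Proof.
move=> mf f0; have mN : measurable_fun [set: R] (fun x => - x) by exact: oppr_measurable.
rewrite !normal_integral//; last exact: (measurableT_comp mf).
pose g x := normal_pdf 0 1 x * f x.
transitivity (\int[leb]_x (g (- x))%:E)%E.
  apply: eq_integral => x _; rewrite /g /normal_pdf oner_eq0 /normal_fun.
  by rewrite !subr0 sqrrN.
have g0 x : 0 <= g x by rewrite mulr_ge0 ?normal_pdf_ge0.
have mg : measurable_fun [set: R] g by rewrite /g; mfun.
transitivity (\int[pushforward leb (-%R : _ -> measurableTypeR R)]_x (g x)%:E)%E.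
  by rewrite ge0_integral_pushforward//; [exact/measurable_EFinP|move=> x _; rewrite lee_fin].
by apply: eq_measure_integral => A mA _; exact: lebesgue_measureN.
Qed.

Lemma rintegrable_gauss_pow6 : rintegrable gauss (fun x => x ^+ 6).
Proof.
(* Cubing x^2 / 12 <= exp (x^2 / 12) gives x^6 <= 12^3 exp (x^2 / 4), which is the case k = -1/2 of
   the exponential integral. *)
have h : rintegrable gauss (fun x => 12 ^+ 3 * expR (0 * x - (- 2^-1) * x ^+ 2 / 2)).
  apply: rintegrableZ; apply/integrableP; split.
    by apply/measurable_EFinP; mfun.
  under eq_integral do rewrite /= ger0_norm ?expR_ge0//.
  by rewrite gauss_exp ?ltry//; lra.
apply: rintegrable_le h _; first exact: measurable_funX.
move=> x; rewrite ger0_norm; last by rewrite (exprM x 2 3) exprn_ge0// sqr_ge0.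
have -> : 0 * x - (- 2^-1) * x ^+ 2 / 2 = 3 * (x ^+ 2 / 12) by field.
rewrite expRM_natl.
have := @expR_ge1Dx R (x ^+ 2 / 12).
have x0 : 0 <= x ^+ 2 / 12 by rewrite divr_ge0 ?sqr_ge0.
move=> h1; have h2 : (x ^+ 2 / 12) ^+ 3 <= expR (x ^+ 2 / 12) ^+ 3.
  by rewrite lerXn2r ?nnegrE ?expR_ge0//; lra.
apply: le_trans (_ : 12 ^+ 3 * (x ^+ 2 / 12) ^+ 3 <= _); last by rewrite ler_wpM2l.
by rewrite le_eqVlt; apply/orP; left; apply/eqP; field.
Qed.

Lemma pow_le_pow6 x n : (n <= 6)%N -> `|x ^+ n| <= 1 + x ^+ 6.
Proof.
move=> n6; rewrite normrX -[x ^+ 6]ger0_norm; last by rewrite (exprM x 2 3) exprn_ge0// sqr_ge0.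
rewrite normrX; have [x1|x1] := leP `|x| 1.
  by rewrite (le_trans (exprn_ile1 _ _ _))// lerDl exprn_ge0.
apply: le_trans (_ : `|x| ^+ 6 <= _); last by rewrite lerDr.
by rewrite ler_weXn2l// ltW.
Qed.

Lemma rintegrable_gauss_pow n : (n <= 6)%N -> rintegrable gauss (fun x => x ^+ n).
Proof.
move=> n6; apply: rintegrable_le (rintegrableD (rintegrable_gauss_cst 1) rintegrable_gauss_pow6) _.
  exact: measurable_funX.
by move=> x; exact: pow_le_pow6.
Qed.

(** Convexity of the exponential gives 1 - k m / 2 <= E exp (- k x^2 / 2) = (1 + k)^(-1/2) for every
    k > -1. Both sides agree at k = 0, so comparing slopes there, from k < 0 and from k > 0, forces
    m = 1. *)
Lemma gauss_square : \int[gauss]_x (x ^+ 2) = 1.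
Proof.
set m := Rintegral _ _ _.
have key (k : R) : -1 < k -> 1 - k * m / 2 <= (Num.sqrt (1 + k))^-1.
  move=> k1; have := gauss_exp 0 k1.
  rewrite expr0n/= mul0r expR0 mulr1 => /(congr1 fine)/= <-.
  have <- : \int[gauss]_x (1 - (k / 2) * x ^+ 2) = 1 - k * m / 2.
    rewrite RintegralB//; last 2 first.
    - exact: rintegrable_gauss_cst.
    - by apply: rintegrableZ; exact: rintegrable_gauss_pow.
    rewrite gauss_cst RintegralZl//; last exact: rintegrable_gauss_pow.
    by rewrite -/m; field.
  apply: le_Rintegral => //.
  - apply: rintegrableB; first exact: rintegrable_gauss_cst.
    by apply: rintegrableZ; exact: rintegrable_gauss_pow.
  - apply/integrableP; split; first by apply/measurable_EFinP; mfun.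
    under eq_integral do rewrite /= ger0_norm ?expR_ge0//.
    by rewrite gauss_exp ?ltry.
  - move=> x _; rewrite mul0r sub0r; apply: le_trans (@expR_ge1Dx R _).
    by rewrite le_eqVlt; apply/orP; left; apply/eqP; field.
have r_ge0 (k : R) : -1 < k -> 0 < (Num.sqrt (1 + k))^-1 by move=> k1; rewrite invr_gt0 sqrtr_gt0; lra.
have r_sq (k : R) : -1 < k -> (Num.sqrt (1 + k))^-1 ^+ 2 * (1 + k) = 1.
  by move=> k1; rewrite exprVn sqr_sqrtr ?mulVf//; [rewrite gt_eqF//|]; lra.
apply/eqP; rewrite eq_le; apply/andP; split.
- apply/ler_addgt0Pl => e e0.
  (* Chosen so that (1 - k) (1 + e) = 1, whence the right-hand side for - k is the square root of 1
     + e. *)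
  pose k := e / (1 + e).
  have k0 : 0 < k < 1 by rewrite divr_gt0 ?addr_gt0//= ltr_pdivrMr ?mul1r ?ltrDr// addr_gt0.
  have kE : k * (1 + e) = e by rewrite divfK// gt_eqF// addr_gt0.
  have nk : -1 < - k by lra.
  have := key _ nk; have := r_ge0 _ nk; have := r_sq _ nk.
  set r := _^-1 => r2 r0 h.
  rewrite leNgt; apply/negP => me.
  have rE : r ^+ 2 = 1 + e.
    have : (1 - k) * (1 + e) = 1 by rewrite mulrBl kE; ring.
    by move=> E; rewrite -[LHS]mulr1 -[X in _ * X = _]E mulrA r2 mul1r.
  have km : k * (1 + e) < k * m by rewrite ltr_pM2l ?(andP k0).1// addrC.
  rewrite kE in km; have : 1 + e / 2 < r by apply: lt_le_trans h; lra.
  move=> lr; have : (1 + e / 2) ^+ 2 < r ^+ 2 by rewrite ltrXn2r ?nnegrE//; lra.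
  by rewrite rE; nra.
- apply/ler_addgt0Pl => e e0.
  have nk : -1 < e by lra.
  have := key _ nk; have := r_ge0 _ nk; have := r_sq _ nk.
  set r := _^-1 => r2 r0 h.
  rewrite leNgt; apply/negP => me.
  have lr : 1 - e / 2 + e ^+ 2 / 2 < r by apply: lt_le_trans h; nra.
  have s0 : 0 <= 1 - e / 2 + e ^+ 2 / 2 by nra.
  have : (1 - e / 2 + e ^+ 2 / 2) ^+ 2 < r ^+ 2 by rewrite ltrXn2r ?nnegrE//; lra.
  move=> lr2; have : (1 - e / 2 + e ^+ 2 / 2) ^+ 2 * (1 + e) < 1.
    by rewrite -[ltRHS]r2 ltr_pM2r//; lra.
  apply/negP; rewrite -leNgt.
  have -> : (1 - e / 2 + e ^+ 2 / 2) ^+ 2 * (1 + e) =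
    1 + e ^+ 2 / 4 + e ^+ 3 / 2 + (e ^+ 3 / 4) * ((1 - e / 2) ^+ 2 + 3 / 4 * e ^+ 2) by field.
  have e2 : 0 <= e ^+ 2 by rewrite sqr_ge0.
  have e3 : 0 <= e ^+ 3 by rewrite exprn_ge0// ltW.
  have : 0 <= (e ^+ 3 / 4) * ((1 - e / 2) ^+ 2 + 3 / 4 * e ^+ 2).
    by apply: mulr_ge0; [lra|]; have := sqr_ge0 (1 - e / 2); lra.
  lra.
Qed.

(** Stability of the normal law, by convolution. For fixed y the variable u = a x + b y has an
    explicit density; [G] is the resulting integrand in (y, u), and integrating out y by completing
    the square leaves the density of variance a^2 + b^2. *)
Lemma gauss_rotation f a b : 0 <= a -> 0 <= b ->
  measurable_fun [set: R] f -> (forall x, 0 <= f x) ->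
  (\int[gauss]_y \int[gauss]_x (f (a * x + b * y))%:E =
   \int[gauss]_x (f (Num.sqrt (a ^+ 2 + b ^+ 2) * x))%:E)%E.
Proof.
move=> a_ge0 b0 mf f0; have [a0|a0] := eqVneq a 0.
  rewrite a0 expr0n/= add0r sqrtr_sqr ger0_norm//.
  apply: eq_integral => y _; under eq_integral do rewrite mul0r add0r.
  rewrite integral_cst; last exact: measurableT.
  by rewrite [X in (_ * X)%E](@probability_setT _ _ _ gauss) mule1.
have {a0 a_ge0} a0 : 0 < a by rewrite lt_neqAle eq_sym a0.
set c := Num.sqrt _.
have c2 : c ^+ 2 = a ^+ 2 + b ^+ 2 by rewrite sqr_sqrtr ?addr_ge0 ?sqr_ge0.
have c0 : 0 < c by rewrite sqrtr_gt0 ltr_wpDr ?sqr_ge0// exprn_gt0.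
have an0 : a != 0 by rewrite gt_eqF.
have cn0 : a ^+ 2 + b ^+ 2 != 0 by rewrite -c2 expf_neq0// gt_eqF.
pose h u := normal_peak a * expR (- u ^+ 2 / (2 * a ^+ 2)) * f u.
have h0 u : 0 <= h u by rewrite !mulr_ge0 ?normal_peak_ge0 ?expR_ge0.
have mh : measurable_fun [set: R] h.
  apply: measurable_funM => //; apply: measurable_funM => //.
  apply: (measurableT_comp (@measurable_expR R)); apply: measurable_funM => //.
  by apply: (measurableT_comp (@oppr_measurable R _)); exact: measurable_funX.
pose G (z : R * R) := h z.2 * expR (z.2 * b / a ^+ 2 * z.1 - (b / a) ^+ 2 * z.1 ^+ 2 / 2).
have G0 z : 0 <= G z by rewrite mulr_ge0 ?expR_ge0.
have mG : measurable_fun [set: R * R] (EFin \o G).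
  have m1 : measurable_fun [set: R * R] (@fst R R) by exact: measurable_fst.
  have m2 : measurable_fun [set: R * R] (@snd R R) by exact: measurable_snd.
  by apply/measurable_EFinP; rewrite /G; mfun.
transitivity (\int[gauss]_y \int[leb]_u (EFin \o G) (y, u))%E.
  apply: eq_integral => y _.
  under eq_integral do rewrite addrC.
  rewrite -normal_integral_gauss// normal_integral//.
  apply: eq_integral => u _; congr EFin; rewrite /G /h /= /normal_pdf (gt_eqF a0).
  rewrite [RHS]mulrAC; congr (_ * _); rewrite -[RHS]mulrA; congr (_ * _); rewrite /normal_fun -expRD.
  by congr expR; field.
rewrite (fubini_tonelli (m1 := gauss) (m2 := leb))//.
have -> : (\int[gauss]_x (f (c * x))%:E = \int[normal_prob 0 c]_x (f x)%:E)%E.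
  by rewrite normal_integral_gauss//; apply: eq_integral => x _; rewrite add0r.
rewrite normal_integral//; apply: eq_integral => u _.
have k1 : -1 < (b / a) ^+ 2 by apply: (@lt_le_trans _ _ 0); rewrite ?sqr_ge0; lra.
under eq_integral do rewrite /G/= EFinM.
rewrite ge0_integralZl//; try (by apply/measurable_EFinP; mfun);
  try (by move=> y _; rewrite lee_fin expR_ge0); try (by rewrite lee_fin).
rewrite gauss_exp// -EFinM; congr EFin.
have kE : 1 + (b / a) ^+ 2 = c ^+ 2 / a ^+ 2 by rewrite c2; field.
rewrite kE /normal_pdf (gt_eqF c0) /h.
rewrite [LHS](_ : _ = normal_peak a * (Num.sqrt (c ^+ 2 / a ^+ 2))^-1 *
   (expR (- u ^+ 2 / (2 * a ^+ 2)) * expR ((u * b / a ^+ 2) ^+ 2 / (2 * (c ^+ 2 / a ^+ 2)))) * f u); last by ring.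
congr (_ * _ * _).
  rewrite /normal_peak -!mulrnAr !(sqrtrM _ (sqr_ge0 _)) !sqrtr_sqr.
  rewrite -exprVn sqrtr_sqr !gtr0_norm ?invr_gt0// !invfM invrK.
  have p0 : Num.sqrt (pi *+ 2) != 0 :> R by rewrite gt_eqF// sqrtr_gt0 mulrn_wgt0// pi_gt0.
  by field; rewrite p0 an0 gt_eqF.
rewrite -expRD /normal_fun subr0; congr expR; rewrite c2; field.
by rewrite cn0 an0.
Qed.

(** Characteristic function of the standard normal law, which is real by symmetry. It enters through
    its multiplicativity, inherited from the rotation formula. *)
Definition gauss_cos a := \int[gauss]_x cos (a * x).

Lemma bounded_measurable_cos t a : bounded_measurable (fun x => cos (t * x + a)).
Proof.
split; last by exists 1 => x; rewrite ler_norml cos_geN1 cos_le1.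
apply: measurableT_comp; first exact: (continuous_measurable_fun (@continuous_cos R)).
by apply: measurable_funD => //; exact: measurable_funM.
Qed.

Lemma rintegrable_gauss_bounded f : bounded_measurable f -> rintegrable gauss f.
Proof.
move=> [mf [M fM]]; apply: rintegrable_le (rintegrable_gauss_cst M) _ => //.
Qed.

Lemma bounded_measurable_sin t a : bounded_measurable (fun x => sin (t * x + a)).
Proof.
have := bounded_measurable_cos t (a - pi / 2).
by under eq_fun do rewrite addrA cosBpihalf.
Qed.

Lemma gauss_opp : same_law gauss gauss (fun x => - x) id.
Proof.
apply: same_law_of_ge0 => //; first exact: oppr_measurable.
by move=> g mg g0; exact: gauss_sym.
Qed.

Lemma gauss_sin0 a : \int[gauss]_x sin (a * x) = 0.
Proof.
have bs : bounded_measurable (fun x => sin (a * x)).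
  by have := bounded_measurable_sin a 0; under eq_fun do rewrite addr0.
have := gauss_opp bs; under eq_Rintegral do rewrite mulrN sinN -mulN1r.
rewrite RintegralZl//; last exact: rintegrable_gauss_bounded.
rewrite mulN1r => /eqP; rewrite -subr_eq0 -opprD oppr_eq0 -mulr2n mulrn_eq0 /=.
by move/eqP.
Qed.

Lemma gauss_mean : \int[gauss]_x x = 0.
Proof.
have i1 : rintegrable gauss (fun x => x).
  by apply: rintegrable_eq (rintegrable_gauss_pow (n := 1) isT) => x; rewrite expr1.
have mN : measurable_fun [set: R] (fun x : R => - x) by exact: oppr_measurable.
have := same_law_Rintegral gauss_opp mN (@measurable_id _ _ _) (@measurable_id _ _ _).
under eq_Rintegral do rewrite -mulN1r.
rewrite RintegralZl// mulN1r => /eqP; rewrite -subr_eq0 -opprD oppr_eq0 -mulr2n mulrn_eq0 /=.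
by move/eqP.
Qed.

Lemma gauss_cos_phase a t : \int[gauss]_x cos (a * x + t) = cos t * gauss_cos a.
Proof.
have bc : bounded_measurable (fun x => cos (a * x)).
  by have := bounded_measurable_cos a 0; under eq_fun do rewrite addr0.
have bs : bounded_measurable (fun x => sin (a * x)).
  by have := bounded_measurable_sin a 0; under eq_fun do rewrite addr0.
under eq_Rintegral do rewrite cosD mulrC [X in _ - X]mulrC.
rewrite RintegralB//; try by apply: rintegrableZ; exact: rintegrable_gauss_bounded.
rewrite !RintegralZl//; try exact: rintegrable_gauss_bounded.
by rewrite gauss_sin0 mulr0 subr0.
Qed.

Lemma gauss_cosM a b : 0 <= a -> 0 <= b ->
  gauss_cos (Num.sqrt (a ^+ 2 + b ^+ 2)) = gauss_cos a * gauss_cos b.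
Proof.
move=> a0 b0.
(* The rotation formula is stated for nonnegative functions, hence the shift by 1. *)
have b1 : bounded_measurable (fun x : R => 1 + cos x).
  apply: bounded_measurableD; first exact: bounded_measurable_cst.
  by have := bounded_measurable_cos 1 0; under eq_fun do rewrite mul1r addr0.
have bc c : bounded_measurable (fun x => cos (c * x)).
  by have := bounded_measurable_cos c 0; under eq_fun do rewrite addr0.
have ge1 x : 0 <= 1 + cos x by rewrite -lerBlDl sub0r cos_geN1.
have := gauss_rotation a0 b0 (proj1 b1) ge1.
have E c t : (\int[gauss]_x (1 + cos (c * x + t))%:E = (1 + cos t * gauss_cos c)%:E)%E.
  rewrite rintegralE; last first.
    apply: rintegrable_gauss_bounded; apply: bounded_measurableD; first exact: bounded_measurable_cst.
    exact: bounded_measurable_cos.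
  rewrite RintegralD//; last 2 first.
  - exact: rintegrable_gauss_cst.
  - by apply: rintegrable_gauss_bounded; exact: bounded_measurable_cos.
  by rewrite gauss_cst gauss_cos_phase.
under eq_integral do rewrite E.
rewrite rintegralE; last first.
  apply: rintegrableD; first exact: rintegrable_gauss_cst.
  apply: rintegrable_eq (rintegrableZ (gauss_cos a) (rintegrable_gauss_bounded (bc b))) => x.
  by rewrite mulrC.
rewrite RintegralD//; last 2 first.
- exact: rintegrable_gauss_cst.
- apply: rintegrable_eq (rintegrableZ (gauss_cos a) (rintegrable_gauss_bounded (bc b))) => x.
  by rewrite mulrC.
under [X in _ + X]eq_Rintegral do rewrite mulrC.
rewrite RintegralZl//; last exact: rintegrable_gauss_bounded.
set c := Num.sqrt _.
have := E c 0; under eq_integral do rewrite addr0.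
move=> ->; rewrite cos0 mul1r gauss_cst => -[] /addrI <-.
by [].
Qed.

End gaussian_moments.

Section centered_gaussian.
Context d (T : measurableType d) (R : realType) (P : probability T R).
Implicit Types (U : T -> R) (v t a : R) (f : R -> R).
Local Notation gauss := (gauss R).

(** Stated through scaling of the standard law rather than a density, so that v = 0 is covered as
    the point mass at 0. *)
Definition centered_gaussian U v :=
  [/\ 0 <= v, measurable_fun [set: T] U &
      same_law P gauss U (fun x => Num.sqrt v * x)].

Let mscale v : measurable_fun [set: measurableTypeR R] (fun x => Num.sqrt v * x : R).
Proof. exact: measurable_funM. Qed.

Lemma centered_gaussian_ge0 U v f : centered_gaussian U v ->
  measurable_fun [set: R] f -> (forall x, 0 <= f x) ->
  (\int[P]_w (f (U w))%:E = \int[gauss]_x (f (Num.sqrt v * x))%:E)%E.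
Proof. by move=> [v0 mU UL] mf f0; exact: (same_law_ge0 mU (mscale v) UL). Qed.

Lemma centered_gaussian_rintegrable_pow U v n : (n <= 6)%N ->
  centered_gaussian U v -> rintegrable P (fun w => U w ^+ n).
Proof.
move=> n6 [v0 mU UL].
apply: (same_law_rintegrable mU (mscale v) UL (f := fun x => x ^+ n)).
  exact: measurable_funX.
apply: rintegrable_eq (rintegrableZ (Num.sqrt v ^+ n) (rintegrable_gauss_pow R n6)) => x.
by rewrite exprMn.
Qed.

Lemma centered_gaussian_rintegrable U v : centered_gaussian U v -> rintegrable P U.
Proof.
move=> /(centered_gaussian_rintegrable_pow (n := 1) isT).
by apply: rintegrable_eq => x; rewrite expr1.
Qed.

Lemma centered_gaussian_square U v : centered_gaussian U v ->
  \int[P]_w (U w ^+ 2) = v.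
Proof.
move=> [v0 mU UL].
have := same_law_Rintegral UL mU (mscale v) (measurable_funX 2 (@measurable_id _ _ _)) => ->.
under eq_Rintegral do rewrite exprMn sqr_sqrtr//.
rewrite RintegralZl//; last exact: rintegrable_gauss_pow.
by rewrite gauss_square mulr1.
Qed.

Lemma centered_gaussian_cos U v t a : centered_gaussian U v ->
  \int[P]_w cos (t * U w + a) = cos a * gauss_cos (t * Num.sqrt v).
Proof.
move=> [v0 mU UL]; rewrite (UL _ (bounded_measurable_cos t a)).
by under eq_Rintegral do rewrite mulrA; rewrite gauss_cos_phase.
Qed.

Lemma centered_gaussian_of_cos U v : 0 <= v -> measurable_fun [set: T] U ->
  (forall t a, \int[P]_w cos (t * U w + a) = cos a * gauss_cos (t * Num.sqrt v)) ->
  centered_gaussian U v.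
Proof.
move=> v0 mU H; split=> // f bf.
have iP : rintegrable P (fun=> 1) by exact: finite_measure_integrable_cst.
have ig : rintegrable gauss (fun=> 1) by exact: rintegrable_gauss_cst.
have bd := bounded_continuous_diff iP ig mU (mscale v).
have /(_ _ _ bf) := trigonometric_uniqueness bd.
under eq_Rintegral do rewrite mul1r.
under [X in _ - _ * X]eq_Rintegral do rewrite mul1r.
rewrite mul1r => h; apply/eqP; rewrite -subr_eq0 h// => t a.
under eq_Rintegral do rewrite mul1r.
under [X in _ - _ * X]eq_Rintegral do rewrite mul1r mulrA.
by rewrite H gauss_cos_phase mul1r subrr.
Qed.

Lemma normal_rv_centered_gaussian U : measurable_fun [set: T] U ->
  normal_rv P U -> \int[P]_w U w = 0 -> exists v, centered_gaussian U v.
Proof.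
move=> mU [[m Um]|[m [s [s0 Us]]]] mean.
- have mUm : measurable [set w | U w = m].
    by have := mU measurableT _ (measurable_set1 m); rewrite setTI.
  have PC : P (~` [set w | U w = m]) = 0%E.
    by have -> := probability_setC P mUm; rewrite Um subee.
  have m0 : m = 0.
    rewrite -mean /Rintegral (ae_eq_integral (cst m%:E))//.
    + by rewrite integral_cst//= probability_setT mule1.
    + exact/measurable_EFinP.
    + exists (~` [set w | U w = m]); split; first exact: measurableC.
        exact: PC.
      by move=> w /= h e; apply: h => _; rewrite e.
  exists 0; split => //; apply: same_law_set => // A mA.
  have mUA := mU measurableT _ mA; rewrite setTI in mUA.
  rewrite sqrtr0; have [A0|A0] := pselect (A 0).
    rewrite [RHS](_ : _ = 1%E); last first.
      rewrite (_ : _ @^-1` A = setT); first exact: (@probability_setT _ _ _ gauss).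
      by apply/seteqP; split => x //= _; rewrite mul0r.
    apply/eqP; rewrite eq_le probability_le1//= -Um; apply: le_measure; [exact/mem_set|exact/mem_set|].
    by move=> w /= ->; rewrite m0.
  rewrite [RHS](_ : _ = 0%E); last first.
    rewrite (_ : _ @^-1` A = set0) ?measure0//.
    by apply/seteqP; split => x //=; rewrite mul0r.
  apply/eqP; rewrite eq_le measure_ge0 andbT.
  rewrite -PC.
  apply: le_measure; [exact/mem_set|exact/mem_set/measurableC|].
  by move=> w /= Aw e; apply: A0; rewrite -m0 -e.
- have mma : measurable_fun [set: measurableTypeR R] (fun x => m + s * x : R).
    by apply: measurable_funD => //; exact: measurable_funM.
  have UL : same_law P gauss U (fun x => m + s * x).
    apply: same_law_of_ge0 => // f mf f0.
    rewrite -normal_integral_gauss//.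
    have L : same_law P (normal_prob m s) U id by apply: same_law_set => // A mA; exact: Us.
    exact: (same_law_ge0 mU _ L).
  have m0 : m = 0.
    have := same_law_Rintegral UL mU mma (@measurable_id _ _ _); rewrite mean.
    have i1 : rintegrable gauss (fun x => x).
      by apply: rintegrable_eq (@rintegrable_gauss_pow R 1 isT) => x; rewrite expr1.
    rewrite RintegralD//; last 2 first.
    + exact: rintegrable_gauss_cst.
    + exact: rintegrableZ.
    by rewrite RintegralZl// gauss_mean gauss_cst mulr0 addr0.
  exists (s ^+ 2); split; [exact: sqr_ge0|by []|].
  rewrite sqrtr_sqr gtr0_norm//.
  by move: UL; rewrite m0; under [X in same_law _ _ _ X]eq_fun do rewrite add0r.
Qed.

End centered_gaussian.

Section gauss_cos_products.
Variable R : realType.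
Implicit Types (t v w a : R).

Lemma gauss_cos0 : gauss_cos (0 : R) = 1.
Proof.
by rewrite /gauss_cos; under eq_Rintegral do rewrite mul0r cos0; rewrite gauss_cst.
Qed.

Lemma gauss_cosN a : gauss_cos (- a) = gauss_cos a.
Proof. by rewrite /gauss_cos; under eq_Rintegral do rewrite mulNr cosN. Qed.

Lemma gauss_cosD t v w : 0 <= v -> 0 <= w ->
  gauss_cos (t * Num.sqrt (v + w)) = gauss_cos (t * Num.sqrt v) * gauss_cos (t * Num.sqrt w).
Proof.
move=> v0 w0; wlog t0 : t / 0 <= t => [H|].
  have [/H//|t0] := leP 0 t.
  by rewrite -[LHS]gauss_cosN -[gauss_cos (t * _)]gauss_cosN -[gauss_cos (t * Num.sqrt w)]gauss_cosN -!mulNr H// oppr_ge0 ltW.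
rewrite -gauss_cosM ?mulr_ge0 ?sqrtr_ge0//; congr gauss_cos.
rewrite !exprMn !sqr_sqrtr// -mulrDr sqrtrM ?sqr_ge0// sqrtr_sqr ger0_norm//.
Qed.

Lemma gauss_cos_sum (I : Type) (r : seq I) (p : pred I) t (v : I -> R) :
  (forall i, 0 <= v i) ->
  gauss_cos (t * Num.sqrt (\sum_(i <- r | p i) v i)) =
  \prod_(i <- r | p i) gauss_cos (t * Num.sqrt (v i)).
Proof.
move=> v0; elim: r => [|i r IH]; first by rewrite !big_nil sqrtr0 mulr0 gauss_cos0.
rewrite !big_cons; case: ifP => // pi; rewrite gauss_cosD ?IH//.
exact: sumr_ge0.
Qed.

End gauss_cos_products.

Lemma measurable_fun_sum_cond d (T : measurableType d) (R : realType)
    (J : Type) (r : seq J) (p : pred J) (F : J -> T -> R) :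
  (forall i, measurable_fun [set: T] (F i)) ->
  measurable_fun [set: T] (fun w => \sum_(i <- r | p i) F i w).
Proof.
move=> mF; elim: r => [|i r IH].
  by under eq_fun do rewrite big_nil; exact: measurable_cst.
under eq_fun do rewrite big_cons.
by case: (p i) => //; exact: measurable_funD.
Qed.

(** * Sums and independence of normal variables *)

Section independence.
Context d (T : measurableType d) (R : realType) (P : probability T R) (I : finType).
Implicit Types (L U : I -> T -> R) (g f : I -> R -> R).

Definition independent_rvs L := forall A : I -> set R,
  (forall i, measurable (A i)) ->
  P (\bigcap_(i in [set: I]) (L i @^-1` A i)) = (\prod_(i : I) P (L i @^-1` A i))%E.

Let prod_update g L j h w : \prod_i (if i == j then h else g i) (L i w) =
  (\prod_(i | i != j) g i (L i w)) * h (L j w).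
Proof.
rewrite (bigD1 j)//= eqxx mulrC; congr (_ * _).
by apply: eq_bigr => i /negbTE ->.
Qed.

Let bm_prod L f (p : pred I) : (forall i, measurable_fun [set: T] (L i)) ->
  (forall i, bounded_measurable (f i)) ->
  bounded_measurable (fun w => \prod_(i | p i) f i (L i w)).
Proof.
move=> mL bf; apply: bounded_measurable_prod => i; have [mf [M fM]] := bf i.
by split; [exact: (measurableT_comp mf)|exists M => x; exact: fM].
Qed.

Lemma rintegrable_bm (V : T -> R) : bounded_measurable V -> rintegrable P V.
Proof. exact: (rintegrable_bounded P (@measurable_id _ _ _)). Qed.

(** Indicators are replaced by bounded functions one coordinate at a time: with the other factors
    frozen, both sides are signed functionals of the remaining test function that agree on
    indicators. *)
Lemma independent_rvs_expectation L f :
  (forall i, measurable_fun [set: T] (L i)) -> independent_rvs L ->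
  (forall i, bounded_measurable (f i)) ->
  \int[P]_w (\prod_i f i (L i w)) = \prod_i \int[P]_w f i (L i w).
Proof.
move=> mL iL.
have mLA i A : measurable A -> measurable (L i @^-1` A).
  by move=> mA; have := mL i measurableT _ mA; rewrite setTI.
suff H (s : seq I) : forall f, (forall i, bounded_measurable (f i)) ->
    (forall i, i \notin s -> exists2 A, measurable A & f i = \1_A) ->
    \int[P]_w (\prod_i f i (L i w)) = \prod_i \int[P]_w f i (L i w).
  by move=> bf; apply: (H (enum I)) => // i; rewrite mem_enum.
elim: s => [|j s IH] {}f bf sf.
  have /choice[A hA] : forall i, exists A, measurable A /\ f i = \1_A.
    by move=> i; have [//|A mA fA] := sf i; exists A.
  have mA i : measurable (A i) by case: (hA i).
  have fE : f = fun i => \1_(A i) by apply/funext => i; case: (hA i).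
  rewrite fE.
  transitivity (fine (P (\bigcap_(i in [set: I]) (L i @^-1` A i)))).
    rewrite /Rintegral; congr fine.
    rewrite -[X in P X]setIT -integral_indic//; last first.
      by apply: fin_bigcap_measurable => // i _; exact: mLA.
    apply: eq_integral => w _; congr EFin; rewrite indicE.
    have [wA|wA] := boolP (w \in _).
      apply: big1 => i _; rewrite indicE mem_set//.
      by move/set_mem : wA; exact.
    have [i wi] : exists i, ~ A i (L i w).
      apply/not_existsP => h; move/negP: wA; apply; apply/mem_set => i _.
      by apply: contrapT; exact: h.
    by rewrite (bigD1 i)//= indicE memNset// mul0r.
  rewrite iL//.
  transitivity (\prod_i fine (P (L i @^-1` A i))).
    rewrite (eq_bigr (fun i => (fine (P (L i @^-1` A i)))%:E)).
      by rewrite -(big_morph EFin (@EFinM R) (erefl _)).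
    by move=> i _; rewrite fineK// fin_num_measure//; exact: mLA.
  apply: eq_bigr => i _; rewrite /Rintegral; congr fine.
  by rewrite -[X in P X]setIT -integral_indic//; exact: mLA.
pose V w := \prod_(i | i != j) f i (L i w).
pose c := \prod_(i | i != j) \int[P]_w f i (L i w).
have bV : bounded_measurable V by exact: bm_prod.
have bcd := bounded_continuousB c
  (bounded_continuous_integral (rintegrable_bm bV) (mL j))
  (bounded_continuous_integral (rintegrable_cst P 1) (mL j)).
have key : forall g : R -> R, bounded_measurable g ->
   \int[P]_x (V x * g (L j x)) - c * \int[P]_x (1 * g (L j x)) = 0.
  apply: (bcont_bounded0 bcd) => A mA.
  have := IH (fun i => if i == j then \1_A else f i).
  under eq_Rintegral do rewrite prod_update.
  move=> ->.
  - rewrite (bigD1 j)//= eqxx mulrC.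
    under [X in _ - _ * X]eq_Rintegral do rewrite mul1r.
    apply/eqP; rewrite subr_eq0; apply/eqP; congr (_ * _).
    by apply: eq_bigr => i /negbTE ->.
  - by move=> i; case: ifP => // _; exact: bounded_measurable_indic.
  - move=> i si; case: eqVneq => [_|ij]; first by exists A.
    by apply: sf; rewrite inE negb_or ij.
have := key _ (bf j); under [X in _ - _ * X]eq_Rintegral do rewrite mul1r.
move=> /eqP; rewrite subr_eq0 => /eqP fj.
rewrite [RHS](bigD1 j)//= mulrC -fj; apply: eq_Rintegral => w _.
by rewrite (bigD1 j)//= mulrC.
Qed.

(** Only cosines of the sum have to be computed. The addition formula splits off one summand; the
    term with its sine vanishes by symmetry and the term with its cosine gives one factor of the
    characteristic function. *)
Lemma centered_gaussian_sum L (v : I -> R) :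
  independent_rvs L -> (forall i, centered_gaussian P (L i) (v i)) ->
  centered_gaussian P (fun w => \sum_i L i w) (\sum_i v i).
Proof.
move=> iL cL.
have v0 i : 0 <= v i by case: (cL i).
have mL i : measurable_fun [set: T] (L i) by case: (cL i).
apply: centered_gaussian_of_cos => [||t a].
- exact: sumr_ge0.
- exact: measurable_sum.
(* The variables outside [s] carry arbitrary test functions, so that the cosine and the sine of the
   summand split off can be moved into [psi] before the induction hypothesis is applied. *)
suff H (s : seq I) : uniq s -> forall (psi : I -> R -> R) a, (forall i, bounded_measurable (psi i)) ->
    \int[P]_w (cos (t * (\sum_(i <- s) L i w) + a) * \prod_(i | i \notin s) psi i (L i w)) =
    cos a * (\prod_(i <- s) gauss_cos (t * Num.sqrt (v i))) *
      \prod_(i | i \notin s) \int[P]_w psi i (L i w).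
  have := H (enum I) (enum_uniq I) (fun _ _ => 1) a (fun=> bounded_measurable_cst _ _).
  rewrite [X in _ * X]big_pred0 ?mulr1; last by move=> i; rewrite mem_enum.
  rewrite gauss_cos_sum// !big_enum => <-.
  apply: eq_Rintegral => w _; have -> : \prod_(i | i \notin enum I) 1 = 1 :> R by exact: big1.
  by rewrite mulr1 big_enum.
elim: s => [|j s IH] us psi b bpsi.
  rewrite big_nil mulr1.
  under eq_Rintegral do rewrite big_nil mulr0 add0r.
  have bp : bounded_measurable (fun w => \prod_(i | i \notin [::]) psi i (L i w)) by exact: bm_prod.
  rewrite RintegralZl//; last exact: rintegrable_bm.
  congr (_ * _); exact: independent_rvs_expectation.
move: us => /= /andP[js us].
pose upd h := fun i => if i == j then h else psi i.
have bupd h : bounded_measurable h -> forall i, bounded_measurable (upd h i).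
  by move=> bh i; rewrite /upd; case: ifP.
have updE h w : \prod_(i | i \notin s) upd h i (L i w) =
    h (L j w) * \prod_(i | i \notin j :: s) psi i (L i w).
  rewrite (bigD1 j)//= /upd eqxx; congr (_ * _); apply: eq_big => i.
    by rewrite inE negb_or andbC.
  by move=> /andP[_ /negbTE ->].
have updEi h : \prod_(i | i \notin s) \int[P]_w upd h i (L i w) =
    (\int[P]_w h (L j w)) * \prod_(i | i \notin j :: s) \int[P]_w psi i (L i w).
  rewrite (bigD1 j)//= /upd eqxx; congr (_ * _); apply: eq_big => i.
    by rewrite inE negb_or andbC.
  by move=> /andP[_ /negbTE ->].
have bc := bounded_measurable_cos t 0; have bs := bounded_measurable_sin t 0.
have mS : measurable_fun [set: T] (fun w => \sum_(i <- s) L i w) by exact: measurable_sum.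
have bI h c : bounded_measurable h -> rintegrable P (fun w =>
   cos (t * (\sum_(i <- s) L i w) + c) * \prod_(i | i \notin s) upd h i (L i w)).
  move=> bh; apply: rintegrable_bm; apply: bounded_measurableM; last by apply: bm_prod => //; exact: bupd.
  have [mc _] := bounded_measurable_cos t c.
  split; first exact: (measurableT_comp mc).
  by exists 1 => x; rewrite ler_norml cos_geN1 cos_le1.
transitivity (\int[P]_w (cos (t * (\sum_(i <- s) L i w) + b) *
     \prod_(i | i \notin s) upd (fun x => cos (t * x + 0)) i (L i w)) -
   \int[P]_w (cos (t * (\sum_(i <- s) L i w) + (b - pi / 2)) *
     \prod_(i | i \notin s) upd (fun x => sin (t * x + 0)) i (L i w))).
  rewrite -RintegralB//; try exact: bI.
  apply: eq_Rintegral => w _; rewrite !updE big_cons !addr0 addrA cosBpihalf !mulrA -mulrBl.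
  congr (_ * _).
  have -> : t * (L j w + \sum_(i <- s) L i w) + b = (t * (\sum_(i <- s) L i w) + b) + t * L j w by ring.
  by rewrite cosD.
rewrite !IH//; try exact: bupd.
rewrite !updEi (centered_gaussian_cos _ _ (cL j)).
have -> : \int[P]_w sin (t * L j w + 0) = 0.
  transitivity (\int[P]_w cos (t * L j w + (- (pi / 2)))).
    by apply: eq_Rintegral => w _; rewrite addr0 cosBpihalf.
  by rewrite (centered_gaussian_cos _ _ (cL j)) cosN cos_pihalf mul0r.
rewrite cos0 mul1r mul0r mulr0 subr0 big_cons; ring.
Qed.

(** Uncorrelated jointly normal variables are independent. The induction moves coordinates one by
    one from a common cosine, where the hypothesis computes everything, to arbitrary test functions,
    by uniqueness in one variable. *)
Lemma gaussian_independence U (v : I -> R) :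
  (forall t : I -> R, centered_gaussian P (fun w => \sum_i t i * U i w) (\sum_i t i ^+ 2 * v i)) ->
  forall g, (forall i, bounded_measurable (g i)) ->
  \int[P]_w (\prod_i g i (U i w)) = \prod_i \int[P]_w g i (U i w).
Proof.
move=> cU g bg.
have cUj j : centered_gaussian P (U j) (v j).
  have := cU (fun i => (i == j)%:R).
  have -> : \sum_i (i == j)%:R ^+ 2 * v i = v j.
    rewrite (bigD1 j)//= eqxx expr1n mul1r big1 ?addr0// => i /negbTE ->.
    by rewrite expr0n mul0r.
  congr (centered_gaussian P _ (v j)); apply/funext => w.
  rewrite (bigD1 j)//= eqxx mul1r big1 ?addr0// => i /negbTE ->.
  by rewrite mul0r.
have v0 i : 0 <= v i by case: (cUj i).
have mU i : measurable_fun [set: T] (U i) by case: (cUj i).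
suff H (s : seq I) : forall t a,
    \int[P]_w ((\prod_(i | i \in s) g i (U i w)) * cos (\sum_(i | i \notin s) t i * U i w + a)) =
    (\prod_(i | i \in s) \int[P]_w g i (U i w)) * (cos a * \prod_(i | i \notin s) gauss_cos (t i * Num.sqrt (v i))).
  have := H (enum I) (fun=> 0) 0.
  rewrite cos0 mul1r [X in _ * X]big_pred0 ?mulr1; last by move=> i; rewrite mem_enum.
  rewrite (eq_bigl xpredT); last by move=> i; rewrite mem_enum.
  move=> <-; apply: eq_Rintegral => w _.
  rewrite [X in cos (X + _)]big_pred0 ?add0r ?cos0 ?mulr1; last by move=> i; rewrite mem_enum.
  by apply: eq_bigl => i; rewrite mem_enum.
elim: s => [|j s IH] t a.
  rewrite big_pred0// mul1r.
  under eq_Rintegral do rewrite big_pred0// mul1r.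
  have := centered_gaussian_cos 1 a (cU t).
  under eq_Rintegral do rewrite mul1r.
  move=> ->; rewrite gauss_cos_sum; last by move=> i; rewrite mulr_ge0 ?sqr_ge0.
  congr (_ * _); apply: eq_bigr => i _; rewrite mul1r sqrtrM ?sqr_ge0// sqrtr_sqr.
  have [//|ti] := leP 0 (t i); first by move=> ti; rewrite ger0_norm.
  by rewrite ltr0_norm// mulNr gauss_cosN.
have [js|js] := boolP (j \in s).
  have E i : (i \in j :: s) = (i \in s) by rewrite inE; case: eqVneq => // ->.
  have En i : (i \notin j :: s) = (i \notin s) by rewrite E.
  rewrite !(eq_bigl _ _ E) (eq_bigl _ _ En) -IH; apply: eq_Rintegral => w _.
  by rewrite !(eq_bigl _ _ E) (eq_bigl _ _ En).
(* [V] gathers all factors not involving the coordinate j and [c] is its expected mean. The signed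
   functional sending h to E (V h(U_j)) - c E h(U_j) kills cosines by the induction hypothesis and
   the product formula, hence kills [g j]. *)
pose V w := (\prod_(i | i \in s) g i (U i w)) * cos (\sum_(i | i \notin j :: s) t i * U i w + a).
pose c := (\prod_(i | i \in s) \int[P]_w g i (U i w)) * (cos a * \prod_(i | i \notin j :: s) gauss_cos (t i * Num.sqrt (v i))).
have mS : measurable_fun [set: T] (fun w => \sum_(i | i \notin j :: s) t i * U i w + a).
  apply: measurable_funD => //; apply: measurable_fun_sum_cond => i.
  exact: measurable_funM.
have bV : bounded_measurable V.
  apply: bounded_measurableM; first exact: bm_prod.
  split; last by exists 1 => x; rewrite ler_norml cos_geN1 cos_le1.
  apply: measurableT_comp mS; exact: (continuous_measurable_fun (@continuous_cos R)).
have bcd := bounded_continuousB c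
  (bounded_continuous_integral (rintegrable_bm bV) (mU j))
  (bounded_continuous_integral (rintegrable_cst P 1) (mU j)).
have key := trigonometric_uniqueness bcd _ (bg j).
have ninE : forall (F : I -> R), \big[+%R/0]_(i | i \notin s) F i = F j + \sum_(i | i \notin j :: s) F i.
  move=> F; rewrite (bigD1 j)//=; congr (_ + _); apply: eq_bigl => i.
  by rewrite inE negb_or andbC.
have ninM : forall (F : I -> R), \big[*%R/1]_(i | i \notin s) F i = F j * \prod_(i | i \notin j :: s) F i.
  move=> F; rewrite (bigD1 j)//=; congr (_ * _); apply: eq_bigl => i.
  by rewrite inE negb_or andbC.
have inM : forall (F : I -> R), \big[*%R/1]_(i | i \in j :: s) F i = F j * \prod_(i | i \in s) F i.
  move=> F; rewrite (bigD1 j)/= ?inE ?eqxx//; congr (_ * _); apply: eq_bigl => i.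
  by rewrite inE; case: eqVneq => [->|]//=; rewrite ?(negbTE js) ?andbT.
have updS tau w : \sum_(i | i \notin s) (if i == j then tau else t i) * U i w =
   tau * U j w + \sum_(i | i \notin j :: s) t i * U i w.
  rewrite ninE eqxx; congr (_ + _); apply: eq_bigr => i.
  by rewrite inE negb_or => /andP[/negbTE -> _].
have updM tau : \prod_(i | i \notin s) gauss_cos ((if i == j then tau else t i) * Num.sqrt (v i)) =
   gauss_cos (tau * Num.sqrt (v j)) * \prod_(i | i \notin j :: s) gauss_cos (t i * Num.sqrt (v i)).
  rewrite ninM eqxx; congr (_ * _); apply: eq_bigr => i.
  by rewrite inE negb_or => /andP[/negbTE -> _].
have {}key : \int[P]_x (V x * g j (U j x)) = c * \int[P]_x g j (U j x).
  apply/eqP; rewrite -subr_eq0 -[X in _ - _ * X](eq_Rintegral _ _ (f := fun x => 1 * g j (U j x))); last by move=> x _; rewrite mul1r.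
  rewrite key// => tau eta.
  pose A b tau0 w := (\prod_(i | i \in s) g i (U i w)) *
    cos (\sum_(i | i \notin s) (if i == j then tau0 else t i) * U i w + b).
  have bA b tau0 : bounded_measurable (A b tau0).
    apply: bounded_measurableM; first exact: bm_prod.
    split; last by exists 1 => x; rewrite ler_norml cos_geN1 cos_le1.
    apply: measurableT_comp; first exact: (continuous_measurable_fun (@continuous_cos R)).
    apply: measurable_funD => //; apply: measurable_fun_sum_cond => i.
    exact: measurable_funM.
  transitivity (\int[P]_w (2^-1 * (A (a + eta) tau w + A (a - eta) (- tau) w)) -
      c * \int[P]_w cos (tau * U j w + eta)).
    congr (_ - c * _); apply: eq_Rintegral => w _; last by rewrite mul1r.
    rewrite /A /V !updS -mulrDr mulrCA -[LHS]mulrA; congr (_ * _).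
    move: (\sum_(i | _) _) => S.
    have -> : tau * U j w + S + (a + eta) = (S + a) + (tau * U j w + eta) by ring.
    have -> : - tau * U j w + S + (a - eta) = (S + a) - (tau * U j w + eta) by ring.
    by move: (S + a) (tau * _ + _) => p q; rewrite cosD cosB; field.
  rewrite RintegralZl//; last by apply: rintegrableD; exact: rintegrable_bm.
  rewrite RintegralD//; try exact: rintegrable_bm.
  rewrite !IH !updM (centered_gaussian_cos _ _ (cUj j)) mulNr gauss_cosN /c.
  by rewrite cosD cosB; field.
rewrite [in RHS]inM -mulrA -/c mulrC -key; apply: eq_Rintegral => w _.
by rewrite inM /V; ring.
Qed.

End independence.

(** * Proper complex normal families *)

Section complex_dot.
Variable R : realType.
Implicit Types c x y : R[i].
Local Notation cRe := complex.Re.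
Local Notation cIm := complex.Im.

(** The real inner product Re (conj c x) of the plane; sums of such terms are the real linear
    functionals through which complex normality is expressed. *)
Definition rdot c x : R := cRe c * cRe x + cIm c * cIm x.
Definition nsq x : R := cRe x ^+ 2 + cIm x ^+ 2.

Lemma rdotDr c x y : rdot c (x + y) = rdot c x + rdot c y.
Proof. by case: c x y => [a b] [u v] [u' v']; rewrite /rdot /=; ring. Qed.

Lemma rdotDl c x y : rdot (x + y) c = rdot x c + rdot y c.
Proof. by case: c x y => [a b] [u v] [u' v']; rewrite /rdot /=; ring. Qed.

Lemma rdot0r c : rdot c 0 = 0.
Proof. by case: c => [a b]; rewrite /rdot /=; ring. Qed.

Lemma rdot0l c : rdot 0 c = 0.
Proof. by case: c => [a b]; rewrite /rdot /=; ring. Qed.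

Lemma rdotC c x : rdot c x = rdot x c.
Proof. by rewrite /rdot; ring. Qed.

Lemma rdot_sumr (I : Type) (r : seq I) (p : pred I) c (F : I -> R[i]) :
  rdot c (\sum_(i <- r | p i) F i) = \sum_(i <- r | p i) rdot c (F i).
Proof. exact: (big_morph _ (rdotDr c) (rdot0r c)). Qed.

Lemma rdot_suml (I : Type) (r : seq I) (p : pred I) c (F : I -> R[i]) :
  rdot (\sum_(i <- r | p i) F i) c = \sum_(i <- r | p i) rdot (F i) c.
Proof. exact: (big_morph _ (rdotDl c) (rdot0l c)). Qed.

Lemma rdotMr c x y : rdot c (x * y) = rdot (c * conjc y) x.
Proof. by case: c x y => [a b] [u v] [u' v']; rewrite /rdot /=; ring. Qed.

Lemma rdotZr (a : R) c x : rdot c (a%:C%C * x) = a * rdot c x.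
Proof. by case: c x => [u v] [u' v']; rewrite /rdot /=; ring. Qed.

Lemma rdotZl (a : R) c x : rdot (a%:C%C * c) x = a * rdot c x.
Proof. by rewrite rdotC rdotZr rdotC. Qed.

Lemma rdot_self x : rdot x x = nsq x.
Proof. by rewrite /rdot /nsq; ring. Qed.

Lemma nsq_ge0 x : 0 <= nsq x.
Proof. by rewrite addr_ge0 ?sqr_ge0. Qed.

Lemma nsqM x y : nsq (x * y) = nsq x * nsq y.
Proof. by case: x y => [a b] [u v]; rewrite /nsq /=; ring. Qed.

Lemma nsq_normc x : nsq x = Normc.normc x ^+ 2.
Proof. by case: x => a b; rewrite /nsq /= sqr_sqrtr// addr_ge0 ?sqr_ge0. Qed.

Lemma nsqC x : (nsq x)%:C%C = conjc x * x.
Proof. by case: x => a b; rewrite /nsq; apply/eqP; rewrite eq_complex /=; apply/andP; split; apply/eqP; ring. Qed.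

(** Polarization into a covariance term and a pseudo-covariance term; properness removes the second
    in the mean. *)
Lemma rdotM c x c' x' : rdot c x * rdot c' x' =
  (cRe (conjc c * c' * (x * conjc x')) + cRe (conjc c * conjc c' * (x * x'))) / 2.
Proof. by case: c x c' x' => [a b] [u v] [a' b'] [u' v']; rewrite /rdot /=; field. Qed.

Lemma cReD x y : cRe (x + y) = cRe x + cRe y.
Proof. by case: x y => [? ?] []. Qed.

Lemma cImD x y : cIm (x + y) = cIm x + cIm y.
Proof. by case: x y => [? ?] []. Qed.

Lemma cRe_sum (I : Type) (r : seq I) (p : pred I) (F : I -> R[i]) :
  cRe (\sum_(i <- r | p i) F i) = \sum_(i <- r | p i) cRe (F i).
Proof. exact: (big_morph _ cReD). Qed.

End complex_dot.

Section complex_random_variables.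
Context d (T : measurableType d) (R : realType) (P : probability T R).
Implicit Types (Z : T -> R[i]) (X : int -> {RV P >-> R[i]}).
Local Notation cRe := complex.Re.
Local Notation cIm := complex.Im.

Definition cintegrable Z := rintegrable P (fun w => cRe (Z w)) /\ rintegrable P (fun w => cIm (Z w)).

Lemma cexpectation_Re Z (k : R[i]) : cintegrable Z ->
  \int[P]_w cRe (k * Z w) = cRe (k * cexpectation P Z).
Proof.
move=> [iR iI]; rewrite /cexpectation /cintegral; case: k => a b /=.
rewrite -!RintegralZl//= -RintegralB//; try exact: rintegrableZ.
by apply: eq_Rintegral => w _; case: (Z w).
Qed.

Lemma measurable_Re (Z : {RV P >-> R[i]}) : measurable_fun [set: T] (fun w => cRe (Z w)).
Proof. by have [] := (measurable_fun_complexP Z).1 (measurable_funP Z). Qed.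

Lemma measurable_Im (Z : {RV P >-> R[i]}) : measurable_fun [set: T] (fun w => cIm (Z w)).
Proof. by have [] := (measurable_fun_complexP Z).1 (measurable_funP Z). Qed.

Lemma measurable_rdot (c : R[i]) (Z : {RV P >-> R[i]}) :
  measurable_fun [set: T] (fun w => rdot c (Z w)).
Proof.
by apply: measurable_funD; apply: measurable_funM => //; [exact: measurable_Re|exact: measurable_Im].
Qed.

Lemma rintegrableM_sq (f g : T -> R) : measurable_fun [set: T] f -> measurable_fun [set: T] g ->
  rintegrable P (fun w => f w ^+ 2) -> rintegrable P (fun w => g w ^+ 2) ->
  rintegrable P (fun w => f w * g w).
Proof.
move=> mf mg f2 g2; apply: rintegrable_le (rintegrableD f2 g2) _; first exact: measurable_funM.
by move=> w; rewrite ler_norml; apply/andP; split; have := sqr_ge0 (f w + g w); have := sqr_ge0 (f w - g w); nra.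
Qed.

(** Since pseudo-covariances vanish, the variance of a real functional is half the Hermitian form of
    the covariances, whatever its phases. *)
Lemma proper_gaussian_functional (I : finType) (X : I -> {RV P >-> R[i]}) (r : I -> I -> R[i]) :
  (forall c : I -> R[i], normal_rv P (fun w => \sum_i rdot (c i) (X i w))) ->
  (forall i, cexpectation P (X i) = 0) ->
  (forall i j, cexpectation P (fun w => X i w * X j w) = 0) ->
  (forall i j, cexpectation P (fun w => X i w * conjc (X j w)) = r i j) ->
  forall c : I -> R[i], centered_gaussian P (fun w => \sum_i rdot (c i) (X i w))
    (cRe (\sum_i \sum_j conjc (c i) * c j * r i j) / 2).
Proof.
move=> nX X0 pX rX c.
have single i (a : R[i]) : normal_rv P (fun w => rdot a (X i w)).
  have := nX (fun j => if j == i then a else 0); congr normal_rv.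
  apply/funext => w; rewrite (bigD1 i)//= eqxx big1 ?addr0// => j /negbTE ->.
  by rewrite rdot0l.
(* Real and imaginary parts are themselves real functionals, hence normal; this is the source of all
   the integrability used below. *)
have gRe i : exists v, centered_gaussian P (fun w => cRe (X i w)) v.
  apply: normal_rv_centered_gaussian; first exact: measurable_Re.
  - have := single i 1; congr normal_rv; apply/funext => w.
    by rewrite /rdot /= mul1r mul0r addr0.
  - by have /(congr1 (@complex.Re R)) := X0 i.
have gIm i : exists v, centered_gaussian P (fun w => cIm (X i w)) v.
  apply: normal_rv_centered_gaussian; first exact: measurable_Im.
  - have := single i (0 +i* 1)%C; congr normal_rv; apply/funext => w.
    by rewrite /rdot /= mul1r mul0r add0r.
  - by have /(congr1 (@complex.Im R)) := X0 i.
have iRe i : rintegrable P (fun w => cRe (X i w)).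
  by have [v] := gRe i; exact: centered_gaussian_rintegrable.
have iIm i : rintegrable P (fun w => cIm (X i w)).
  by have [v] := gIm i; exact: centered_gaussian_rintegrable.
have iRe2 i : rintegrable P (fun w => cRe (X i w) ^+ 2).
  by have [v] := gRe i; exact: centered_gaussian_rintegrable_pow.
have iIm2 i : rintegrable P (fun w => cIm (X i w) ^+ 2).
  by have [v] := gIm i; exact: centered_gaussian_rintegrable_pow.
have mRe i := measurable_Re (X i); have mIm i := measurable_Im (X i).
have i1 i (a : R[i]) : rintegrable P (fun w => rdot a (X i w)).
  by apply: rintegrableD; exact: rintegrableZ.
have iM i j : cintegrable (fun w => X i w * X j w).
  split.
  - apply: (rintegrable_eq (f := fun w => cRe (X i w) * cRe (X j w) - cIm (X i w) * cIm (X j w))).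
      by move=> w; case: (X i w) (X j w) => [? ?] [].
    by apply: rintegrableB; exact: rintegrableM_sq.
  - apply: (rintegrable_eq (f := fun w => cRe (X i w) * cIm (X j w) + cIm (X i w) * cRe (X j w))).
      by move=> w; case: (X i w) (X j w) => [? ?] [].
    by apply: rintegrableD; exact: rintegrableM_sq.
have iMc i j : cintegrable (fun w => X i w * conjc (X j w)).
  split.
  - apply: (rintegrable_eq (f := fun w => cRe (X i w) * cRe (X j w) + cIm (X i w) * cIm (X j w))).
      by move=> w; case: (X i w) (X j w) => [? ?] [? ?] /=; ring.
    by apply: rintegrableD; exact: rintegrableM_sq.
  - apply: (rintegrable_eq (f := fun w => cIm (X i w) * cRe (X j w) - cRe (X i w) * cIm (X j w))).
      by move=> w; case: (X i w) (X j w) => [? ?] [? ?] /=; ring.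
    by apply: rintegrableB; exact: rintegrableM_sq.
have [||v gL] := @normal_rv_centered_gaussian _ _ _ P (fun w => \sum_i rdot (c i) (X i w)) _ (nX c).
- by apply: measurable_fun_sum_cond => i; exact: measurable_rdot.
- rewrite rintegral_sum// big1// => i _.
  rewrite RintegralD//; try exact: rintegrableZ.
  rewrite !RintegralZl//; try exact: iRe; try exact: iIm.
  have /(congr1 (@complex.Re R)) /= -> := X0 i; have /(congr1 (@complex.Im R)) /= -> := X0 i.
  by rewrite !mulr0 addr0.
suff -> : cRe (\sum_i \sum_j conjc (c i) * c j * r i j) / 2 = v by [].
rewrite -(centered_gaussian_square gL).
have E w : (\sum_i rdot (c i) (X i w)) ^+ 2 = \sum_i \sum_j
    (2^-1 * cRe (conjc (c i) * c j * (X i w * conjc (X j w))) +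
     2^-1 * cRe (conjc (c i) * conjc (c j) * (X i w * X j w))).
  rewrite expr2 mulr_suml; apply: eq_bigr => i _; rewrite mulr_sumr.
  by apply: eq_bigr => j _; rewrite rdotM mulrC mulrDr.
under [RHS]eq_Rintegral do rewrite E.
have iA (k : R[i]) Z : cintegrable Z -> rintegrable P (fun w => cRe (k * Z w)).
  case: k => a b [iZR iZI]; apply: (rintegrable_eq (f := fun w => a * cRe (Z w) - b * cIm (Z w))).
    by move=> w; case: (Z w).
  by apply: rintegrableB; exact: rintegrableZ.
have iT i j : rintegrable P (fun w =>
    (2^-1 * cRe (conjc (c i) * c j * (X i w * conjc (X j w))) +
     2^-1 * cRe (conjc (c i) * conjc (c j) * (X i w * X j w)))).
  by apply: rintegrableD; apply: rintegrableZ; exact: iA.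
rewrite rintegral_sum; last by move=> i; apply: rintegrable_sum => //; exact: rintegrable_cst.
rewrite cRe_sum mulr_suml; apply: eq_bigr => i _; rewrite rintegral_sum//.
rewrite cRe_sum mulr_suml; apply: eq_bigr => j _.
rewrite RintegralD//; try by apply: rintegrableZ; exact: iA.
rewrite !RintegralZl//; try exact: iA.
by rewrite !cexpectation_Re// rX pX mulr0 /= mulr0 addr0 mulrC.
Qed.

End complex_random_variables.

(** * Path functionals and linear functionals of the channel *)

Section paths.
Context d (T : measurableType d) (R : realType) (P : probability T R).
Implicit Types X : int -> {RV P >-> R[i]}.

Definition path_generator : set (set (int -> R[i])) :=
  [set A | exists n (B : set R[i]), measurable B /\ A = [set x | B (x n)]].

(** A measurable type carrying the sigma-algebra [path_measurable], so that stationarity and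
    independence of processes can be applied to measurable functions of a path. *)
Definition path_space := g_sigma_algebraType path_generator.

Lemma measurable_path_eval n : measurable_fun [set: path_space] (fun x : path_space => x n).
Proof.
by move=> _ B mB; rewrite setTI; apply: sub_sigma_algebra; exists n, B.
Qed.

Lemma measurable_path X : measurable_fun [set: T] (Defs.path X : T -> path_space).
Proof.
have fX (n : int) (B : set R[i]) : measurable B -> measurable (X n @^-1` B).
  by move=> mB; exact: measurable_funPTI.
move=> _ B mB; rewrite setTI.
pose S := [set A : set (int -> R[i]) | measurable ((Defs.path X : T -> int -> R[i]) @^-1` A)].
suff : <<s path_generator >> `<=` S by apply; exact: mB.
apply: smallest_sub.
- split.
  + by rewrite /S/= preimage_set0.
  + by move=> A SA; rewrite setTD; exact: measurableC.
  + by move=> F SF; rewrite /S/= preimage_bigcup; apply: bigcupT_measurable.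
- by move=> _ [n [A [mA ->]]]; exact: fX.
Qed.

Lemma measurable_path_rdot (c : R[i]) n :
  measurable_fun [set: path_space] (fun x : path_space => rdot c (x n)).
Proof.
have /measurable_fun_complexP[mR mI] := measurable_path_eval n.
by apply: measurable_funD; apply: measurable_funM.
Qed.

Lemma stationary_same_law X m (f : path_space -> R) : stationary X ->
  measurable_fun [set: path_space] f ->
  same_law P P (fun w => f (Defs.path (fun n => X (n + m)) w)) (fun w => f (Defs.path X w)).
Proof.
move=> sX mf; apply: same_law_set.
- exact: (measurableT_comp mf (measurable_path (fun n => X (n + m)))).
- exact: (measurableT_comp mf (measurable_path X)).
move=> A mA; apply: (sX m (f @^-1` A)).
by have := mf measurableT _ mA; rewrite setTI.
Qed.

Lemma stationary_autocorrelation X m n : stationary X ->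
  cexpectation P (fun w => X m w * conjc (X n w)) = autocorrelation X (m - n).
Proof.
move=> sX; have mM : measurable_fun [set: path_space] (fun x : path_space => x (m - n) * conjc (x 0)).
  apply: measurable_fun_complexM; first exact: measurable_path_eval.
  have /measurable_fun_complexP[mR mI] := measurable_path_eval 0.
  apply/measurable_fun_complexP; split.
    by apply: eq_measurable_fun mR => x _ /=; case: (x 0).
  by apply: eq_measurable_fun (measurableT_comp (@oppr_measurable R _) mI) => x _ /=; case: (x 0).
have /measurable_fun_complexP[mR mI] := mM.
have L1 := same_law_Rintegral (stationary_same_law n sX mR)
  (measurableT_comp mR (measurable_path (fun k => X (k + n))))
  (measurableT_comp mR (measurable_path X)) (@measurable_id _ _ _).
have L2 := same_law_Rintegral (stationary_same_law n sX mI)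
  (measurableT_comp mI (measurable_path (fun k => X (k + n))))
  (measurableT_comp mI (measurable_path X)) (@measurable_id _ _ _).
rewrite /autocorrelation /cexpectation /cintegral.
move: L1 L2; rewrite /Defs.path subrK add0r => -> ->.
by [].
Qed.

Lemma independent_processes_rvs (I : finType) (X : I -> int -> {RV P >-> R[i]})
    (f : I -> path_space -> R) : independent_processes X ->
  (forall i, measurable_fun [set: path_space] (f i)) ->
  independent_rvs P (fun i w => f i (Defs.path (X i) w)).
Proof.
move=> iX mf A mA; apply: (iX (fun i => f i @^-1` A i)) => i.
by have := mf i measurableT _ (mA i); rewrite setTI.
Qed.

End paths.

Lemma big_option_sum (V : nmodType) (I : finType) (F : option I -> V) :
  \sum_i F i = \sum_i F (Some i) + F None.
Proof.
rewrite (bigD1 None)//= addrC; congr (_ + _).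
rewrite (reindex_omap Some id) => [|[]//].
by apply: eq_bigl => i; rewrite eqxx.
Qed.

Section channel_functionals.
Context d (T : measurableType d) (R : realType) (P : probability T R) (K N : nat).
Variables (H : 'I_K -> int -> {RV P >-> R[i]}) (W : int -> {RV P >-> R[i]}).
Hypothesis HW : rayleigh_channel H W.
Implicit Types (s : int) (z : N.-tuple R[i]).
Local Notation cRe := complex.Re.

(** The offset [s] shifts the fading and not the input: a block placed later inside a longer one
    sees the same input and delayed fading. *)
Definition fade s z (m : 'I_N) (w : T) : R[i] :=
  \sum_(k < K) H k (s + m.+1%:Z) w * input_at z (m.+1%:Z - k%:Z).

(** The matrix S(z). By stationarity it does not depend on the offset of the block. *)
Definition fade_cov z (m n : 'I_N) : R[i] :=
  \sum_(k < K) autocorrelation (H k) (m%:Z - n%:Z) *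
    (input_at z (m.+1%:Z - k%:Z) * conjc (input_at z (n.+1%:Z - k%:Z))).

Lemma fading_functional s k (c : 'I_N -> R[i]) :
  centered_gaussian P (fun w => \sum_m rdot (c m) (H k (s + m.+1%:Z) w))
   (cRe (\sum_m \sum_n conjc (c m) * c n * autocorrelation (H k) (m%:Z - n%:Z)) / 2).
Proof.
have [/(_ k)[zm nm pm st _] _ _ _] := HW.
apply: (proper_gaussian_functional (X := fun m : 'I_N => H k (s + m.+1%:Z)) (r := fun m n : 'I_N => autocorrelation (H k) (m%:Z - n%:Z))).
- move=> {}c; exact: (nm N (fun m => s + m.+1%:Z) (fun m => cRe (c m)) (fun m => complex.Im (c m))).
- by move=> m; exact: zm.
- move=> m n; have := pm (s + m.+1%:Z) (s + n.+1%:Z).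
  by under eq_fun do rewrite !zm !subr0.
- move=> m n; rewrite stationary_autocorrelation//; congr autocorrelation.
  by rewrite -addn1 -(addn1 n) !PoszD; ring.
Qed.

Lemma noise_functional s (c : 'I_N -> R[i]) :
  centered_gaussian P (fun w => \sum_m rdot (c m) (W (s + m.+1%:Z) w))
   (\sum_m nsq (c m) / 2).
Proof.
have [_ _ [[iW _] nW pW zW vW] _] := HW.
apply: centered_gaussian_sum.
- move=> A mA.
  have mrA n (B : set R) (a : R[i]) : measurable B -> measurable [set x : R[i] | B (rdot a x)].
    move=> mB.
    have [mR mI] := (measurable_fun_complexP _).1 (@measurable_id _ R[i] setT).
    have mr : measurable_fun [set: R[i]] (rdot a).
      by apply: measurable_funD; apply: measurable_funM.
    by have := mr measurableT _ mB; rewrite setTI.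
  pose t (m : 'I_N) := s + m.+1%:Z.
  have tI : injective t by move=> m n /addrI [] /ord_inj.
  (* Independence of the noise is stated for sets indexed by times; the sets [A m] are carried along
     the injection [t], all other times receiving the whole plane. *)
  pose B n := if [pick m | t m == n] is Some m then [set x : R[i] | A m (rdot (c m) x)] else setT.
  have Bt m : B (t m) = [set x | A m (rdot (c m) x)].
    by rewrite /B; case: pickP => [m' /eqP/tI ->//|/(_ m)]; rewrite eqxx.
  have mB n : measurable (B n).
    by rewrite /B; case: pickP => [m _|_]; [exact: mrA|exact: measurableT].
  have := iW (map t (enum 'I_N)) B; rewrite map_inj_uniq ?enum_uniq//.
  move=> /(_ isT mB); rewrite big_map big_enum/=.
  under eq_bigr do rewrite Bt.
  move=> <-; congr (P _); apply/seteqP; split => w /= h.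
  + move=> _ /mapP[m _ ->]; rewrite Bt; exact: h.
  + move=> m _; have := h (t m); rewrite Bt; apply.
    by apply: map_f; rewrite mem_enum.
- move=> m; pose X (_ : 'I_1) := W (s + m.+1%:Z).
  have [||||] := @proper_gaussian_functional _ _ _ P 'I_1 X (fun _ _ => 1) _ _ _ _ (fun _ => c m).
  + move=> a; exact: (nW 1%N (fun=> s + m.+1%:Z) (fun i => cRe (a i)) (fun i => complex.Im (a i))).
  + by move=> i; exact: zW.
  + move=> i j; have := pW (s + m.+1%:Z) (s + m.+1%:Z).
    by under eq_fun do rewrite !zW !subr0.
  + move=> i j; have := vW (s + m.+1%:Z).
    by under eq_fun do rewrite !zW !subr0.
  rewrite !big_ord1 mulr1 -nsqC /= => v0 mU L.
  by split => //; move: mU L; rewrite /X; under eq_fun do rewrite big_ord1.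
Qed.

(** One independent normal summand per process, the noise sitting at [None]. The input symbols are
    absorbed into the coefficients of the fading functionals, and the variances add up to the form
    of S(z). *)
Lemma channel_functional s z (e f : 'I_N -> R[i]) :
  centered_gaussian P
    (fun w => \sum_m rdot (e m) (fade s z m w) + \sum_m rdot (f m) (W (s + m.+1%:Z) w))
    (cRe (\sum_m \sum_n conjc (e m) * e n * fade_cov z m n) / 2 + \sum_m nsq (f m) / 2).
Proof.
have [_ _ _ iHW] := HW.
pose G (i : option 'I_K) := if i is Some k then H k else W.
pose zk (k : 'I_K) (m : 'I_N) := input_at z (m.+1%:Z - k%:Z).
pose c (i : option 'I_K) m := if i is Some k then e m * conjc (zk k m) else f m.
pose g (i : option 'I_K) (x : path_space R) := \sum_m rdot (c i m) (x (s + m.+1%:Z)).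
pose v (i : option 'I_K) := if i is Some k then
   cRe (\sum_m \sum_n conjc (c (Some k) m) * (c (Some k) n) * autocorrelation (H k) (m%:Z - n%:Z)) / 2
   else \sum_m nsq (f m) / 2.
have ind : independent_rvs P (fun i w => g i (Defs.path (G i) w)).
  apply: independent_processes_rvs => // i.
  by apply: measurable_fun_sum_cond => m; exact: measurable_path_rdot.
have := centered_gaussian_sum (v := v) ind.
have -> : \sum_i v i = cRe (\sum_m \sum_n conjc (e m) * e n * fade_cov z m n) / 2 + \sum_m nsq (f m) / 2.
  rewrite big_option_sum /v; congr (_ + _).
  rewrite -mulr_suml -cRe_sum; congr (cRe _ / _).
  rewrite exchange_big; apply: eq_bigr => m _; rewrite exchange_big; apply: eq_bigr => n _.
  rewrite /fade_cov mulr_sumr; apply: eq_bigr => k _.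
  rewrite /c rmorphM /= conjcK /zk; ring.
have -> : (fun w => \sum_i g i (Defs.path (G i) w)) = (fun w => \sum_m rdot (e m) (fade s z m w) + \sum_m rdot (f m) (W (s + m.+1%:Z) w)).
  apply/funext => w; rewrite big_option_sum /g; congr (_ + _).
  rewrite exchange_big; apply: eq_bigr => m _; rewrite /fade rdot_sumr.
  by apply: eq_bigr => k _; rewrite rdotMr.
apply=> -[k|]; [exact: fading_functional|exact: noise_functional].
Qed.

End channel_functionals.
(** * Density of the output with respect to the noise *)

Section hermitian.
Context d (T : measurableType d) (R : realType) (P : probability T R).
Implicit Types X : int -> {RV P >-> R[i]}.

Lemma RintegralN (f : T -> R) : \int[P]_w (- f w) = - \int[P]_w f w.
Proof.
rewrite /Rintegral integralE [in RHS]integralE.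
have -> : ((fun x => (- f x)%:E)^\+ = (fun x => (f x)%:E)^\-)%E.
  by apply/funext => x; rewrite funeposE funenegE.
have -> : ((fun x => (- f x)%:E)^\- = (fun x => (f x)%:E)^\+)%E.
  by apply/funext => x; rewrite funeposE funenegE EFinN oppeK.
by case: (integral _ _ _) => [a| |]; case: (integral _ _ _) => [b| |] /=; rewrite ?oppr0//; ring.
Qed.

Lemma autocorrelation_conj X n : stationary X ->
  autocorrelation X (- n) = conjc (autocorrelation X n).
Proof.
move=> sX; have := stationary_autocorrelation 0 n sX; rewrite sub0r => <-.
rewrite /autocorrelation /cexpectation /cintegral /=; congr (_ +i* _)%C.
  by apply: eq_Rintegral => w _; case: (X 0 w) (X n w) => [? ?] [? ?] /=; ring.
rewrite -RintegralN.
by apply: eq_Rintegral => w _; case: (X 0 w) (X n w) => [? ?] [? ?] /=; ring.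
Qed.

Lemma fade_cov_conj (K N : nat) (H : 'I_K -> int -> {RV P >-> R[i]}) (z : N.-tuple R[i])
    (m n : 'I_N) : (forall k, stationary (H k)) ->
  fade_cov H z n m = conjc (fade_cov H z m n).
Proof.
move=> sH; rewrite /fade_cov.
transitivity (\sum_(k < K) conjc (autocorrelation (H k) (m%:Z - n%:Z) *
    (input_at z (m.+1%:Z - k%:Z) * conjc (input_at z (n.+1%:Z - k%:Z))))); last first.
  by apply/esym; exact: (rmorph_sum (@conjc R)).
apply: eq_bigr => k _.
rewrite -opprB autocorrelation_conj//.
move: (autocorrelation _ _) (input_at z (m.+1%:Z - _)) (input_at _ _) => [a b] [u v] [x y].
by apply/eqP; rewrite eq_complex /=; apply/andP; split; apply/eqP; ring.
Qed.

End hermitian.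

Section hermitian_spectral.
Variables (R : realType) (N : nat) (S : 'I_N -> 'I_N -> R[i]).
Hypothesis herm : forall m n, S n m = conjc (S m n).

Lemma hermitian_spectral : exists (p : 'I_N -> 'I_N -> R[i]) (l : 'I_N -> R),
  [/\ forall j k, \sum_n p j n * conjc (p k n) = (j == k)%:R,
      forall m n, \sum_j conjc (p j m) * p j n = (m == n)%:R &
      forall m n, S m n = \sum_j conjc (p j m) * (l j)%:C%C * p j n].
Proof.
pose A : 'M[R[i]]_N := \matrix_(m, n) S m n.
have hA : A \is hermsymmx.
  apply/is_hermitianmxP; rewrite expr0 scale1r; apply/matrixP => m n.
  by rewrite !mxE herm.
have /hermitian_normalmx/orthomx_spectralP AE := hA.
have /hermitian_spectral_diag_real dR := hA.
set p := spectralmx A in AE; set D := spectral_diag A in AE dR.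
have pU : p \is unitarymx by exact: spectral_unitarymx.
exists (fun j n => p j n), (fun j => complex.Re (D 0 j)).
have DE j : (complex.Re (D 0 j))%:C%C = D 0 j.
  by have /mxOverP/(_ 0 j) := dR; exact: RRe_real.
rewrite (invmx_unitary pU) in AE.
split.
- move=> j k; have /unitarymxP/matrixP/(_ j k) := pU; rewrite !mxE => <-.
  by apply: eq_bigr => n _; rewrite !mxE.
- move=> m n; have := pU; rewrite -trmxC_unitary => /unitarymxP; rewrite trmxCK => /matrixP/(_ m n).
  rewrite !mxE => <-.
  by apply: eq_bigr => j _; rewrite !mxE.
- move=> m n; have := AE => /matrixP/(_ m n); rewrite !mxE => ->.
  apply: eq_bigr => j _; rewrite mul_mx_diag !mxE DE.
  by [].
Qed.

End hermitian_spectral.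

Section generated_functionals.
Context d (E : measurableType d) (R : realType) (J : finType) (f : J -> E -> R).
Hypothesis mf : forall j, measurable_fun [set: E] (f j).
Hypothesis gen : forall d' (S : measurableType d') (phi : S -> E),
  (forall j, measurable_fun [set: S] (fun x => f j (phi x))) -> measurable_fun [set: S] phi.

(** The property [gen] says that the functions [f j] generate the sigma-algebra of [E]; rectangles
    in these functions then form a generating system closed under intersection. *)
Lemma bcont_generated (L : (E -> R) -> R) : bounded_continuous L ->
  (forall B : J -> set R, (forall j, measurable (B j)) ->
     L (fun x => \prod_j \1_(B j) (f j x)) = 0) ->
  forall h, bounded_measurable h -> L h = 0.
Proof.
move=> LC H; apply: (bcont_bounded0 LC) => A mA.
pose G := [set A : set E | exists2 B : J -> set R, (forall j, measurable (B j)) &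
   A = \bigcap_(j in [set: J]) (f j @^-1` B j)].
have L1 B : (forall j, measurable (B j)) -> L (\1_(\bigcap_(j in [set: J]) (f j @^-1` B j))) = 0.
  move=> mB; rewrite -[RHS](H B mB); congr L.
  apply/funext => x; rewrite indicE.
  have [wA|wA] := boolP (x \in _).
    apply/esym; apply: big1 => i _; rewrite indicE mem_set//.
    by move/set_mem : wA; exact.
  have [i wi] : exists i, ~ B i (f i x).
    apply/not_existsP => h; move/negP: wA; apply; apply/mem_set => i _.
    by apply: contrapT; exact: h.
  by rewrite (bigD1 i)//= indicE memNset// mul0r.
have mfB j (B : set R) : measurable B -> measurable (f j @^-1` B).
  by move=> mB; have := mf j measurableT mB; rewrite setTI.
apply: (bcont_indic0 LC (G := G)) => //.
- apply/seteqP; split => B.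
  + have mid : measurable_fun [set: g_sigma_algebraType G] (id : g_sigma_algebraType G -> E).
      apply: gen => j _ C mC; rewrite setTI; apply: sub_sigma_algebra.
      exists (fun i => if i == j then C else setT).
        by move=> i; case: ifP => // _; exact: measurableT.
      apply/seteqP; split => x /=.
        by move=> Cx i _; case: eqVneq => // ->.
      by move/(_ j I); rewrite eqxx.
    by move=> mB; have := mid measurableT _ mB; rewrite setTI.
  + apply: smallest_sub; first exact: sigma_algebra_measurable.
    move=> _ [C mC ->]; apply: fin_bigcap_measurable => // j _; exact: mfB.
- move=> _ _ [B mB ->] [C mC ->]; exists (fun j => B j `&` C j).
    by move=> j; exact: measurableI.
  apply/seteqP; split => x /=.
    by move=> [h1 h2] j _; split; [exact: h1|exact: h2].
  by move=> h; split => j _; have [] := h j I.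
- have := L1 (fun=> setT) (fun=> measurableT); congr (L _ = _); congr (\1_ _).
  by apply/seteqP; split.
- by move=> _ [B mB ->]; exact: L1.
Qed.

End generated_functionals.

Section complex_coordinates.
Variables (R : realType) (N : nat).
Local Notation C := R[i].

Definition part (b : bool) (x : C) : R := if b then complex.Im x else complex.Re x.

Lemma measurable_part b : measurable_fun [set: C] (part b).
Proof.
have [mR mI] := (measurable_fun_complexP _).1 (@measurable_id _ C setT).
by case: b.
Qed.

End complex_coordinates.

Lemma sum_pairE (V : nmodType) (I I' : finType) (F : I * I' -> V) :
  \sum_ij F ij = \sum_i \sum_j F (i, j).
Proof. by rewrite pair_bigA; apply: eq_bigr => -[]. Qed.

Section products_of_nonnegative.
Context d (T : measurableType d) (R : realType) (P : probability T R) (I : finType).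
Variable (U : I -> T -> R).
Hypothesis mU : forall i, measurable_fun [set: T] (U i).
Hypothesis HI : forall g : I -> R -> R, (forall i, bounded_measurable (g i)) ->
  \int[P]_w (\prod_i g i (U i w)) = \prod_i \int[P]_w g i (U i w).

(** Truncation at level n reduces to bounded functions; the limit is monotone for the product and
    dominated by [h i] in each factor. *)
Lemma prod_expectation_ge0 (h : I -> R -> R) :
  (forall i, measurable_fun [set: R] (h i)) -> (forall i x, 0 <= h i x) ->
  (forall i, rintegrable P (fun w => h i (U i w))) ->
  (\int[P]_w (\prod_i h i (U i w))%:E = (\prod_i \int[P]_w h i (U i w))%:E)%E.
Proof.
move=> mh h0 ih.
pose g n i x := Num.min (h i x) n%:R.
have g0 n i x : 0 <= g n i x by rewrite le_min h0 ler0n.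
have mg n i : measurable_fun [set: R] (g n i) by apply: measurable_minr.
have bg n i : bounded_measurable (g n i).
  by split=> //; exists n%:R => x; rewrite ger0_norm// ge_min lexx orbT.
have gh i x : g n i x @[n --> \oo] --> h i x.
  apply: cvg_near_cst; near=> n.
  by apply/min_idPl; apply: ltW; near: n; exact: nbhs_infty_gtr.
have gle n m i x : (n <= m)%N -> g n i x <= g m i x.
  by move=> nm; rewrite /g le_min ge_min lexx/= ge_min ler_nat nm orbT.
have cvg_prod (G : nat -> I -> R) (G' : I -> R) : (forall i, G n i @[n --> \oo] --> G' i) ->
    \prod_i G n i @[n --> \oo] --> \prod_i G' i.
  move=> GG; elim: (index_enum I) => [|i r IH].
    by rewrite big_nil; under eq_fun do rewrite big_nil; exact: cvg_cst.
  by rewrite big_cons; under eq_fun do rewrite big_cons; apply: cvgM; [exact: GG|].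
transitivity (limn (fun n => (\int[P]_w (\prod_i g n i (U i w))%:E)%E)).
  rewrite -monotone_convergence//.
  - apply: eq_integral => w _; apply/esym/cvg_lim => //.
    by apply: cvg_EFin; [exact: nearW|exact: cvg_prod].
  - move=> n; apply/measurable_EFinP; apply: (proj1 (bounded_measurable_prod _ _ _)) => i.
    by split; [exact: (measurableT_comp (mg n i))|exists n%:R => w; have [_] := bg n i; rewrite ger0_norm// ge_min lexx orbT].
  - by move=> n w _; rewrite lee_fin prodr_ge0.
  - move=> w _ n m nm; rewrite lee_fin; apply: ler_prod => i _.
    by rewrite g0 gle.
apply/cvg_lim => //.
under eq_fun => n.
  rewrite rintegralE; last first.
    apply: rintegrable_bm; apply: bounded_measurable_prod => i.
    by split; [exact: (measurableT_comp (mg n i))|exists n%:R => w; rewrite ger0_norm// ge_min lexx orbT].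
  rewrite HI//.
  over.
apply: cvg_EFin; first exact: nearW.
apply: cvg_prod => i.
have := @dominated_convergence _ _ _ P _ measurableT (fun n w => (g n i (U i w))%:E)
  (fun w => (h i (U i w))%:E) (fun w => (h i (U i w))%:E).
case.
- by move=> n; apply/measurable_EFinP; exact: (measurableT_comp (mg n i)).
- by apply/measurable_EFinP; exact: (measurableT_comp (mh i)).
- by apply: aeW => w _; apply: cvg_EFin; [exact: nearW|exact: gh].
- exact: ih.
- by apply: aeW => w n _ /=; rewrite lee_fin ger0_norm// ge_min lexx.
move=> fi _; rewrite rintegralE//.
by move/fine_cvg.
Unshelve. all: end_near. Qed.

Lemma rintegrable_prod_ge0 (h : I -> R -> R) :
  (forall i, measurable_fun [set: R] (h i)) -> (forall i x, 0 <= h i x) ->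
  (forall i, rintegrable P (fun w => h i (U i w))) ->
  rintegrable P (fun w => \prod_i h i (U i w)).
Proof.
move=> mh h0 ih; apply/integrableP; split.
  apply/measurable_EFinP; elim: (index_enum I) => [|i r IH].
    by under eq_fun do rewrite big_nil; exact: measurable_cst.
  under eq_fun do rewrite big_cons; apply: measurable_funM => //.
  exact: (measurableT_comp (mh i)).
under eq_integral do rewrite /= ger0_norm ?prodr_ge0//.
by rewrite prod_expectation_ge0// ltry.
Qed.

End products_of_nonnegative.

Section unitary_rotation.
Variables (R : realType) (N : nat).
Local Notation C := R[i].
Variables (p : 'I_N -> 'I_N -> C).
Hypothesis pp : forall j k, \sum_n p j n * conjc (p k n) = (j == k)%:R.
Hypothesis pp' : forall m n, \sum_j conjc (p j m) * p j n = (m == n)%:R.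

Definition rotate (y : 'I_N -> C) (j : 'I_N) : C := \sum_n p j n * y n.

Definition part_unit (b : bool) : C := if b then (0 +i* 1)%C else 1.

Lemma rdot_part_unit b x : rdot (part_unit b) x = part b x.
Proof. by case: b x => [] [u v]; rewrite /rdot /part /=; ring. Qed.

Lemma nsq_part_unit b : nsq (part_unit b) = 1.
Proof. by case: b; rewrite /nsq /=; ring. Qed.

Lemma sum_part_sq (x : C) : \sum_b part b x ^+ 2 = nsq x.
Proof. by rewrite big_bool /nsq /= addrC. Qed.

Lemma sum_part_mul (x y : C) : \sum_b part b x * part b y = rdot x y.
Proof. by rewrite big_bool /rdot /= addrC. Qed.

Lemma rdot_rotate a y j : rdot a (rotate y j) = \sum_n rdot (a * conjc (p j n)) (y n).
Proof.
rewrite /rotate rdot_sumr; apply: eq_bigr => n _.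
by rewrite mulrC rdotMr.
Qed.

Lemma rotateK y n : \sum_j conjc (p j n) * rotate y j = y n.
Proof.
transitivity (\sum_m (n == m)%:R * y m).
  under eq_bigr do rewrite /rotate mulr_sumr.
  rewrite exchange_big; apply: eq_bigr => m _ /=.
  by rewrite -pp' mulr_suml; apply: eq_bigr => j _; rewrite mulrA.
rewrite (bigD1 n)//= eqxx mul1r big1 ?addr0// => m /negbTE.
by rewrite eq_sym => ->; rewrite mul0r.
Qed.

Lemma sum_rdot_rotate x y : \sum_j rdot (rotate x j) (rotate y j) = \sum_n rdot (x n) (y n).
Proof.
under eq_bigr do rewrite rdot_rotate.
rewrite exchange_big; apply: eq_bigr => n _ /=.
rewrite -[in RHS](rotateK x n) rdot_suml; apply: eq_bigr => j _.
by rewrite mulrC.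
Qed.

Lemma sum_nsq_rotate y : \sum_j nsq (rotate y j) = \sum_n nsq (y n).
Proof.
under eq_bigr do rewrite -rdot_self.
by rewrite sum_rdot_rotate; apply: eq_bigr => n _; rewrite rdot_self.
Qed.

Lemma rotate_comb (a : 'I_N -> C) k : rotate (fun n => \sum_j a j * conjc (p j n)) k = a k.
Proof.
rewrite /rotate; under eq_bigr do rewrite mulr_sumr.
rewrite exchange_big /=.
transitivity (\sum_j a j * (k == j)%:R).
  by apply: eq_bigr => j _; rewrite -pp mulr_sumr; apply: eq_bigr => n _; ring.
rewrite (bigD1 k)//= eqxx mulr1 big1 ?addr0// => j /negbTE; rewrite eq_sym => ->.
by rewrite mulr0.
Qed.

Section diagonalized.
Variables (S : 'I_N -> 'I_N -> C) (l : 'I_N -> R).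
Hypothesis pS : forall m n, S m n = \sum_j conjc (p j m) * (l j)%:C%C * p j n.

Lemma quadratic_form_rotate (e : 'I_N -> C) : \sum_m \sum_n conjc (e m) * e n * S m n =
  \sum_k (l k * nsq (rotate e k))%:C%C.
Proof.
transitivity (\sum_k \sum_m \sum_n conjc (e m) * e n * (conjc (p k m) * (l k)%:C%C * p k n)).
  rewrite [RHS]exchange_big; apply: eq_bigr => m _; rewrite [RHS]exchange_big; apply: eq_bigr => n _.
  by rewrite pS mulr_sumr.
apply: eq_bigr => k _.
rewrite rmorphM /= nsqC.
have -> : conjc (rotate e k) = \sum_m conjc (p k m) * conjc (e m).
  rewrite /rotate; transitivity (\sum_n conjc (p k n * e n)).
    exact: (rmorph_sum (@conjc R)).
  by apply: eq_bigr => n _; rewrite rmorphM.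
rewrite mulr_suml mulr_sumr; apply: eq_bigr => m _.
rewrite /rotate mulr_sumr mulr_sumr; apply: eq_bigr => n _; ring.
Qed.

Lemma sum_nsq_row j : \sum_n nsq (p j n) = 1.
Proof.
have /(congr1 (@complex.Re R)) := pp j j; rewrite eqxx cRe_sum /= => <-.
by apply: eq_bigr => n _; case: (p j n) => u v; rewrite /nsq /=; ring.
Qed.

Lemma diagonalized_trace : \sum_n complex.Re (S n n) = \sum_j l j.
Proof.
under eq_bigr do rewrite pS cRe_sum.
rewrite exchange_big; apply: eq_bigr => j _ /=.
rewrite -[RHS]mulr1 -(sum_nsq_row j) mulr_sumr.
by apply: eq_bigr => n _; case: (p j n) => u v; rewrite /nsq /=; ring.
Qed.

(** Unitary invariance of the Hilbert-Schmidt norm: rotating the column n of S turns its entry k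
    into l_k p_kn, and the rows of p have norm 1. *)
Lemma diagonalized_nsq : \sum_m \sum_n nsq (S m n) = \sum_j l j ^+ 2.
Proof.
rewrite exchange_big /=.
transitivity (\sum_n \sum_k l k ^+ 2 * nsq (p k n)).
  apply: eq_bigr => n _; rewrite -(sum_nsq_rotate (fun m => S m n)).
  apply: eq_bigr => k _.
  have -> : rotate (S^~ n) k = (l k)%:C%C * p k n.
    rewrite -(rotate_comb (fun j => (l j)%:C%C * p j n)) /rotate.
    apply: eq_bigr => m _; rewrite pS; congr (_ * _); apply: eq_bigr => j _; ring.
  by rewrite nsqM; congr (_ * _); rewrite /nsq /=; ring.
rewrite exchange_big; apply: eq_bigr => j _ /=.
by rewrite -mulr_sumr sum_nsq_row mulr1.
Qed.

End diagonalized.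
End unitary_rotation.

Lemma integral_prob_cst d (T : measurableType d) (R : realType) (P : probability T R) (c : R) :
  (\int[P]_x c%:E = c%:E)%E.
Proof. by rewrite integral_cst//= [X in (_ * X)%E](@probability_setT _ _ _ P) mule1. Qed.

Section gaussian_gain.
Variable R : realType.
Implicit Types (u a U : R).

(** Density of the normal law of variance (1 + u) / 2 with respect to that of variance 1/2, the
    latter being the law of the real and imaginary parts of the noise. *)
Definition gain u (x : R) : R := (Num.sqrt (1 + u))^-1 * expR (x ^+ 2 * (u / (1 + u))).

Lemma gain_gt0 u x : 0 <= u -> 0 < gain u x.
Proof. by move=> u0; rewrite mulr_gt0 ?expR_gt0// invr_gt0 sqrtr_gt0; lra. Qed.

Lemma measurable_gain u : measurable_fun [set: R] (gain u).
Proof. by rewrite /gain; mfun. Qed.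

Lemma centered_gaussian_gain d (T : measurableType d) (P : probability T R)
    d' (T' : measurableType d') (P' : probability T' R) (U : T -> R) (U' : T' -> R) u (f : R -> R) :
  0 <= u -> centered_gaussian P U 2^-1 -> centered_gaussian P' U' ((1 + u) / 2) ->
  measurable_fun [set: R] f -> (forall x, 0 <= f x) ->
  (\int[P]_w (gain u (U w) * f (U w))%:E = \int[P']_w (f (U' w))%:E)%E.
Proof.
move=> u0 cU cU' mf f0.
have u1 : 0 < 1 + u by lra.
have su : 0 < Num.sqrt (1 + u) by rewrite sqrtr_gt0.
have s1 : (1 - u / (1 + u)) = (1 + u)^-1 by field; lra.
have k1 : -1 < - (u / (1 + u)) by rewrite -subr_gt0 opprK addrC s1 invr_gt0.
pose s : R := Num.sqrt 2^-1; have s2 : s ^+ 2 = 2^-1 by rewrite sqr_sqrtr.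
have mF : measurable_fun [set: R] (fun x => (Num.sqrt (1 + u))^-1 * f (s * x)) by mfun.
have F0 x : 0 <= (Num.sqrt (1 + u))^-1 * f (s * x) by rewrite mulr_ge0// invr_ge0 ltW.
transitivity (\int[gauss R]_x ((Num.sqrt (1 + u))^-1 * f (s * x) *
    expR (0 * x - - (u / (1 + u)) * x ^+ 2 / 2))%:E)%E.
  rewrite (centered_gaussian_ge0 cU (f := fun x => gain u x * f x)); last 2 first.
  - by apply: measurable_funM => //; exact: measurable_gain.
  - by move=> x; rewrite mulr_ge0// ltW// gain_gt0.
  apply: eq_integral => x _; congr EFin; rewrite /gain -/s exprMn s2.
  rewrite mulrAC; congr (_ * expR _); rewrite mul0r; field; lra.
rewrite gauss_quadratic// (centered_gaussian_ge0 cU')// -ge0_integralZl//; last 2 first.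
- by apply/measurable_EFinP; mfun.
- by move=> x _; rewrite lee_fin F0.
apply: eq_integral => x _; rewrite -EFinM; congr EFin.
rewrite s1 sqrtrV ?ltW// invrK expr0n /= !mul0r expR0 mulr1 add0r mulrA divff ?mul1r ?gt_eqF//.
by rewrite sqrtrM ?ltW// (mulrC _ s) mulrA.
Qed.

Lemma centered_gaussian_gain1 d (T : measurableType d) (P : probability T R) (U : T -> R) u :
  0 <= u -> centered_gaussian P U 2^-1 ->
  rintegrable P (fun w => gain u (U w)) /\ \int[P]_w gain u (U w) = 1.
Proof.
move=> u0 cU.
have c' : centered_gaussian (gauss R) (fun x : measurableTypeR R => Num.sqrt ((1 + u) / 2) * x) ((1 + u) / 2).
  by split => //; [lra|exact: measurable_funM].
have := centered_gaussian_gain u0 cU c' (measurable_cst (1 : R)) (fun=> ler01).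
under eq_integral do rewrite mulr1.
rewrite (integral_prob_cst _ 1) => H.
split; last by rewrite /Rintegral H.
apply/integrableP; split.
  apply/measurable_EFinP; case: cU => _ mU _.
  exact: (measurableT_comp (measurable_gain u)).
by under eq_integral do rewrite /= ger0_norm ?ltW ?gain_gt0//; rewrite H ltry.
Qed.

(** The exponential is the likelihood ratio at a of the noise shifted by sqrt rho U against the
    noise. Its average over a normal U is the density of the sum, of variance (1 + rho l) / 2. *)
Lemma centered_gaussian_tilt d (T : measurableType d) (P : probability T R) (U : T -> R) (l rho : R) a :
  0 <= l -> 0 <= rho -> centered_gaussian P U (l / 2) ->
  (\int[P]_w (expR (2 * Num.sqrt rho * a * U w - rho * U w ^+ 2))%:E = (gain (rho * l) a)%:E)%E.
Proof.
move=> l0 r0 cU; rewrite (centered_gaussian_ge0 cU (f := fun x => expR (2 * Num.sqrt rho * a * x - rho * x ^+ 2))); last 2 first.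
- by mfun.
- by move=> x; rewrite expR_ge0.
have k0 : 0 <= rho * l by rewrite mulr_ge0.
pose s := Num.sqrt (l / 2); have s2 : s ^+ 2 = l / 2 by rewrite sqr_sqrtr//; lra.
have := @gauss_quadratic R (fun=> 1) (2 * Num.sqrt rho * a * s) (rho * l) _ _ _.
rewrite (integral_prob_cst _ 1) mule1 => H.
transitivity (\int[gauss R]_x (1 * expR (2 * Num.sqrt rho * a * s * x - rho * l * x ^+ 2 / 2))%:E)%E.
  apply: eq_integral => x _; congr EFin; rewrite mul1r -/s exprMn s2; congr expR; by field.
rewrite H//; last exact: lt_le_trans (ltrN10 R) k0.
congr (_ * expR _)%:E.
clear H; rewrite !exprMn sqr_sqrtr// s2; field; lra.
Qed.

End gaussian_gain.

Section gaussian_vector.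
Context d (T : measurableType d) (R : realType) (P : probability T R) (N : nat).
Local Notation C := R[i].
Local Notation cRe := complex.Re.

(** Centered proper normal vectors with covariance [S], degenerate ones included, described by the
    laws of their real functionals. *)
Definition proper_gaussian (X : 'I_N -> T -> C) (S : 'I_N -> 'I_N -> C) := forall e : 'I_N -> C,
  centered_gaussian P (fun w => \sum_m rdot (e m) (X m w))
    (cRe (\sum_m \sum_n conjc (e m) * e n * S m n) / 2).

Lemma proper_gaussian_measurable X S m : proper_gaussian X S -> measurable_fun [set: T] (X m).
Proof.
move=> GX; have H b : measurable_fun [set: T] (fun w => part b (X m w)).
  have [_ + _] := GX (fun k => (k == m)%:R * part_unit R b).
  apply: eq_measurable_fun => w _; rewrite (bigD1 m)//= big1 => [|i /negbTE ->]; last by rewrite mul0r rdot0l.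
  by rewrite eqxx mul1r rdot_part_unit addr0.
by apply/measurable_fun_complexP; split; [exact: (H false)|exact: (H true)].
Qed.

Lemma proper_gaussian_part X S m b : proper_gaussian X S ->
  centered_gaussian P (fun w => part b (X m w)) (cRe (S m m) / 2).
Proof.
move=> /(_ (fun k => (k == m)%:R * part_unit R b)); congr centered_gaussian.
- apply/funext => w; rewrite (bigD1 m)//= big1 => [|i /negbTE ->]; last by rewrite mul0r rdot0l.
  by rewrite eqxx mul1r rdot_part_unit addr0.
- congr (cRe _ / _).
  rewrite (bigD1 m)//= [X in _ + X]big1 => [|i /negbTE im]; last first.
    by apply: big1 => j _; rewrite im mul0r conjc0 !mul0r.
  rewrite addr0 (bigD1 m)//= big1 => [|j /negbTE ->]; last by rewrite mul0r mulr0 mul0r.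
  rewrite addr0 eqxx !mul1r -nsqC nsq_part_unit.
  by rewrite mul1r.
Qed.

Lemma proper_gaussian_nsq X S m : proper_gaussian X S ->
  rintegrable P (fun w => nsq (X m w)) /\ \int[P]_w nsq (X m w) = cRe (S m m).
Proof.
move=> GX.
have ip b : rintegrable P (fun w => part b (X m w) ^+ 2).
  exact: (centered_gaussian_rintegrable_pow _ (proper_gaussian_part m b GX)).
have E w : nsq (X m w) = \sum_b part b (X m w) ^+ 2 by rewrite sum_part_sq.
split.
  apply: rintegrable_eq (fun w => esym (E w)) _.
  by apply: rintegrable_sum => [|b]; [exact: rintegrable_cst|exact: ip].
under eq_Rintegral do rewrite E.
rewrite rintegral_sum//.
under eq_bigr do rewrite (centered_gaussian_square (proper_gaussian_part m _ GX)).
by rewrite big_bool /=; field.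
Qed.

Variables (X : 'I_N -> T -> C) (S : 'I_N -> 'I_N -> C).
Hypothesis GX : proper_gaussian X S.
Variables (p : 'I_N -> 'I_N -> C) (l : 'I_N -> R).
Hypothesis pp : forall j k, \sum_n p j n * conjc (p k n) = (j == k)%:R.
Hypothesis pp' : forall m n, \sum_j conjc (p j m) * p j n = (m == n)%:R.
Hypothesis pS : forall m n, S m n = \sum_j conjc (p j m) * (l j)%:C%C * p j n.

Definition coordinate (jb : 'I_N * bool) (w : T) : R := part jb.2 (rotate p (fun n => X n w) jb.1).

(** In the eigenbasis the variance of a functional is a diagonal form in its 2N real coefficients;
    this is what makes the 2N real coordinates independent. *)
Lemma coordinate_gaussian (t : 'I_N * bool -> R) : centered_gaussian P
  (fun w => \sum_i t i * coordinate i w) (\sum_i t i ^+ 2 * (l i.1 / 2)).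
Proof.
pose a j := \sum_b (t (j, b))%:C%C * part_unit R b.
pose e n := \sum_j a j * conjc (p j n).
have nsq_ab (u : bool -> R) : nsq (\sum_b (u b)%:C%C * part_unit R b) = \sum_b u b ^+ 2.
  by rewrite !big_bool /nsq /part_unit /=; ring.
have := GX e; congr (centered_gaussian P _ _).
- apply/funext => w.
  transitivity (\sum_j rdot (a j) (rotate p (fun n => X n w) j)).
    under [RHS]eq_bigr do rewrite rdot_rotate.
    by rewrite exchange_big; apply: eq_bigr => n _; rewrite rdot_suml.
  rewrite [RHS]sum_pairE /=.
  apply: eq_bigr => j _; rewrite rdot_suml; apply: eq_bigr => b _.
  by rewrite rdotZl rdot_part_unit.
- rewrite (quadratic_form_rotate pS) cRe_sum mulr_suml.
  rewrite [RHS]sum_pairE /=.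
  apply: eq_bigr => j _; rewrite (rotate_comb pp) nsq_ab -mulr_suml /=; ring.
Qed.

Lemma coordinate_independence g : (forall jb, bounded_measurable (g jb)) ->
  \int[P]_w (\prod_j g j (coordinate j w)) = \prod_j \int[P]_w g j (coordinate j w).
Proof. exact: (gaussian_independence coordinate_gaussian). Qed.

Lemma coordinate_centered jb : centered_gaussian P (coordinate jb) (l jb.1 / 2).
Proof.
have := coordinate_gaussian (fun i => (i == jb)%:R); congr centered_gaussian.
- apply/funext => w; rewrite (bigD1 jb)//= big1 => [|i /negbTE ->]; last by rewrite mul0r.
  by rewrite eqxx mul1r addr0.
- rewrite (bigD1 jb)//= big1 => [|i /negbTE ->]; last by rewrite expr0n mul0r.
  by rewrite eqxx expr1n mul1r addr0.
Qed.

Lemma eigenvalue_ge0 j : 0 <= l j.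
Proof. by have [+ _ _] := coordinate_centered (j, true); rewrite /=; lra. Qed.

Lemma coordinate_nsq j : rintegrable P (fun w => nsq (rotate p (fun n => X n w) j)) /\
  \int[P]_w nsq (rotate p (fun n => X n w) j) = l j.
Proof.
have ip b : rintegrable P (fun w => coordinate (j, b) w ^+ 2).
  exact: (centered_gaussian_rintegrable_pow _ (coordinate_centered (j, b))).
have E w : nsq (rotate p (fun n => X n w) j) = \sum_b coordinate (j, b) w ^+ 2 by rewrite -sum_part_sq.
split.
  apply: rintegrable_eq (fun w => esym (E w)) _.
  by apply: rintegrable_sum => [|b]; [exact: rintegrable_cst|exact: ip].
under eq_Rintegral do rewrite E.
rewrite rintegral_sum//.
under eq_bigr do rewrite (centered_gaussian_square (coordinate_centered (j, _))).
by rewrite big_bool /=; field.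
Qed.

Lemma measurable_coordinate jb : measurable_fun [set: T] (coordinate jb).
Proof. by have [] := coordinate_centered jb. Qed.

End gaussian_vector.

Section rotated_coordinates.
Variables (R : realType) (N : nat).
Local Notation C := R[i].
Variables (p : 'I_N -> 'I_N -> C).

Definition rotated_coord (jb : 'I_N * bool) (y : N.-tuple C) : R :=
  part jb.2 (rotate p (tnth y) jb.1).

Lemma measurable_complex_of_parts d (T : measurableType d) (f : T -> C) :
  (forall b, measurable_fun [set: T] (fun x => part b (f x))) -> measurable_fun [set: T] f.
Proof. by move=> h; apply/measurable_fun_complexP; split; [exact: (h false)|exact: (h true)]. Qed.

Lemma measurable_rotated_coord jb : measurable_fun [set: N.-tuple C] (rotated_coord jb).
Proof.
suff mr : measurable_fun [set: N.-tuple C] (fun y => rotate p (tnth y) jb.1).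
  exact: (measurableT_comp (@measurable_part R jb.2) mr).
apply: measurable_fun_complex_sum => n; apply: measurable_fun_complexM; first exact: measurable_cst.
exact: measurable_tnth.
Qed.

Hypothesis pp' : forall m n, \sum_j conjc (p j m) * p j n = (m == n)%:R.

Lemma rotated_coord_gen d (T : measurableType d) (phi : T -> N.-tuple C) :
  (forall jb, measurable_fun [set: T] (fun x => rotated_coord jb (phi x))) ->
  measurable_fun [set: T] phi.
Proof.
move=> h; apply/measurable_fun_tnthP => n.
have -> : (fun x : N.-tuple C => tnth x n) \o phi = fun x => \sum_j conjc (p j n) * rotate p (tnth (phi x)) j.
  by apply/funext => x /=; rewrite rotateK.
apply: measurable_fun_complex_sum => j; apply: measurable_fun_complexM; first exact: measurable_cst.
by apply: measurable_complex_of_parts => b; exact: (h (j, b)).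
Qed.

End rotated_coordinates.

Section gaussian_density.
Context d (T : measurableType d) (R : realType) (P : probability T R) (N : nat).
Local Notation C := R[i].
Variables (X : 'I_N -> T -> C) (S : 'I_N -> 'I_N -> C).
Hypothesis GX : proper_gaussian P X S.
Variables (p : 'I_N -> 'I_N -> C) (l : 'I_N -> R) (rho : R).
Hypothesis rho0 : 0 <= rho.
Hypothesis pp : forall j k, \sum_n p j n * conjc (p k n) = (j == k)%:R.
Hypothesis pp' : forall m n, \sum_j conjc (p j m) * p j n = (m == n)%:R.

Definition tuple_rv d' (T' : measurableType d') (X : 'I_N -> T' -> C) (w : T') : N.-tuple C :=
  [tuple X n w | n < N].

Lemma measurable_tuple_rv d' (T' : measurableType d') (Y : 'I_N -> T' -> C) :
  (forall n, measurable_fun [set: T'] (Y n)) -> measurable_fun [set: T'] (tuple_rv Y).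
Proof.
move=> mY; apply/measurable_fun_tnthP => n.
by have -> : (fun x : N.-tuple C => tnth x n) \o tuple_rv Y = Y n by apply/funext => w /=; rewrite tnth_mktuple.
Qed.

Lemma tnth_tuple_rv d' (T' : measurableType d') (Y : 'I_N -> T' -> C) w : tnth (tuple_rv Y w) = Y^~ w.
Proof. by apply/funext => n; rewrite tnth_mktuple. Qed.

(** The likelihood ratio exp (|y|^2 - |y - sqrt rho x|^2) of the noise shifted by sqrt rho x against
    the noise. *)
Definition tilt (x y : 'I_N -> C) : R :=
  expR (2 * Num.sqrt rho * (\sum_n rdot (y n) (x n)) - rho * \sum_n nsq (x n)).

Definition spectral_gain (u : 'I_N -> R) (y : N.-tuple C) : R :=
  \prod_jb gain (u jb.1) (rotated_coord p jb y).

Lemma tilt_expectation y :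
  (forall m n, S m n = \sum_j conjc (p j m) * (l j)%:C%C * p j n) ->
  (\int[P]_w (tilt (X^~ w) (tnth y))%:E = (spectral_gain (fun j => (rho * l j)%R) y)%:E)%E.
Proof.
move=> pS.
have l0 := eigenvalue_ge0 GX pp pS.
pose h jb x := expR (2 * Num.sqrt rho * rotated_coord p jb y * x - rho * x ^+ 2).
have mh jb : measurable_fun [set: R] (h jb) by rewrite /h; mfun.
have h0 jb x : 0 <= h jb x by exact: expR_ge0.
have hE jb := centered_gaussian_tilt (rotated_coord p jb y) (l0 jb.1) rho0 (coordinate_centered GX pp pS jb).
have ih jb : rintegrable P (fun w => h jb (coordinate X p jb w)).
  apply/integrableP; split.
    by apply/measurable_EFinP/(measurableT_comp (mh jb)); exact: (measurable_coordinate GX pp pS).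
  by under eq_integral do rewrite /= ger0_norm//; rewrite hE ltry.
transitivity (\int[P]_w (\prod_jb h jb (coordinate X p jb w))%:E)%E.
  apply: eq_integral => w _; congr EFin; rewrite /tilt /h -expR_sum; congr expR.
  rewrite sumrB -!mulr_sumr -(sum_nsq_rotate pp') -(sum_rdot_rotate pp'); congr (_ - _).
    under [RHS]eq_bigr do rewrite -mulrA.
    rewrite -mulr_sumr sum_pairE /=; congr (_ * _); apply: eq_bigr => j _.
    by rewrite -sum_part_mul.
  rewrite sum_pairE /=; congr (_ * _); apply: eq_bigr => j _.
  by rewrite -sum_part_sq.
rewrite (prod_expectation_ge0 (measurable_coordinate GX pp pS) (coordinate_independence GX pp pS))//.
congr EFin; apply: eq_bigr => jb _.
by rewrite /Rintegral hE.
Qed.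

Lemma measurable_spectral_gain u : measurable_fun [set: N.-tuple C] (spectral_gain u).
Proof.
rewrite /spectral_gain.
elim: (index_enum _) => [|i r IH].
  by under eq_fun do rewrite big_nil; exact: measurable_cst.
under eq_fun do rewrite big_cons; apply: measurable_funM => //.
exact: (measurableT_comp (measurable_gain _) (measurable_rotated_coord p i)).
Qed.

Lemma spectral_gain_gt0 u y : (forall j, 0 <= u j) -> 0 < spectral_gain u y.
Proof. by move=> u0; apply: prodr_gt0 => jb _; exact: gain_gt0. Qed.

Definition white (m n : 'I_N) : C := (m == n)%:R.

Lemma white_diagonal m n : white m n = \sum_j conjc (p j m) * (1 : R)%:C%C * p j n.
Proof. by rewrite /white -pp'; apply: eq_bigr => j _; rewrite mulr1. Qed.

Lemma sum_gain_diagonal :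
  (forall m n, S m n = \sum_j conjc (p j m) * (l j)%:C%C * p j n) -> forall m n,
  white m n + rho%:C%C * S m n = \sum_j conjc (p j m) * (1 + rho * l j)%:C%C * p j n.
Proof.
move=> pS m n; rewrite pS white_diagonal mulr_sumr -big_split /=; apply: eq_bigr => j _.
by rewrite rmorphD rmorphM /=; ring.
Qed.

End gaussian_density.

Section gaussian_change_of_measure.
Context (R : realType) (N : nat).
Local Notation C := R[i].
Context d (T : measurableType d) (P : probability T R) (V : 'I_N -> T -> C).
Context d' (T' : measurableType d') (P' : probability T' R) (Y : 'I_N -> T' -> C).
Variables (p : 'I_N -> 'I_N -> C) (u : 'I_N -> R) (Q : 'I_N -> 'I_N -> C).
Hypothesis u0 : forall j, 0 <= u j.
Hypothesis pp : forall j k, \sum_n p j n * conjc (p k n) = (j == k)%:R.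
Hypothesis pp' : forall m n, \sum_j conjc (p j m) * p j n = (m == n)%:R.
Hypothesis GV : proper_gaussian P V (@white R N).
Hypothesis GY : proper_gaussian P' Y Q.
Hypothesis pQ : forall m n, Q m n = \sum_j conjc (p j m) * (1 + u j)%:C%C * p j n.

Let cV jb : centered_gaussian P (coordinate V p jb) 2^-1.
Proof. by have := coordinate_centered GV pp (white_diagonal pp') jb; rewrite mul1r. Qed.
Let cY jb := coordinate_centered GY pp pQ jb.

Let gE w : spectral_gain p u (tuple_rv V w) = \prod_jb gain (u jb.1) (coordinate V p jb w).
Proof. by apply: eq_bigr => jb _; rewrite /rotated_coord tnth_tuple_rv. Qed.

Let igV jb : rintegrable P (fun w => gain (u jb.1) (coordinate V p jb w)).
Proof. exact: (centered_gaussian_gain1 (u0 _) (cV jb)).1. Qed.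

Let mV jb := measurable_coordinate GV pp (white_diagonal pp') jb.
Let iV := coordinate_independence GV pp (white_diagonal pp').
Let g0 (jb : 'I_N * bool) (x : R) : 0 <= gain (u jb.1) x. Proof. exact/ltW/gain_gt0. Qed.

Lemma rintegrable_spectral_gain : rintegrable P (fun w => spectral_gain p u (tuple_rv V w)).
Proof.
apply: rintegrable_eq (fun w => esym (gE w)) _.
by apply: (rintegrable_prod_ge0 mV iV (h := fun jb => gain (u jb.1))) => // jb; exact: measurable_gain.
Qed.

(** On rectangles in the rotated coordinates the identity is the product of its one-dimensional
    versions, by independence on both sides. Rectangles determine bounded functions, and truncation
    gives nonnegative ones. *)
Lemma gaussian_change_of_measure (f : N.-tuple C -> R) :
  measurable_fun [set: N.-tuple C] f -> (forall y, 0 <= f y) ->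
  (\int[P]_w (spectral_gain p u (tuple_rv V w) * f (tuple_rv V w))%:E =
   \int[P']_w (f (tuple_rv Y w))%:E)%E.
Proof.
move=> mf f0.
have mVT := measurable_tuple_rv (fun m => proper_gaussian_measurable m GV).
have mYT := measurable_tuple_rv (fun m => proper_gaussian_measurable m GY).
transitivity (\int[P']_w (1 * f (tuple_rv Y w))%:E)%E; last by under eq_integral do rewrite mul1r.
apply: (eq_ge0_integral rintegrable_spectral_gain (rintegrable_cst P' 1) mVT mYT) => //.
  by move=> w; rewrite ltW// spectral_gain_gt0.
move=> {f mf f0} f bf; apply/eqP; rewrite -subr_eq0 -[X in _ - X]mul1r; apply/eqP.
have bc := bounded_continuous_diff rintegrable_spectral_gain (rintegrable_cst P' 1) mVT mYT.
apply: (bcont_generated (measurable_rotated_coord p) (rotated_coord_gen pp') bc) bf => B mB.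
rewrite mul1r.
under [X in _ - X]eq_Rintegral do rewrite mul1r; rewrite /=.
under [X in _ - X]eq_Rintegral => w _.
  rewrite (eq_bigr (fun j => \1_(B j) (coordinate Y p j w))); last by move=> jb _; rewrite /rotated_coord tnth_tuple_rv.
  over.
rewrite /= (coordinate_independence GY pp pQ (g := fun j => \1_(B j))); last by move=> jb; exact: bounded_measurable_indic.
apply/eqP; rewrite subr_eq0; apply/eqP.
have mgB jb : measurable_fun [set: R] (fun x => gain (u jb.1) x * \1_(B jb) x).
  by apply: measurable_funM; [exact: measurable_gain|exact: measurable_indic].
have E jb := centered_gaussian_gain (u0 jb.1) (cV jb) (cY jb) (measurable_indic (mB jb) : measurable_fun [set: R] (\1_(B jb) : R -> R)) (fun x => _).
transitivity (fine (\int[P]_w (\prod_jb (gain (u jb.1) (coordinate V p jb w) * \1_(B jb) (coordinate V p jb w)))%:E)).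
  congr fine; apply: eq_integral => w _; congr EFin; rewrite gE -big_split /=.
  by apply: eq_bigr => jb _; rewrite /rotated_coord tnth_tuple_rv.
rewrite (prod_expectation_ge0 mV iV mgB).
- apply: eq_bigr => jb _; rewrite /Rintegral E//.
- by move=> jb x; rewrite mulr_ge0.
- move=> jb; apply: rintegrable_le (igV jb) _.
    exact: (measurableT_comp (mgB jb)).
  move=> w; rewrite normrM (ger0_norm (g0 _ _)) ler_piMr// indicE.
  by case: (_ \in _); rewrite ?normr1 ?normr0.
Qed.

Lemma spectral_gain_integral : (\int[P]_w (spectral_gain p u (tuple_rv V w))%:E = 1)%E.
Proof.
have := @gaussian_change_of_measure (fun=> 1) (measurable_cst (1 : R)) (fun=> ler01).
by under eq_integral do rewrite mulr1; rewrite integral_prob_cst.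
Qed.

Lemma ln_spectral_gain y : ln (spectral_gain p u y) =
  \sum_j (u j / (1 + u j) * nsq (rotate p (tnth y) j) - ln (1 + u j)).
Proof.
have lng (U x : R) : 0 <= U -> ln (gain U x) = x ^+ 2 * (U / (1 + U)) - ln (1 + U) / 2.
  move=> U0; rewrite /gain lnM ?posrE ?expR_gt0 ?invr_gt0 ?sqrtr_gt0//; last by lra.
  rewrite expRK lnV ?posrE ?sqrtr_gt0//; last by lra.
  have u1 : 0 < 1 + U by lra.
  have : ln (1 + U) = ln (Num.sqrt (1 + U)) + ln (Num.sqrt (1 + U)).
    by rewrite -lnM ?posrE ?sqrtr_gt0// -expr2 sqr_sqrtr// ltW.
  by move=> ->; field; exact: lt0r_neq0.
have lnp (r : seq ('I_N * bool)) : ln (\prod_(jb <- r) gain (u jb.1) (rotated_coord p jb y)) =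
    \sum_(jb <- r) ln (gain (u jb.1) (rotated_coord p jb y)).
  elim: r => [|i r IH]; first by rewrite !big_nil ln1.
  by rewrite !big_cons lnM ?IH ?posrE ?gain_gt0// prodr_gt0// => jb _; exact: gain_gt0.
rewrite /spectral_gain lnp sum_pairE; apply: eq_bigr => j _.
under eq_bigr do rewrite lng//.
rewrite -(sum_part_sq (rotate p (tnth y) j)) !big_bool /rotated_coord /=.
by have u1 : 1 + u j != 0 by [have := u0 j; lra]; field.
Qed.

End gaussian_change_of_measure.

(** * The density of the channel output *)

Section channel_density.
Context d (T : measurableType d) (R : realType) (P : probability T R) (K N : nat).
Local Notation C := R[i].
Local Notation cRe := complex.Re.
Variables (H : 'I_K -> int -> {RV P >-> C}) (W : int -> {RV P >-> C}).
Hypothesis HW : rayleigh_channel H W.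
Implicit Types (s : int) (z : N.-tuple C) (y : N.-tuple C) (rho : R).

Definition noise : T -> N.-tuple C := tuple_rv (fun m : 'I_N => W m.+1%:Z : T -> C).

Definition channel_output s rho z (m : 'I_N) (w : T) : C :=
  (Num.sqrt rho)%:C%C * fade H s z m w + W (s + m.+1%:Z) w.

Definition channel_out s rho z : T -> N.-tuple C := tuple_rv (channel_output s rho z).

(** Defined as an average over the fading, which gives joint measurability in z and y by Tonelli,
    whereas an eigenbasis is chosen separately for each z. [density_spectral] links it to the
    product form. *)
Definition density rho z y : R := \int[P]_w tilt rho ((fade H 0 z)^~ w) (tnth y).

Lemma channel_stationary k : stationary (H k).
Proof. by have [/(_ k)[]] := HW. Qed.

Lemma white_form (e : 'I_N -> C) :
  cRe (\sum_m \sum_n conjc (e m) * e n * white R m n) = \sum_m nsq (e m).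
Proof.
rewrite cRe_sum; apply: eq_bigr => m _; rewrite (bigD1 m)//= big1 => [|n nm].
  by rewrite /white eqxx mulr1 addr0 -nsqC.
by rewrite /white eq_sym (negbTE nm) mulr0.
Qed.

Lemma noise_proper s : proper_gaussian P (fun m : 'I_N => W (s + m.+1%:Z)) (@white R N).
Proof.
move=> e; have := noise_functional HW s e; congr centered_gaussian.
by rewrite white_form mulr_suml.
Qed.

Lemma fade_proper s z : proper_gaussian P (fade H s z) (fade_cov H z).
Proof.
move=> e; have := channel_functional HW s z e (fun=> 0); congr centered_gaussian.
- by apply/funext => w; rewrite [X in _ + X]big1 ?addr0// => m _; rewrite rdot0l.
- by rewrite [X in _ + X]big1 ?addr0// => m _; rewrite /nsq /= expr0n /= addr0 mul0r.
Qed.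

Lemma output_proper s rho z : 0 <= rho ->
  proper_gaussian P (channel_output s rho z) (fun m n => white R m n + rho%:C%C * fade_cov H z m n).
Proof.
move=> r0 e; have := channel_functional HW s z (fun m => (Num.sqrt rho)%:C%C * e m) e; congr centered_gaussian.
- apply/funext => w; rewrite -big_split /=; apply: eq_bigr => m _.
  by rewrite rdotZl /channel_output rdotDr rdotZr.
- rewrite -mulr_suml -mulrDl; congr (_ / _).
  rewrite -white_form -cReD -big_split /=; congr cRe; apply: eq_bigr => m _.
  rewrite -big_split /=; apply: eq_bigr => n _.
  have sr : (Num.sqrt rho)%:C%C * (Num.sqrt rho)%:C%C = rho%:C%C by rewrite -rmorphM -expr2 sqr_sqrtr.
  have -> : conjc ((Num.sqrt rho)%:C%C * e m) = (Num.sqrt rho)%:C%C * conjc (e m).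
    by case: (e m) => a b; apply/eqP; rewrite eq_complex /=; apply/andP; split; apply/eqP; ring.
  rewrite -sr; ring.
Qed.

Lemma density_spectral rho z : 0 <= rho -> exists (p : 'I_N -> 'I_N -> C) (l : 'I_N -> R),
  [/\ [/\ (forall j k, \sum_n p j n * conjc (p k n) = (j == k)%:R),
       (forall m n, \sum_j conjc (p j m) * p j n = (m == n)%:R) &
       (forall m n, fade_cov H z m n = \sum_j conjc (p j m) * (l j)%:C%C * p j n)],
   (forall j, 0 <= l j), 
   (forall y, (\int[P]_w (tilt rho ((fade H 0 z)^~ w) (tnth y))%:E)%E = (density rho z y)%:E) &
   forall y, density rho z y = spectral_gain p (fun j => rho * l j) y].
Proof.
move=> r0; have [p [l [pp pp' pS]]] := hermitian_spectral (fun m n => fade_cov_conj z m n channel_stationary).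
exists p, l.
have E y := tilt_expectation (fade_proper 0 z) r0 pp pp' y pS.
split => //.
- exact: (eigenvalue_ge0 (fade_proper 0 z) pp pS).
- by move=> y; rewrite /density /Rintegral E.
- by move=> y; rewrite /density /Rintegral E.
Qed.

Lemma density_gt0 rho z y : 0 <= rho -> 0 < density rho z y.
Proof.
move=> r0; have [p [l [_ l0 _ ->]]] := density_spectral z r0.
by apply: spectral_gain_gt0 => j; rewrite mulr_ge0.
Qed.

(** The right-hand side is free of [s]: the law of the output does not depend on where the block is
    placed in time. *)
Lemma density_change s rho z (f : N.-tuple C -> R) : 0 <= rho ->
  measurable_fun [set: N.-tuple C] f -> (forall y, 0 <= f y) ->
  (\int[P]_w (f (channel_out s rho z w))%:E =
   \int[P]_w (density rho z (noise w) * f (noise w))%:E)%E.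
Proof.
move=> r0 mf f0; have [p [l [[pp pp' pS] l0 _ dE]]] := density_spectral z r0.
have u0 j : 0 <= rho * l j by rewrite mulr_ge0.
have := gaussian_change_of_measure u0 pp pp' (noise_proper 0) (output_proper s z r0) (sum_gain_diagonal rho pp' pS) mf f0.
move=> <-; apply: eq_integral => w _; congr (_ * _)%:E.
  by rewrite dE.
Qed.

Lemma rotate_white (y : 'I_N -> C) j : rotate (@white R N) y j = y j.
Proof.
rewrite /rotate (bigD1 j)//= big1 => [|n nj]; first by rewrite /white eqxx mul1r addr0.
by rewrite /white eq_sym (negbTE nj) mul0r.
Qed.

Lemma white_conj (m n : 'I_N) : conjc (white R m n : C) = @white R N n m.
Proof. by rewrite /white eq_sym; case: (_ == _); rewrite ?conjc0 ?conjc1. Qed.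

Lemma white_unitary (m n : 'I_N) : \sum_j white R m j * conjc (white R n j) = ((m == n)%:R : C).
Proof. by under eq_bigr do rewrite white_conj; exact: (rotate_white (fun j => white R j n) m). Qed.

Lemma white_unitary' (m n : 'I_N) : \sum_j conjc (white R j m) * white R j n = ((m == n)%:R : C).
Proof. by under eq_bigr do rewrite white_conj; exact: (rotate_white (fun j => white R j n) m). Qed.

(** Density, with respect to the noise, of the product normal law of variance 1 + x per symbol. The
    matrix [white] is the identity, used here as a trivial rotation. *)
Definition reference x : N.-tuple C -> R := spectral_gain (@white R N) (fun=> x).

Lemma reference_integral x : 0 <= x -> (\int[P]_w (reference x (noise w))%:E = 1)%E.
Proof.
move=> x0.
have GY : proper_gaussian P (fun (m : 'I_N) w => (Num.sqrt (1 + x))%:C%C * W (0 + m.+1%:Z) w)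
    (fun m n => (1 + x)%:C%C * white R m n).
  move=> e; have := noise_proper 0 (fun m => (Num.sqrt (1 + x))%:C%C * e m); congr centered_gaussian.
    by apply/funext => w; apply: eq_bigr => m _; rewrite rdotZl rdotZr.
  congr (cRe _ / _); apply: eq_bigr => m _; apply: eq_bigr => n _.
  have sr : (Num.sqrt (1 + x))%:C%C * (Num.sqrt (1 + x))%:C%C = (1 + x)%:C%C.
    by rewrite -rmorphM -expr2 sqr_sqrtr//; lra.
  have -> : conjc ((Num.sqrt (1 + x))%:C%C * e m) = (Num.sqrt (1 + x))%:C%C * conjc (e m).
    by case: (e m) => a b; apply/eqP; rewrite eq_complex /=; apply/andP; split; apply/eqP; ring.
  rewrite -sr; ring.
apply: (spectral_gain_integral (fun=> x0) white_unitary white_unitary' (noise_proper 0) GY) => m n.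
rewrite -[white R m n in LHS]white_unitary' mulr_sumr; apply: eq_bigr => j _; ring.
Qed.

Lemma reference_gt0 x y : 0 <= x -> 0 < reference x y.
Proof. by move=> x0; apply: spectral_gain_gt0. Qed.

Lemma ln_reference x y : 0 <= x ->
  ln (reference x y) = \sum_n (x / (1 + x) * nsq (tnth y n) - ln (1 + x)).
Proof.
by move=> x0; rewrite ln_spectral_gain//; apply: eq_bigr => j _; rewrite rotate_white.
Qed.

Definition trace_cov z := \sum_n cRe (fade_cov H z n n).

(** The lower bound comes from ln (1 + u) <= u, the upper one from bounding each eigenvalue by the
    trace. The factor rho in the upper bound keeps exponential moments of the output under control
    as rho tends to 0. *)
Lemma ln_density_bounds rho z y : 0 <= rho ->
  - (rho * trace_cov z) <= ln (density rho z y) <= rho * trace_cov z * \sum_n nsq (tnth y n).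
Proof.
move=> r0; have [p [l [[pp pp' pS] l0 _ ->]]] := density_spectral z r0.
have u0 j : 0 <= rho * l j by rewrite mulr_ge0.
rewrite ln_spectral_gain// /trace_cov (diagonalized_trace pp pS) mulr_sumr; apply/andP; split.
- rewrite -sumrN; apply: ler_sum => j _.
  rewrite -[X in X <= _]add0r lerB//.
    by rewrite mulr_ge0 ?nsq_ge0// divr_ge0// addr_ge0.
  by apply: le_ln1Dx; exact: lt_le_trans (ltrN10 R) _.
- rewrite -(sum_nsq_rotate pp') mulr_sumr; apply: ler_sum => j _.
  have ut : rho * l j <= \sum_i rho * l i by rewrite (bigD1 j)//= lerDl sumr_ge0.
  have := u0 j; move: ut; set u := rho * l j => ut uj.
  rewrite lerBlDr; apply: (@le_trans _ _ ((\sum_i rho * l i) * nsq (rotate p (tnth y) j))).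
    rewrite ler_wpM2r ?nsq_ge0// (le_trans _ ut)// ler_pdivrMr; last by lra.
    by rewrite ler_peMr//; lra.
  by rewrite lerDl ln_ge0//; lra.
Qed.

Lemma ln_density_le rho z y : 0 <= rho -> ln (density rho z y) <= \sum_n nsq (tnth y n).
Proof.
move=> r0; have [p [l [[pp pp' pS] l0 _ ->]]] := density_spectral z r0.
have u0 j : 0 <= rho * l j by rewrite mulr_ge0.
rewrite ln_spectral_gain// -(sum_nsq_rotate pp'); apply: ler_sum => j _.
have := u0 j; set u := rho * l j => uj.
rewrite lerBlDr; apply: (@le_trans _ _ (nsq (rotate p (tnth y) j))).
  by rewrite ler_piMl ?nsq_ge0// ler_pdivrMr; lra.
by rewrite lerDl ln_ge0//; lra.
Qed.

Lemma output_nsq s rho z m : 0 <= rho ->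
  rintegrable P (fun w => nsq (tnth (channel_out s rho z w) m)) /\
  \int[P]_w nsq (tnth (channel_out s rho z w) m) = 1 + rho * cRe (fade_cov H z m m).
Proof.
move=> r0; have [h1 h2] := proper_gaussian_nsq m (output_proper s z r0).
split; first by apply: rintegrable_eq h1 => w; rewrite /channel_out tnth_mktuple.
transitivity (cRe (white R m m + rho%:C%C * fade_cov H z m m)).
  by rewrite -h2; apply: eq_Rintegral => w _; rewrite /channel_out tnth_mktuple.
by rewrite /white eqxx; case: (fade_cov _ _ _ _) => a b /=; ring.
Qed.

(** The eigencoordinate j of the output has mean square 1 + u with u = rho l_j, so the mean of the
    logarithm is the sum of the terms u - ln (1 + u) <= u^2 / 2, and the squares of the l_j add up
    to the squared norm of S(z). *)
Lemma ln_density_integral s rho z : 0 <= rho ->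
  rintegrable P (fun w => ln (density rho z (channel_out s rho z w))) /\
  \int[P]_w ln (density rho z (channel_out s rho z w)) <=
    rho ^+ 2 / 2 * \sum_m \sum_n nsq (fade_cov H z m n).
Proof.
move=> r0; have [p [l [[pp pp' pS] l0 _ dE]]] := density_spectral z r0.
have u0 j : 0 <= rho * l j by rewrite mulr_ge0.
have pQ := sum_gain_diagonal rho pp' pS.
have cn j := coordinate_nsq (output_proper s z r0) pp pQ j.
have E w : ln (density rho z (channel_out s rho z w)) = \sum_j (rho * l j / (1 + rho * l j) *
    nsq (rotate p (fun n => channel_output s rho z n w) j) + - ln (1 + rho * l j)).
  by rewrite dE ln_spectral_gain//; apply: eq_bigr => j _; rewrite tnth_tuple_rv.
have ic j : rintegrable P (fun w => rho * l j / (1 + rho * l j) *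
    nsq (rotate p (fun n => channel_output s rho z n w) j) + - ln (1 + rho * l j)).
  by apply: rintegrableD; [apply: rintegrableZ; exact: (cn j).1|exact: rintegrable_cst].
split.
  apply: rintegrable_eq (fun w => esym (E w)) _.
  by apply: rintegrable_sum => //; exact: rintegrable_cst.
under eq_Rintegral do rewrite E.
rewrite rintegral_sum// (diagonalized_nsq pp pp' pS) mulr_sumr; apply: ler_sum => j _.
rewrite RintegralD//; [|by apply: rintegrableZ; exact: (cn j).1|exact: rintegrable_cst].
rewrite RintegralZl//; last exact: (cn j).1.
rewrite (cn j).2 Rintegral_prob_cst.
have := u0 j; have -> : rho ^+ 2 / 2 * l j ^+ 2 = (rho * l j) ^+ 2 / 2 by ring.
set u := rho * l j => uj.
have -> : u / (1 + u) * (1 + u) = u by field; lra.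
by have := ln1D_ge_quadratic uj; lra.
Qed.

End channel_density.

Section complex_measurability.
Context d (T : measurableType d) (R : realType).
Local Notation C := R[i].
Implicit Types f g : T -> C.

Lemma measurable_fun_nsq f : measurable_fun [set: T] f -> measurable_fun [set: T] (fun x => nsq (f x)).
Proof.
move=> /measurable_fun_complexP[mR mI].
by apply: measurable_funD; apply: measurable_funX.
Qed.

Lemma measurable_fun_rdot f g : measurable_fun [set: T] f -> measurable_fun [set: T] g ->
  measurable_fun [set: T] (fun x => rdot (f x) (g x)).
Proof.
move=> /measurable_fun_complexP[fR fI] /measurable_fun_complexP[gR gI].
by apply: measurable_funD; apply: measurable_funM.
Qed.

Lemma measurable_fun_input_at N (f : T -> N.-tuple C) m : measurable_fun [set: T] f ->
  measurable_fun [set: T] (fun x => input_at (f x) m).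
Proof.
move=> mf; case: m => [[|j]|j] /=; [exact: measurable_cst| |exact: measurable_cst].
have [jN|Nj] := ltnP j N.
- apply: eq_measurable_fun (measurableT_comp (measurable_tnth (Ordinal jN)) mf) => z _ /=.
  by rewrite (tnth_nth 0).
- apply: eq_measurable_fun (measurable_cst (0 : C)) => z _ /=.
  by rewrite nth_default ?size_tuple.
Qed.

End complex_measurability.

Section clamp.
Variables (R : realType) (N : nat).
Local Notation C := R[i].
Implicit Types z : N.-tuple C.

(* Clamping makes the bounds on the density hold for all inputs; admissible inputs are
   almost surely unchanged. *)
Definition unit_disk_part (x : C) : C := if nsq x <= 1 then x else 0.

Definition clamp z : N.-tuple C := [tuple unit_disk_part (tnth z i) | i < N].

Lemma measurable_clamp : measurable_fun [set: N.-tuple C] clamp.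
Proof.
apply/measurable_fun_tnthP => i.
have -> : (fun x : N.-tuple C => tnth x i) \o clamp = fun z => unit_disk_part (tnth z i).
  by apply/funext => z /=; rewrite tnth_mktuple.
apply: measurable_fun_ifT; [|exact: measurable_tnth|exact: measurable_cst].
by apply: measurable_fun_ler => //; apply: measurable_fun_nsq; exact: measurable_tnth.
Qed.

Lemma clamp_id z : (forall i, nsq (tnth z i) <= 1) -> clamp z = z.
Proof. by move=> h; apply: eq_from_tnth => i; rewrite tnth_mktuple /unit_disk_part h. Qed.

Lemma clamp_le1 z i : nsq (tnth (clamp z) i) <= 1.
Proof.
rewrite tnth_mktuple /unit_disk_part; case: ifP => // _.
by rewrite /nsq /= expr0n /= addr0.
Qed.

Lemma input_at_le1 z m : (forall i, nsq (tnth z i) <= 1) -> nsq (input_at z m) <= 1.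
Proof.
have n0 : nsq (0 : C) <= 1 by rewrite /nsq /= expr0n /= addr0.
move=> h; case: m => [[|j]|j] //=.
have [jN|Nj] := ltnP j N; last by rewrite nth_default ?size_tuple.
by have := h (Ordinal jN); rewrite (tnth_nth 0).
Qed.

End clamp.

Section block_channel.
Context d (T : measurableType d) (R : realType) (P : probability T R) (K N : nat).
Local Notation C := R[i].
Local Notation cRe := complex.Re.
Variables (H : 'I_K -> int -> {RV P >-> C}) (W : int -> {RV P >-> C}).
Hypothesis HW : rayleigh_channel H W.
Implicit Types (s : int) (z : N.-tuple C) (y : N.-tuple C) (rho : R).

Definition power (k : 'I_K) : R := cRe (autocorrelation (H k) 0).

Definition total_power : R := \sum_k power k.

Lemma power_ge0 k : 0 <= power k.
Proof.
rewrite /power /autocorrelation /cexpectation /cintegral /=.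
apply: Rintegral_ge0 => w _.
rewrite (_ : cRe _ = nsq (H k 0 w)) ?nsq_ge0//.
by case: (H k 0 w) => a b; rewrite /nsq /=; ring.
Qed.

Lemma total_power_ge0 : 0 <= total_power.
Proof. by apply: sumr_ge0 => k _; exact: power_ge0. Qed.

Lemma fade_cov_diag z m : cRe (fade_cov H z m m) = \sum_k power k * nsq (input_at z (m.+1%:Z - k%:Z)).
Proof.
rewrite /fade_cov cRe_sum; apply: eq_bigr => k _.
rewrite subrr /power; case: (input_at _ _) (autocorrelation _ _) => a b [c e].
by rewrite /nsq /=; ring.
Qed.

Lemma fade_cov_diag_le z m : (forall i, nsq (tnth z i) <= 1) -> cRe (fade_cov H z m m) <= total_power.
Proof.
move=> h; rewrite fade_cov_diag; apply: ler_sum => k _.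
by rewrite ler_piMr ?power_ge0// input_at_le1.
Qed.

Lemma trace_cov_le z : (forall i, nsq (tnth z i) <= 1) -> trace_cov H z <= N%:R * total_power.
Proof.
move=> h; rewrite /trace_cov; apply: (@le_trans _ _ (\sum_(i < N) total_power)).
  by apply: ler_sum => m _; exact: fade_cov_diag_le.
by rewrite sumr_const card_ord mulr_natl.
Qed.

Section measurability.
Context d' (S : measurableType d') (z : S -> N.-tuple C) (w : S -> T).
Hypotheses (mz : measurable_fun [set: S] z) (mw : measurable_fun [set: S] w).

Lemma measurable_fade s m : measurable_fun [set: S] (fun x => fade H s (z x) m (w x)).
Proof.
apply: measurable_fun_complex_sum => k; apply: measurable_fun_complexM.
  by apply: measurableT_comp => //; exact: measurable_funP.
exact: measurable_fun_input_at.
Qed.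

Lemma measurable_channel_out s rho : measurable_fun [set: S] (fun x => channel_out H W s rho (z x) (w x)).
Proof.
apply/measurable_fun_tnthP => m.
have -> : (fun x : N.-tuple C => tnth x m) \o (fun x => channel_out H W s rho (z x) (w x)) =
    fun x => channel_output H W s rho (z x) m (w x).
  by apply/funext => x /=; rewrite tnth_mktuple.
apply: measurable_fun_complexD.
  by apply: measurable_fun_complexM; [exact: measurable_cst|exact: measurable_fade].
by apply: measurableT_comp => //; exact: measurable_funP.
Qed.

Lemma measurable_tilt rho (y : S -> N.-tuple C) : measurable_fun [set: S] y ->
  measurable_fun [set: S] (fun x => tilt rho (fun m => fade H 0 (z x) m (w x)) (tnth (y x))).
Proof.
move=> my; apply: (measurableT_comp (@measurable_expR R)).
have myn n : measurable_fun [set: S] (fun x => tnth (y x) n) by exact: measurableT_comp (measurable_tnth n) my.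
apply: measurable_funB; apply: measurable_funM => //; apply: measurable_fun_sum_cond => n.
- by apply: measurable_fun_rdot => //; exact: measurable_fade.
- by apply: measurable_fun_nsq; exact: measurable_fade.
Qed.

End measurability.

Lemma measurable_density d' (S : measurableType d') (z : S -> N.-tuple C) (y : S -> N.-tuple C) rho :
  measurable_fun [set: S] z -> measurable_fun [set: S] y ->
  measurable_fun [set: S] (fun x => density H rho (z x) (y x)).
Proof.
move=> mz my.
have m := @measurable_tilt _ (S * T)%type (fun u => z u.1) (fun u => u.2)
  (measurableT_comp mz measurable_fst) measurable_snd rho (fun u => y u.1) (measurableT_comp my measurable_fst).
apply: (measurableT_comp (fine_measurable measurableT)).
apply: (@measurable_fun_fubini_tonelli_F _ _ _ _ _ P (fun u => (tilt rho (fun m => fade H 0 (z u.1) m u.2) (tnth (y u.1)))%:E)).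
  exact/measurable_EFinP.
by move=> u; rewrite lee_fin expR_ge0.
Qed.

Lemma measurable_noise : measurable_fun [set: T] (@noise d T R P N W).
Proof. by apply: measurable_tuple_rv => n; exact: measurable_funP. Qed.

End block_channel.

Lemma kl_divergence_density d (E : measurableType d) (R : realType) (J nu : probability E R) (r : E -> R) :
  measurable_fun [set: E] r -> (forall x, 0 < r x) ->
  (forall A, measurable A -> J A = \int[nu]_(x in A) (r x)%:E)%E ->
  kl_divergence J nu = (\int[J]_x (ln (r x))%:E)%E.
Proof.
move=> mr r0 JE.
have dom : J `<< nu.
  apply/null_content_dominatesP => A mA nuA; rewrite JE// null_set_integral//.
  exact/measurable_EFinP/measurable_funTS.
rewrite /kl_divergence asboolT//.
have domc : charge_of_finite_measure J `<< nu by [].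
have mrE : measurable_fun [set: E] (EFin \o r) by exact/measurable_EFinP.
have H : ae_eq nu [set: E] (Radon_Nikodym (charge_of_finite_measure J) nu) (EFin \o r).
  apply: integral_ae_eq => //; first exact: Radon_Nikodym_integrable.
  by move=> A _ mA; rewrite -Radon_Nikodym_integral// -JE.
have [A [mA A0 HA]] := H.
apply: ae_eq_integral => //.
- have mRN : measurable_fun [set: E] (Radon_Nikodym (charge_of_finite_measure J) nu).
    by apply: (measurable_int nu); exact: Radon_Nikodym_integrable.
  have mfRN : measurable_fun [set: E] (fun x => fine (Radon_Nikodym (charge_of_finite_measure J) nu x)).
    exact: (measurableT_comp (fine_measurable measurableT) mRN).
  (* The Radon-Nikodym derivative is identified with [r] only almost everywhere; where it is not
     positive [lne] takes the value -oo, hence the case split to obtain measurability. *)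
  have -> : (fun x => lne (Radon_Nikodym (charge_of_finite_measure J) nu x)) =
     (fun x => if 0 < fine (Radon_Nikodym (charge_of_finite_measure J) nu x)
               then (ln (fine (Radon_Nikodym (charge_of_finite_measure J) nu x)))%:E else -oo%E).
    apply/funext => x; rewrite -[in LHS](fineK (Radon_Nikodym_fin_num x domc)).
    by case: ltP => h; [rewrite lne_EFin|rewrite le0_lneNy// lee_fin].
  apply: measurable_fun_ifT => //; first exact: measurable_fun_ltr.
  by apply/measurable_EFinP/measurableT_comp.
- by apply/measurable_EFinP/measurableT_comp.
exists A; split => //; first by have /null_content_dominatesP := dom; exact.
move=> x /= Hx; apply: HA => /= Hx'; apply: Hx => _; rewrite Hx'//=.
by rewrite leNgt r0.
Qed.

(** * Information of a channel with a density *)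

Section sections.
Context d1 (T1 : measurableType d1) d2 (T2 : measurableType d2) d3 (T3 : measurableType d3) (f : T1 * T2 -> T3).
Hypothesis mf : measurable_fun [set: T1 * T2] f.

Lemma measurable_section_left y : measurable_fun [set: T1] (fun x => f (x, y)).
Proof.
have h : measurable_fun [set: T1] (fun x : T1 => (x, y)) by exact: measurable_fun_pair.
exact: measurableT_comp mf h.
Qed.

Lemma measurable_section_right x : measurable_fun [set: T2] (fun y => f (x, y)).
Proof.
have h : measurable_fun [set: T2] (fun y : T2 => (x, y)) by exact: measurable_fun_pair.
exact: measurableT_comp mf h.
Qed.

End sections.

Section tonelli.
Context d1 (T1 : measurableType d1) d2 (T2 : measurableType d2) (R : realType)
  (P1 : probability T1 R) (P2 : probability T2 R) (F : T1 * T2 -> R).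

Section nonnegative.
Hypothesis mF : measurable_fun [set: T1 * T2] F.
Hypothesis F0 : forall z, 0 <= F z.
Let F0' z : (0 <= (F z)%:E)%E. Proof. by rewrite lee_fin. Qed.

Lemma tonelli12 : (\int[(P1 \x P2)%E]_z (F z)%:E = \int[P1]_x \int[P2]_y (F (x, y))%:E)%E.
Proof. by rewrite fubini_tonelli1//; exact/measurable_EFinP. Qed.

Lemma tonelli21 : (\int[(P1 \x P2)%E]_z (F z)%:E = \int[P2]_y \int[P1]_x (F (x, y))%:E)%E.
Proof. by rewrite fubini_tonelli2//; exact/measurable_EFinP. Qed.

Lemma measurable_integral_left : measurable_fun [set: T2] (fun y => \int[P1]_x (F (x, y))%:E)%E.
Proof. by apply: (@measurable_fun_fubini_tonelli_G _ _ _ _ _ P1 (EFin \o F)) => //; exact/measurable_EFinP. Qed.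

Lemma measurable_integral_right : measurable_fun [set: T1] (fun x => \int[P2]_y (F (x, y))%:E)%E.
Proof. by apply: (@measurable_fun_fubini_tonelli_F _ _ _ _ _ P2 (EFin \o F)) => //; exact/measurable_EFinP. Qed.

Lemma measurable_Rintegral_left : measurable_fun [set: T2] (fun y => \int[P1]_x F (x, y)).
Proof. exact: (measurableT_comp (fine_measurable measurableT) measurable_integral_left). Qed.

End nonnegative.

Hypothesis iF : rintegrable (P1 \x P2)%E F.

Lemma Rintegral_fubini_le B : (forall x, rintegrable P2 (fun y => F (x, y))) ->
  (forall x, \int[P2]_y F (x, y) <= B) -> \int[(P1 \x P2)%E]_z F z <= B.
Proof.
move=> iF2 H; rewrite -lee_fin -rintegralE// -(integral12_prod_meas1 iF).
rewrite -[leRHS](integral_prob_cst P1).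
have i1 : P1.-integrable setT (fubini_F P2 (EFin \o F)) := integrable_fubini_F iF.
apply: le_integral => //; first exact: (rintegrable_cst P1 B).
by move=> x _; rewrite /fubini_F /= rintegralE// lee_fin.
Qed.

End tonelli.

Section density_channel.
Context dZ (Z : measurableType dZ) dE (E : measurableType dE) dT (T : measurableType dT) (R : realType).
Context (mu : probability Z R) (P : probability T R).
(** [V] is the channel, [D] the noise, and [q (z, .)] the density of the law of [V (z, .)] with
    respect to that of [D]. The growth function [G] has a uniformly bounded mean under every input,
    and multiples of 1 + G dominate all the logarithms that occur, which makes every information
    finite. *)
Variables (V : Z * T -> E) (D : T -> E) (q : Z * E -> R) (G : E -> R) (A A' : R).
Hypotheses (mV : measurable_fun [set: Z * T] V) (mD : measurable_fun [set: T] D)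
  (mq : measurable_fun [set: Z * E] q) (mG : measurable_fun [set: E] G).
Hypothesis q0 : forall z, 0 < q z.
Hypothesis G0 : forall y, 0 <= G y.
Hypothesis law : forall z (f : E -> R), measurable_fun [set: E] f -> (forall y, 0 <= f y) ->
  (\int[P]_w (f (V (z, w)))%:E = \int[P]_w (q (z, D w) * f (D w))%:E)%E.
Hypothesis A0 : 0 <= A.
Hypothesis q_bounds : forall z y, - A <= ln (q (z, y)) <= G y.
Hypothesis G_int : forall z, (\int[P]_w (G (V (z, w)))%:E <= A'%:E)%E.

Definition output_density y : R := \int[mu]_z q (z, y).
Local Notation s := output_density.

Let q0' z : 0 <= q z. Proof. exact: ltW. Qed.

Let mq_pair y : measurable_fun [set: Z] (fun z => q (z, y)).
Proof. exact: measurable_section_left. Qed.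

Let q_le z y : q (z, y) <= expR (G y).
Proof. by rewrite -[q _]lnK ?posrE// ler_expR; case/andP: (q_bounds z y). Qed.

Let q_ge z y : expR (- A) <= q (z, y).
Proof. by rewrite -[q _]lnK ?posrE// ler_expR; case/andP: (q_bounds z y). Qed.

Let iq y : rintegrable mu (fun z => q (z, y)).
Proof.
apply: rintegrable_le (rintegrable_cst mu (expR (G y))) _ => // z.
by rewrite ger0_norm.
Qed.

Lemma measurable_output_density : measurable_fun [set: E] s.
Proof. by apply: measurable_Rintegral_left. Qed.

Lemma output_density_bounds y : expR (- A) <= s y <= expR (G y).
Proof.
rewrite -[X in X <= s y <= _](Rintegral_prob_cst mu) -[X in _ <= s y <= X](Rintegral_prob_cst mu).
by apply/andP; split; apply: le_Rintegral => //; first [exact: rintegrable_cst|exact: iq].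
Qed.

Lemma output_density_gt0 y : 0 < s y.
Proof. by have /andP[+ _] := output_density_bounds y; apply: lt_le_trans; exact: expR_gt0. Qed.

Definition transmission (zw : Z * T) : Z * E := (zw.1, V zw).

Lemma measurable_transmission : measurable_fun [set: Z * T] transmission.
Proof. by apply: measurable_fun_pair => //; exact: measurable_fst. Qed.

Let mD2 : measurable_fun [set: Z * T] (fun zw => (zw.1, D zw.2)).
Proof. by apply: measurable_fun_pair; [exact: measurable_fst|exact: measurableT_comp mD measurable_snd]. Qed.

Lemma transmission_integral (f : Z * E -> R) : measurable_fun [set: Z * E] f -> (forall y, 0 <= f y) ->
  (\int[(mu \x P)%E]_u (f (transmission u))%:E =
   \int[(mu \x P)%E]_u (q (u.1, D u.2) * f (u.1, D u.2))%:E)%E.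
Proof.
move=> mf f0.
have m1 : measurable_fun [set: Z * T] (fun u => f (transmission u)).
  exact: measurableT_comp mf measurable_transmission.
have m2 : measurable_fun [set: Z * T] (fun u => q (u.1, D u.2) * f (u.1, D u.2)).
  by apply: measurable_funM; [exact: measurableT_comp mq mD2|exact: measurableT_comp mf mD2].
rewrite (tonelli12 mu P m1 (fun u => f0 _)) (tonelli12 mu P m2 (fun u => mulr_ge0 (q0' _) (f0 _))).
apply: eq_integral => z _.
apply: (law z (f := fun y => f (z, y))) => //.
exact: measurable_section_right.
Qed.

Lemma output_integral (f : E -> R) : measurable_fun [set: E] f -> (forall y, 0 <= f y) ->
  (\int[(mu \x P)%E]_u (f (V u))%:E = \int[P]_w (s (D w) * f (D w))%:E)%E.
Proof.
move=> mf f0.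
rewrite (transmission_integral (f := fun zy => f zy.2))//; last exact: measurableT_comp mf measurable_snd.
have m2 : measurable_fun [set: Z * T] (fun u => q (u.1, D u.2) * f (D u.2)).
  apply: measurable_funM; first exact: measurableT_comp mq mD2.
  exact: (measurableT_comp mf (measurableT_comp mD measurable_snd)).
rewrite (tonelli21 mu P m2 (fun u => mulr_ge0 (q0' _) (f0 _))).
apply: eq_integral => w _ /=.
have -> : (\int[mu]_x (q (x, D w) * f (D w))%:E = \int[mu]_x ((f (D w))%:E * (q (x, D w))%:E))%E.
  by apply: eq_integral => z _; rewrite mulrC.
rewrite ge0_integralZl//; try (by apply/measurable_EFinP); try (by move=> z _; rewrite lee_fin); try by rewrite lee_fin.
by rewrite rintegralE//; rewrite -EFinM mulrC.
Qed.

Let PZ := (mu \x P)%E.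

Lemma rintegrable_growth : rintegrable PZ (fun u => G (V u)).
Proof.
have mGV : measurable_fun [set: Z * T] (fun u => G (V u)) by exact: measurableT_comp mG mV.
apply/integrableP; split; first exact/measurable_EFinP.
under eq_integral do rewrite /= ger0_norm//.
rewrite /PZ (tonelli12 mu P mGV (fun u => G0 _)).
apply: (@le_lt_trans _ _ (\int[mu]_z A'%:E)%E); last by rewrite integral_prob_cst ltry.
apply: ge0_le_integral => //.
- by move=> z _; apply: integral_ge0 => w _; rewrite lee_fin.
- exact: (measurable_integral_right P mGV).
Qed.

Lemma rintegrable_growth_section z : rintegrable P (fun w => G (V (z, w))).
Proof.
apply/integrableP; split.
  apply/measurable_EFinP; apply: (measurableT_comp mG); exact: measurable_section_right.
under eq_integral do rewrite /= ger0_norm//.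
by apply: le_lt_trans (G_int z) _; rewrite ltry.
Qed.

Lemma rintegrable_dominated (f : Z * E -> R) c : measurable_fun [set: Z * E] f ->
  (forall z y, `|f (z, y)| <= c * (1 + G y)) ->
  rintegrable PZ (fun u => f (transmission u)).
Proof.
move=> mf fG; apply: rintegrable_le (rintegrableZ c (rintegrableD (rintegrable_cst PZ 1) rintegrable_growth)) _.
- exact: measurableT_comp mf measurable_transmission.
- by move=> u; exact: fG.
Qed.

Lemma rintegrable_dominated_section (f : Z * E -> R) c z : measurable_fun [set: Z * E] f ->
  (forall z y, `|f (z, y)| <= c * (1 + G y)) ->
  rintegrable P (fun w => f (transmission (z, w))).
Proof.
move=> mf fG; apply: rintegrable_le (rintegrableZ c (rintegrableD (rintegrable_cst P 1) (rintegrable_growth_section z))) _.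
- exact: (measurable_section_right (measurableT_comp mf measurable_transmission)).
- by move=> u; exact: fG.
Qed.

Definition information_density (zy : Z * E) : R := ln (q zy) - ln (s zy.2).

Lemma measurable_information_density : measurable_fun [set: Z * E] information_density.
Proof.
apply: measurable_funB; apply: (measurableT_comp (@measurable_ln R)) => //.
exact: measurableT_comp measurable_output_density measurable_snd.
Qed.

Lemma ln_output_density_bounds y : - A <= ln (s y) <= G y.
Proof.
have /andP[h1 h2] := output_density_bounds y.
by rewrite -[- A]expRK -[G y]expRK !ler_ln ?posrE ?expR_gt0 ?output_density_gt0// h1 h2.
Qed.

Lemma information_density_dominated z y :
  `|information_density (z, y)| <= (2 * A + 2) * (1 + G y).
Proof.
have /andP[h1 h2] := ln_output_density_bounds y; have /andP[h3 h4] := q_bounds z y.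
have h := G0 y; have hA := mulr_ge0 A0 h.
by rewrite ler_norml /information_density /=; apply/andP; split; nra.
Qed.

Lemma information_density_mean y :
  (\int[mu]_z (expR (information_density (z, y)))%:E = 1)%E.
Proof.
have s0 := output_density_gt0 y.
transitivity (\int[mu]_z (((s y)^-1)%:E * (q (z, y))%:E))%E.
  apply: eq_integral => z _; rewrite -EFinM; congr EFin.
  by rewrite expRB !lnK ?posrE// mulrC.
rewrite ge0_integralZl//; try (by apply/measurable_EFinP); try (by move=> z _; rewrite lee_fin).
  by rewrite rintegralE// -EFinM mulVf// gt_eqF.
by rewrite lee_fin invr_ge0 ltW.
Qed.

Definition information : R := \int[PZ]_u information_density (transmission u).

(** The variational lower bound of Donsker and Varadhan with the logarithm of the mean of [h]
    linearized: a mean of at most 1 + e under the product of the marginals costs e. The function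
    [eta] separates the average over the input, at fixed output, from the average over the
    output. *)
Lemma information_ge (h : Z * E -> R) (eta : E -> R) c e :
  measurable_fun [set: Z * E] h -> (forall z, 0 < h z) ->
  (forall z y, `|ln (h (z, y))| <= c * (1 + G y)) ->
  measurable_fun [set: E] eta -> (forall y, 0 <= eta y) ->
  (forall y, \int[mu]_z (h (z, y))%:E <= (eta y)%:E)%E ->
  (\int[PZ]_u (eta (V u))%:E <= (1 + e)%:E)%E ->
  \int[PZ]_u ln (h (transmission u)) - e <= information.
Proof.
move=> mh h0 hG meta eta0 heta eeta.
have mlh : measurable_fun [set: Z * E] (fun u => ln (h u)) by exact: (measurableT_comp (@measurable_ln R)).
(* [h] divided by the joint density with respect to the product of the marginals: its mean under the
   joint law is the mean of [h] under the product, and ln k <= k - 1 gives the bound. *)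
pose k (zy : Z * E) := h zy * s zy.2 / q zy.
have sgt y := output_density_gt0 y.
have k0 u : 0 <= k u by rewrite divr_ge0// mulr_ge0 ?ltW.
have msnd : measurable_fun [set: Z * E] (fun u => s u.2) by exact: measurableT_comp measurable_output_density measurable_snd.
have mk : measurable_fun [set: Z * E] k.
  apply: measurable_funM; first exact: measurable_funM.
  have -> : (fun u => (q u)^-1) = (fun u => expR (- ln (q u))).
    by apply/funext => u; rewrite expRN lnK// posrE.
  apply: (measurableT_comp (@measurable_expR R)).
  by apply: (measurableT_comp (@oppr_measurable R _)); exact: (measurableT_comp (@measurable_ln R)).
have kint : (\int[PZ]_u (k (transmission u))%:E <= (1 + e)%:E)%E.
  rewrite /PZ transmission_integral//; apply: le_trans eeta.
  rewrite /PZ output_integral//.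
  have m3 : measurable_fun [set: Z * T] (fun u => s (D u.2) * h (u.1, D u.2)).
    apply: measurable_funM; last exact: measurableT_comp mh mD2.
    exact: measurableT_comp measurable_output_density (measurableT_comp mD measurable_snd).
  have p3 u : 0 <= s (D u.2) * h (u.1, D u.2) by rewrite mulr_ge0 ?ltW.
  have -> : (\int[PZ]_u (q (u.1, D u.2) * k (u.1, D u.2))%:E = \int[PZ]_u (s (D u.2) * h (u.1, D u.2))%:E)%E.
    by apply: eq_integral => u _; congr EFin; rewrite /k /=; field; exact: lt0r_neq0.
  rewrite /PZ (tonelli21 mu P m3 p3).
  apply: ge0_le_integral => //.
  - by move=> w _; apply: integral_ge0 => z _; rewrite lee_fin p3.
  - exact: (measurable_integral_left mu m3 p3).
  - apply/measurable_EFinP; apply: measurable_funM; last exact: measurableT_comp meta mD.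
    exact: measurableT_comp measurable_output_density mD.
  - move=> w _ /=; under eq_integral do rewrite EFinM.
    rewrite ge0_integralZl//; last 3 first.
    + by apply/measurable_EFinP; exact: measurable_section_left.
    + by move=> z _; rewrite lee_fin ltW.
    + by rewrite lee_fin ltW.
    by rewrite EFinM lee_pmul2l// lte_fin.
have ik : rintegrable PZ (fun u => k (transmission u)).
  apply/integrableP; split; first by apply/measurable_EFinP; exact: measurableT_comp mk measurable_transmission.
  by under eq_integral do rewrite /= ger0_norm//; apply: le_lt_trans kint _; rewrite ltry.
have ilh := rintegrable_dominated mlh hG.
have : \int[PZ]_u (ln (h (transmission u)) + 1 - k (transmission u)) <= information.
  apply: le_Rintegral => //.
  - by apply: rintegrableB => //; apply: rintegrableD => //; exact: rintegrable_cst.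
  - exact: (rintegrable_dominated measurable_information_density information_density_dominated).
  - move=> u _; set v := transmission u; rewrite /information_density.
    have kgt : 0 < k v by rewrite divr_gt0// mulr_gt0.
    have : ln (k v) <= k v - 1.
      have := @le_ln1Dx R (k v - 1); rewrite (addrC 1) subrK; apply.
      by rewrite ltrBrDl addrN.
    by rewrite /k ln_div ?posrE ?mulr_gt0// lnM ?posrE//; lra.
rewrite RintegralB//; last by apply: rintegrableD => //; exact: rintegrable_cst.
rewrite RintegralD//; last exact: rintegrable_cst.
rewrite Rintegral_prob_cst.
have : \int[PZ]_u k (transmission u) <= 1 + e by rewrite -lee_fin -rintegralE.
lra.
Qed.

(** Gibbs' inequality: the quotient of [s0] by the true output density has mean at most 1 under the
    output law, so replacing the latter by [s0] can only increase the integral. *)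
Lemma information_le (s0 : E -> R) c :
  measurable_fun [set: E] s0 -> (forall y, 0 < s0 y) ->
  (forall y, `|ln (s0 y)| <= c * (1 + G y)) ->
  (\int[P]_w (s0 (D w))%:E <= 1)%E ->
  information <= \int[PZ]_u (ln (q (transmission u)) - ln (s0 (V u))).
Proof.
move=> ms0 s00 s0G s01.
have sgt y := output_density_gt0 y.
pose k y := s0 y / s y.
have k0 y : 0 < k y by rewrite divr_gt0.
have mk : measurable_fun [set: E] k.
  apply: measurable_funM => //.
  have -> : (fun y => (s y)^-1) = (fun y => expR (- ln (s y))).
    by apply/funext => y; rewrite expRN lnK// posrE.
  apply: (measurableT_comp (@measurable_expR R)).
  apply: (measurableT_comp (@oppr_measurable R _)).
  by apply: (measurableT_comp (@measurable_ln R)); exact: measurable_output_density.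
have kint : (\int[PZ]_u (k (V u))%:E <= 1)%E.
  rewrite /PZ output_integral//; last by move=> y; exact: ltW.
  apply: le_trans s01; rewrite le_eqVlt; apply/orP; left; apply/eqP.
  apply: eq_integral => w _; congr EFin; rewrite /k; field; exact: lt0r_neq0.
have ik : rintegrable PZ (fun u => k (V u)).
  apply/integrableP; split; first by apply/measurable_EFinP; exact: measurableT_comp mk mV.
  under eq_integral do rewrite /= gtr0_norm//.
  by apply: le_lt_trans kint _; rewrite ltry.
pose g (zy : Z * E) := ln (q zy) - ln (s0 zy.2).
have mg : measurable_fun [set: Z * E] g.
  apply: measurable_funB; apply: (measurableT_comp (@measurable_ln R)) => //.
  exact: measurableT_comp ms0 measurable_snd.
have gG z y : `|g (z, y)| <= (A + 1 + c) * (1 + G y).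
  have /andP[h3 h4] := q_bounds z y; have := s0G y; rewrite ler_norml => /andP[h1 h2].
  have h := G0 y; have hA := mulr_ge0 A0 h.
  by rewrite ler_norml /g /=; apply/andP; split; nra.
have ig := rintegrable_dominated mg gG.
apply: (@le_trans _ _ (\int[PZ]_u (g (transmission u) + (k (V u) - 1)))).
  apply: le_Rintegral => //.
  - exact: (rintegrable_dominated measurable_information_density information_density_dominated).
  - by apply: rintegrableD => //; apply: rintegrableB => //; exact: rintegrable_cst.
  - move=> u _; rewrite /information_density /g /=.
    have : ln (k (V u)) <= k (V u) - 1.
      have := @le_ln1Dx R (k (V u) - 1); rewrite (addrC 1) subrK; apply.
      by rewrite ltrBrDl addrN.
    by rewrite {1}/k ln_div ?posrE//; lra.
rewrite RintegralD//; last by apply: rintegrableB => //; exact: rintegrable_cst.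
rewrite [X in _ + X <= _](RintegralB _ ik (rintegrable_cst PZ 1))//.
rewrite Rintegral_prob_cst gerDl subr_le0.
by rewrite -lee_fin -rintegralE.
Qed.

Section mutual_information_formula.
Context (input : {RV (mu \x P)%E >-> Z}) (output : {RV (mu \x P)%E >-> E}).
Variable B : set Z.
Hypotheses (mB : measurable B) (muB : mu (~` B) = 0).
Hypothesis inputE : forall u, input u = u.1.
Hypothesis outputE : forall u, B u.1 -> output u = V u.

Let distE d (F : measurableType d) (X Y : Z * T -> F) : measurable_fun [set: Z * T] X ->
  measurable_fun [set: Z * T] Y -> (forall u, B u.1 -> X u = Y u) ->
  forall C, measurable C -> PZ (X @^-1` C) = PZ (Y @^-1` C).
Proof.
move=> mX mY XY C mC.
have mXC : measurable (X @^-1` C) by have := mX measurableT _ mC; rewrite setTI.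
have mYC : measurable (Y @^-1` C) by have := mY measurableT _ mC; rewrite setTI.
have B0 : PZ (~` (B `*` setT)) = 0.
  have -> : ~` (B `*` [set: T]) = (~` B) `*` [set: T].
    by apply/seteqP; split => u /=; [move=> h; split=> // b; apply: h|move=> [h _] [b _]; exact: h].
  transitivity (mu (~` B) * P [set: T])%E; last by rewrite muB mul0e.
  by apply: product_measure1E => //; exact: measurableC.
have mBT : measurable (B `*` [set: T]) by exact: measurableX.
have H (S : set (Z * T)) : measurable S -> PZ S = PZ (S `&` (B `*` [set: T])).
  move=> mS; have -> : PZ S = (PZ (S `\` (B `*` [set: T])) + PZ (S `&` (B `*` [set: T])))%E by exact: measureDI.
  rewrite [X in (X + _)%E](_ : _ = 0) ?add0e//.
  apply/eqP; rewrite eq_le measure_ge0 andbT -B0; apply: le_measure => //.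
  - by apply/mem_set; exact: measurableD.
  - by apply/mem_set; exact: measurableC.
rewrite (H _ mXC) (H _ mYC); congr (PZ _).
by apply/seteqP; split => u /= [hu [b _]]; split => //; move: hu; rewrite /= XY.
Qed.

(** The joint law has density q / s with respect to the product of the marginals. The set [B] of
    full measure absorbs the difference between the actual output and the channel [V], which agree
    only there. *)
Lemma mutual_informationE : mutual_information input output = information%:E.
Proof.
have sgt y := output_density_gt0 y.
have m1 : measurable_fun [set: Z * T] (fst : Z * T -> Z) by exact: measurable_fst.
have mO : measurable_fun [set: Z * T] output by exact: measurable_funP.
have mpair : measurable_fun [set: Z * T] (pair_rv input output).
  by apply: measurable_fun_pair; exact: measurable_funP.
have mtr := measurable_transmission.
have dpair C : measurable C -> PZ (pair_rv input output @^-1` C) = PZ (transmission @^-1` C).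
  by apply: distE => // u Bu; rewrite /pair_rv /transmission inputE outputE.
have dout C : measurable C -> PZ (output @^-1` C) = PZ (V @^-1` C) by apply: distE.
pose r (zy : Z * E) := q zy / s zy.2.
have r0 u : 0 < r u by rewrite divr_gt0.
have msnd : measurable_fun [set: Z * E] (fun u => s u.2) by exact: measurableT_comp measurable_output_density measurable_snd.
have mr : measurable_fun [set: Z * E] r.
  apply: measurable_funM => //.
  have -> : (fun u : Z * E => (s u.2)^-1) = (fun u => expR (- ln (s u.2))).
    by apply/funext => u; rewrite expRN lnK// posrE.
  apply: (measurableT_comp (@measurable_expR R)).
  by apply: (measurableT_comp (@oppr_measurable R _)); exact: (measurableT_comp (@measurable_ln R)).
have integral_X (f : Z -> \bar R) : measurable_fun [set: Z] f -> (forall z, 0 <= f z)%E ->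
    (\int[distribution PZ input]_z f z = \int[mu]_z f z)%E.
  move=> mf f0.
  rewrite ge0_integral_pushforward// preimage_setT.
  have -> : (f \o input = fun u => f u.1) by apply/funext => u /=; rewrite inputE.
  rewrite fubini_tonelli1//; last exact: measurableT_comp mf m1.
  apply: eq_integral => z _; rewrite /fubini_F /=.
  rewrite integral_cst//= [X in (_ * X)%E](@probability_setT _ _ _ P) ?mule1//.
have integral_Y (f : E -> R) : measurable_fun [set: E] f -> (forall z, 0 <= f z) ->
    (\int[distribution PZ output]_y (f y)%:E = \int[P]_w (s (D w) * f (D w))%:E)%E.
  move=> mf f0; rewrite -output_integral//.
  rewrite ge0_integral_pushforward//; last 2 first.
  - exact/measurable_EFinP.
  - by move=> y _; rewrite lee_fin.
  rewrite preimage_setT.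
  exact: (same_law_ge0 mO mV (same_law_set mO mV dout) mf f0).
rewrite /mutual_information (@kl_divergence_density _ _ _ _ _ r)//.
- have L : same_law (distribution PZ (pair_rv input output)) PZ id transmission.
    by apply: same_law_set => // C mC; exact: dpair.
  have mlr : measurable_fun [set: Z * E] (fun u => ln (r u)) by exact: (measurableT_comp (@measurable_ln R)).
  rewrite (same_law_integral (@measurable_id _ _ _) mtr L mlr).
  transitivity (\int[PZ]_u (information_density (transmission u))%:E)%E.
    by apply: eq_integral => u _; rewrite /information_density /r ln_div ?posrE.
  by rewrite rintegralE//; exact: (rintegrable_dominated measurable_information_density information_density_dominated).
- move=> C mC.
  transitivity (PZ (transmission @^-1` C)); first exact: dpair.
  have mtC : measurable (transmission @^-1` C) by have := mtr measurableT _ mC; rewrite setTI.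
  have m1C : measurable_fun [set: Z * E] (\1_C : Z * E -> R) by exact: measurable_indic.
  transitivity (\int[PZ]_u (\1_C (transmission u) : R)%:E)%E.
    transitivity (\int[PZ]_u (\1_(transmission @^-1` C) u)%:E)%E; last by [].
    by rewrite integral_indic// setIT.
  rewrite /PZ transmission_integral//.
  have mrC : measurable_fun [set: Z * E] (fun u => r u * \1_C u) by exact: measurable_funM.
  have rC0 u : 0 <= r u * \1_C u by rewrite mulr_ge0// ltW.
  transitivity (\int[(distribution PZ input \x distribution PZ output)%E]_u (r u * \1_C u)%:E)%E; last first.
    rewrite [RHS]integral_mkcond; apply: eq_integral => u _.
    by rewrite patchE indicE; case: ifP; rewrite ?mulr1 ?mulr0.
  rewrite (tonelli12 _ _ mrC rC0).
  rewrite integral_X; last 2 first.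
  - exact: (measurable_integral_right _ mrC rC0).
  - by move=> z; apply: integral_ge0 => y _; rewrite lee_fin.
  have m3 : measurable_fun [set: Z * T] (fun u => q (u.1, D u.2) * \1_C (u.1, D u.2) : R).
    by apply: measurable_funM; [exact: measurableT_comp mq mD2|exact: measurableT_comp m1C mD2].
  rewrite (tonelli12 mu P m3); last by move=> u; rewrite mulr_ge0.
  apply: eq_integral => z _; rewrite (integral_Y (fun y => r (z, y) * \1_C (z, y)) (measurable_section_right mrC z) (fun y => rC0 (z, y))).
  by apply: eq_integral => w _ /=; congr EFin; rewrite /r /=; field; exact: lt0r_neq0.
Qed.

End mutual_information_formula.

End density_channel.

(** * The information of one block *)

Section block_information.
Context d (T : measurableType d) (R : realType) (P : probability T R) (K N : nat).
Local Notation C := R[i].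
Local Notation cRe := complex.Re.
Variables (H : 'I_K -> int -> {RV P >-> C}) (W : int -> {RV P >-> C}).
Hypothesis HW : rayleigh_channel H W.
Variable rho : R.
Hypothesis rho0 : 0 <= rho.
Implicit Types (s : int) (z y : N.-tuple C) (mu : probability (N.-tuple C) R).
Local Notation t := (total_power H).

Definition block_output (zw : N.-tuple C * T) : N.-tuple C :=
  channel_out H W 0 rho (clamp zw.1) zw.2.

Definition block_density (zy : N.-tuple C * N.-tuple C) : R := density H rho (clamp zy.1) zy.2.

Definition energy y : R := \sum_n nsq (tnth y n).

Local Notation A := (rho * (N%:R * t)).
Local Notation A' := (N%:R * (1 + rho * t)).

Lemma measurable_block_output : measurable_fun [set: N.-tuple C * T] block_output.
Proof.
apply: measurable_channel_out; last exact: measurable_snd.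
exact: measurableT_comp (@measurable_clamp R N) measurable_fst.
Qed.

Lemma measurable_block_density : measurable_fun [set: N.-tuple C * N.-tuple C] block_density.
Proof.
apply: measurable_density; last exact: measurable_snd.
exact: measurableT_comp (@measurable_clamp R N) measurable_fst.
Qed.

Lemma measurable_energy : measurable_fun [set: N.-tuple C] energy.
Proof. by apply: measurable_fun_sum_cond => n; apply: measurable_fun_nsq; exact: measurable_tnth. Qed.

Lemma block_density_gt0 u : 0 < block_density u.
Proof. exact: (density_gt0 HW). Qed.

Lemma energy_ge0 y : 0 <= energy y.
Proof. by apply: sumr_ge0 => n _; exact: nsq_ge0. Qed.

Lemma block_law z (f : N.-tuple C -> R) : measurable_fun [set: N.-tuple C] f -> (forall y, 0 <= f y) ->
  (\int[P]_w (f (block_output (z, w)))%:E =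
   \int[P]_w (block_density (z, noise N W w) * f (noise N W w))%:E)%E.
Proof. by move=> mf f0; exact: (density_change HW 0 (clamp z) rho0 mf f0). Qed.

Lemma block_A0 : 0 <= A.
Proof. by rewrite !mulr_ge0// total_power_ge0. Qed.

Lemma block_density_bounds z y : - A <= ln (block_density (z, y)) <= energy y.
Proof.
have /andP[h1 _] := ln_density_bounds HW (clamp z) y rho0.
rewrite (ln_density_le HW)// andbT; apply: le_trans h1; rewrite lerN2 ler_wpM2l//.
by apply: trace_cov_le => i; exact: clamp_le1.
Qed.

Lemma energy_output_integral s z : (forall i, nsq (tnth z i) <= 1) ->
  rintegrable P (fun w => energy (channel_out H W s rho z w)) /\
  \int[P]_w energy (channel_out H W s rho z w) <= A'.
Proof.
move=> z1; have oi m := output_nsq HW s z m rho0.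
split; first by apply: rintegrable_sum => [|m]; [exact: rintegrable_cst|exact: (oi m).1].
rewrite rintegral_sum; last by move=> m; exact: (oi m).1.
apply: (@le_trans _ _ (\sum_(m < N) (1 + rho * t))); last by rewrite sumr_const card_ord mulr_natl.
apply: ler_sum => m _; rewrite (oi m).2 lerD2l ler_wpM2l//.
exact: fade_cov_diag_le.
Qed.

Lemma block_growth z : (\int[P]_w (energy (block_output (z, w)))%:E <= A'%:E)%E.
Proof.
have [h1 h2] := @energy_output_integral 0 (clamp z) (clamp_le1 z).
by rewrite /block_output /= rintegralE.
Qed.

(** Information of the channel fed with clamped inputs, a real number for every [mu]. It agrees with
    [block_information] when the inputs lie almost surely in the unit disk. *)
Definition block_info mu : R := information mu P block_output block_density.

Lemma block_informationE mu : (forall i : 'I_N, {ae mu, forall z, Normc.normc (tnth z i) <= 1}) ->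
  block_information H W rho mu = (block_info mu)%:E.
Proof.
move=> ae1.
pose B := [set z : N.-tuple C | forall i, nsq (tnth z i) <= 1].
have BE : B = \bigcap_(i in [set: 'I_N]) [set z | nsq (tnth z i) <= 1].
  by apply/seteqP; split => z /= h i; [move=> _|]; exact: h.
have mB : measurable B.
  rewrite BE; apply: fin_bigcap_measurable => // i _.
  have := @measurable_fun_ler _ _ _ setT (fun z : N.-tuple C => nsq (tnth z i)) (cst 1)
    (measurable_fun_nsq (measurable_tnth i)) (measurable_cst _) measurableT [set true].
  rewrite setTI (_ : _ @^-1` _ = [set z : N.-tuple C | nsq (tnth z i) <= 1]); first exact.
  by apply/seteqP; split.
have muB : mu (~` B) = 0%E.
  have : {ae mu, forall z, B z}.
    have := @filter_forall _ _ (fun i : 'I_N => [set z : N.-tuple C | Normc.normc (tnth z i) <= 1]) _ (ae_filter_ringOfSetsType mu) ae1.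
    apply: (@filterS _ _ (ae_filter_ringOfSetsType mu)) => z /= h i.
    by rewrite nsq_normc expr_le1// /Normc.normc; case: (tnth z i) => a b; exact: sqrtr_ge0.
  move=> [S [mS S0 HS]]; apply/eqP; rewrite eq_le measure_ge0 andbT -S0.
  by apply: le_measure => //; apply/mem_set => //; exact: measurableC.
have MI := mutual_informationE measurable_block_output (@measurable_noise _ _ _ _ N W) measurable_block_density
  measurable_energy block_density_gt0 energy_ge0 block_law block_A0 block_density_bounds block_growth mB muB.
rewrite /block_information; apply: MI => //.
move=> [z w] /= Bz; rewrite /block_output clamp_id//=.
Qed.

Lemma reference_bound x y : 0 <= x ->
  `|ln (reference x y)| <= (1 + N%:R * ln (1 + x)) * (1 + energy y).
Proof.
move=> x0; have l0 : 0 <= ln (1 + x) by rewrite ln_ge0//; lra.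
rewrite ln_reference// sumrB -mulr_sumr -/(energy y) sumr_const card_ord -[_ *+ N]mulr_natl.
have e0 := energy_ge0 y.
have a0 : 0 <= x / (1 + x) by rewrite divr_ge0//; lra.
have a1 : x / (1 + x) <= 1 by rewrite ler_pdivrMr; lra.
have L0 : 0 <= N%:R * ln (1 + x) by rewrite mulr_ge0.
move: a0 a1 L0; set a := _ / _; set L := _ * ln _ => a0 a1 L0.
have h1 := mulr_ge0 a0 e0; have h2 := mulr_ge0 L0 e0.
have h3 : a * energy y <= energy y by rewrite ler_piMl.
by rewrite ler_norml; apply/andP; split; lra.
Qed.

(** Gibbs' inequality with the product normal law of variance 1 + x, followed by Fubini: given the
    input, the means of both logarithms are explicit or bounded, so it suffices to bound them for
    each input separately. *)
Lemma block_info_le mu x B : 0 <= x ->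
  (forall z, (forall i, nsq (tnth z i) <= 1) ->
   rho ^+ 2 / 2 * (\sum_m \sum_n nsq (fade_cov H z m n)) -
   \sum_m (x / (1 + x) * (1 + rho * cRe (fade_cov H z m m)) - ln (1 + x)) <= B) ->
  block_info mu <= B.
Proof.
move=> x0 hB.
have mref : measurable_fun [set: N.-tuple C] (@reference R N x) by exact: measurable_spectral_gain.
have iref : (\int[P]_w (reference x (noise N W w))%:E <= 1)%E by rewrite (reference_integral N HW x0).
have := @information_le _ _ _ _ _ _ _ mu _ _ _ _ _ _ _ measurable_block_output (@measurable_noise _ _ _ _ N W)
  measurable_block_density measurable_energy block_density_gt0 energy_ge0 block_law block_A0
  block_density_bounds block_growth _ _ mref (fun y => reference_gt0 y x0) (fun y => reference_bound y x0) iref.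
move=> h; apply: le_trans h _.
pose g (zy : N.-tuple C * N.-tuple C) := ln (block_density zy) - ln (reference x zy.2).
have mg : measurable_fun [set: N.-tuple C * N.-tuple C] g.
  apply: measurable_funB; apply: (measurableT_comp (@measurable_ln R)).
    exact: measurable_block_density.
  exact: measurableT_comp mref measurable_snd.
have gG z y : `|g (z, y)| <= (A + 1 + (1 + N%:R * ln (1 + x))) * (1 + energy y).
  have /andP[h3 h4] := block_density_bounds z y; have := reference_bound y x0; rewrite ler_norml => /andP[h1 h2].
  have h := energy_ge0 y; have hA := mulr_ge0 block_A0 h; have hA0 := block_A0.
  have E : (A + 1 + (1 + N%:R * ln (1 + x))) * (1 + energy y) =
      A + A * energy y + 1 + energy y + (1 + N%:R * ln (1 + x)) * (1 + energy y) by ring.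
  rewrite ler_norml /g /= E; move: h1 h2 h3 h4 hA hA0 h.
  by move=> *; apply/andP; split; lra.
have ig := rintegrable_dominated mu measurable_block_output measurable_energy energy_ge0 block_growth mg gG.
have igs z := rintegrable_dominated_section measurable_block_output measurable_energy energy_ge0 block_growth z mg gG.
apply: (Rintegral_fubini_le ig igs) => z.
have c1 := @clamp_le1 R N z.
have [i1 l1] := ln_density_integral HW 0 (clamp z) rho0.
have oi m := output_nsq HW 0 (clamp z) m rho0.
rewrite /g /transmission /block_output /block_density /=.
have ir m : rintegrable P (fun w => x / (1 + x) * nsq (tnth (channel_out H W 0 rho (clamp z) w) m) - ln (1 + x)).
  by apply: rintegrableB; [apply: rintegrableZ; exact: (oi m).1|exact: rintegrable_cst].
under eq_Rintegral => w _ do rewrite ln_reference//.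
rewrite RintegralB//; last by apply: rintegrable_sum => //; exact: rintegrable_cst.
rewrite rintegral_sum//; apply: le_trans (hB _ c1); apply: lerB => //.
apply: ler_sum => m _.
rewrite RintegralB//; [|by apply: rintegrableZ; exact: (oi m).1|exact: rintegrable_cst].
by rewrite RintegralZl//; [rewrite (oi m).2 Rintegral_prob_cst|exact: (oi m).1].
Qed.

End block_information.

(** * Upper bound *)

Section cauchy_schwarz.
Variables (R : realType) (K : nat).

Lemma sum_sq_le (a : 'I_K -> R) : (\sum_k a k) ^+ 2 <= K%:R * \sum_k a k ^+ 2.
Proof.
have : 0 <= \sum_i \sum_j (a i - a j) ^+ 2.
  by apply: sumr_ge0 => i _; apply: sumr_ge0 => j _; exact: sqr_ge0.
have -> : \sum_i \sum_j (a i - a j) ^+ 2 = 2 * (K%:R * \sum_k a k ^+ 2) - 2 * (\sum_k a k) ^+ 2.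
  have E i : \sum_j (a i - a j) ^+ 2 = K%:R * a i ^+ 2 + \sum_k a k ^+ 2 - 2 * a i * \sum_k a k.
    rewrite mulr_sumr -[K%:R * _](_ : \sum_(j < K) a i ^+ 2 = _); last by rewrite sumr_const card_ord mulr_natl.
    by rewrite -big_split -sumrB /=; apply: eq_bigr => j _; ring.
  under eq_bigr do rewrite E.
  rewrite sumrB big_split /= -mulr_sumr -mulr_suml -mulr_sumr.
  by rewrite sumr_const card_ord -[_ *+ K]mulr_natl; ring.
lra.
Qed.

Lemma nsq_sum_le (x : 'I_K -> R[i]) : nsq (\sum_k x k) <= K%:R * \sum_k nsq (x k).
Proof.
have cIm_sum : complex.Im (\sum_k x k) = \sum_k complex.Im (x k).
  by apply: (big_morph (@complex.Im R)) => // u v; exact: cImD.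
rewrite /nsq cRe_sum cIm_sum big_split mulrDr /=.
by rewrite lerD ?sum_sq_le.
Qed.

End cauchy_schwarz.

Lemma sum_shift (V : nmodType) (f : nat -> V) (N n : nat) :
  \sum_(m < N | (n < m)%N) f (m - n)%N = \sum_(1 <= e < N - n) f e.
Proof.
have [nN|Nn] := leqP N n.
  rewrite big1; last by move=> m nm; have := ltn_ord m; lia.
  by rewrite big_geq//; lia.
rewrite -(big_mkord (fun m => n < m)%N (fun m => f (m - n)%N)).
rewrite (big_cat_nat (n := n.+1)) //= [X in X + _]big_nat_cond [X in X + _]big1 ?add0r; last by move=> i; lia.
rewrite big_nat_cond (eq_bigl (fun i => (n.+1 <= i < N)%N && true)); last by move=> i; lia.
rewrite -big_nat_cond -{1}(add1n n) big_addn.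
by apply: eq_bigr => i _; rewrite addnK.
Qed.

Section upper_bound.
Context d (T : measurableType d) (R : realType) (P : probability T R) (K N : nat).
Local Notation C := R[i].
Local Notation cRe := complex.Re.
Variables (H : 'I_K -> int -> {RV P >-> C}) (W : int -> {RV P >-> C}).
Hypothesis HW : rayleigh_channel H W.
Hypothesis phi_fin : forall k, (phi (H k) < +oo)%E.
Implicit Types (z : N.-tuple C).
Local Notation t := (total_power H).

Definition phi_real (k : 'I_K) : R := fine (phi (H k)).

Lemma phi_ge0 k : (0 <= phi (H k))%E.
Proof. by apply: nneseries_ge0 => n _ _; rewrite lee_fin sqr_ge0. Qed.

Lemma phi_realE k : phi (H k) = (phi_real k)%:E.
Proof. by rewrite fineK// ge0_fin_numE// phi_ge0. Qed.

Lemma phi_partial k M : \sum_(1 <= n < M) nsq (autocorrelation (H k) n%:Z) <= phi_real k.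
Proof.
rewrite -lee_fin -phi_realE -sumEFin.
under eq_bigr do rewrite nsq_normc.
apply: nneseries_lim_ge => n _ _.
by rewrite lee_fin sqr_ge0.
Qed.

Lemma power_sq_lt k : nonephemeral (H k) -> power H k ^+ 2 <= 2 * phi_real k.
Proof.
move=> ne; rewrite leNgt; apply/negP => h; apply: ne.
by rewrite /ephemeral phi_realE -EFinM lee_fin ltW.
Qed.

(** Cauchy-Schwarz over the K taps; the input factor of the later time m is bounded by 1, which
    leaves the input energy seen at time n and partial sums of phi_k. *)
Lemma fade_cov_row z (n : 'I_N) : (forall i, nsq (tnth z i) <= 1) ->
  \sum_(m < N | (n < m)%N) nsq (fade_cov H z m n) <=
  K%:R * \sum_k phi_real k * nsq (input_at z (n.+1%:Z - k%:Z)).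
Proof.
move=> z1.
apply: (@le_trans _ _ (\sum_(m < N | (n < m)%N) K%:R * \sum_k nsq (autocorrelation (H k) (m - n)%N%:Z) *
   nsq (input_at z (n.+1%:Z - k%:Z)))).
  apply: ler_sum => m nm; apply: le_trans (nsq_sum_le _) _.
  rewrite ler_wpM2l//; apply: ler_sum => k _.
  rewrite nsqM subzn; last exact: ltnW.
  rewrite ler_wpM2l ?nsq_ge0// nsqM.
  have -> : nsq (conjc (input_at z (n.+1%:Z - k%:Z))) = nsq (input_at z (n.+1%:Z - k%:Z)).
    by case: (input_at _ _) => a b; rewrite /nsq /= sqrrN.
  by rewrite ler_piMl ?nsq_ge0// input_at_le1.
rewrite -mulr_sumr ler_wpM2l// exchange_big; apply: ler_sum => k _ /=.
rewrite -mulr_suml ler_wpM2r ?nsq_ge0//.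
rewrite (sum_shift (fun e => nsq (autocorrelation (H k) e%:Z))).
exact: phi_partial.
Qed.

(** With a = |z|^2 in [0, 1], (1 - a)^2 <= 1 - a and R_k(0)^2 <= 2 phi_k. The deficit is thus
    measured in the same unit, phi_k times missing energy, as the off-diagonal part, and the two add
    up to a constant. *)
Lemma diagonal_deficit z (n : 'I_N) : (forall k, nonephemeral (H k)) -> (forall i, nsq (tnth z i) <= 1) ->
  (t - cRe (fade_cov H z n n)) ^+ 2 <=
  2 * (K%:R * \sum_k phi_real k * (1 - nsq (input_at z (n.+1%:Z - k%:Z)))).
Proof.
move=> ne z1.
have -> : t - cRe (fade_cov H z n n) = \sum_k power H k * (1 - nsq (input_at z (n.+1%:Z - k%:Z))).
  by rewrite fade_cov_diag /total_power -sumrB; apply: eq_bigr => k _; rewrite mulrBr mulr1.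
apply: le_trans (sum_sq_le _) _.
rewrite mulrCA ler_wpM2l// mulr_sumr; apply: ler_sum => k _.
have := input_at_le1 (n.+1%:Z - k%:Z) z1; have := nsq_ge0 (input_at z (n.+1%:Z - k%:Z)).
have := power_sq_lt (ne k); have := power_ge0 H k.
set a := nsq _; set r := power _ _; set f := phi_real _ => r0 hr a0 a1.
rewrite exprMn (mulrA 2 f); apply: (@le_trans _ _ (2 * f * (1 - a) ^+ 2)).
  by rewrite ler_wpM2r ?sqr_ge0.
rewrite ler_wpM2l//; last by nra.
by have := sqr_ge0 r; lra.
Qed.

Lemma fade_cov_nsq_sum z : \sum_m \sum_n nsq (fade_cov H z m n) =
  \sum_(n < N) (cRe (fade_cov H z n n) ^+ 2 + 2 * \sum_(m < N | (n < m)%N) nsq (fade_cov H z m n)).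
Proof.
have sym (m n : 'I_N) : nsq (fade_cov H z m n) = nsq (fade_cov H z n m).
  rewrite (fade_cov_conj z n m (channel_stationary HW)).
  by case: (fade_cov H z n m) => a b; rewrite /nsq /= sqrrN.
have diag (n : 'I_N) : nsq (fade_cov H z n n) = cRe (fade_cov H z n n) ^+ 2.
  have := fade_cov_conj z n n (channel_stationary HW).
  case: (fade_cov H z n n) => a b [] /= /eqP.
  by rewrite -subr_eq0 opprK -mulr2n mulrn_eq0 /= => /eqP ->; rewrite /nsq /= expr0n /= addr0.
have split3 (f : 'I_N -> R) n : \sum_m f m = f n + \sum_(m < N | (n < m)%N) f m + \sum_(m < N | (m < n)%N) f m.
  rewrite (bigD1 n)//= -addrA; congr (_ + _).
  rewrite (bigID (fun m : 'I_N => (n < m)%N))/=; congr (_ + _); apply: eq_bigl => m.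
    by rewrite -val_eqE /=; lia.
  by rewrite -val_eqE /=; lia.
rewrite exchange_big /=.
under eq_bigr => n _ do rewrite (split3 _ n) diag.
rewrite !big_split /= -addrA; congr (_ + _).
rewrite -mulr_sumr mulrDl mul1r; congr (_ + _).
rewrite [LHS](exchange_big_dep xpredT)//=; apply: eq_bigr => m _; apply: eq_bigr => n _.
by rewrite sym.
Qed.

(** With a = S_nn and [Off] the sum of |S_mn|^2 over m > n, the second order term of index n is
    rho^2 ((t - a)^2 / 2 + Off), at most rho^2 K times the sum of the phi_k. In the cubic remainder,
    1/3 comes from the expansion of ln (1 + rho t) and 1 from rho a (rho t)^2. *)
Lemma block_info_upper rho (mu : probability (N.-tuple C) R) : 0 <= rho -> (forall k, nonephemeral (H k)) ->
  block_info H W rho mu <= N%:R * (rho ^+ 2 * (K%:R * \sum_k phi_real k) + 4 / 3 * (rho * t) ^+ 3).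
Proof.
move=> r0 ne; have t0 := total_power_ge0 H.
have x0 : 0 <= rho * t by rewrite mulr_ge0.
apply: (block_info_le HW r0 mu x0) => z z1.
rewrite fade_cov_nsq_sum mulr_sumr -sumrB.
apply: (@le_trans _ _ (\sum_(n < N) (rho ^+ 2 * (K%:R * \sum_k phi_real k) + 4 / 3 * (rho * t) ^+ 3))); last first.
  by rewrite sumr_const card_ord -[leLHS]mulr_natl.
apply: ler_sum => n _.
have hrow := fade_cov_row n z1; have hdef := diagonal_deficit n ne z1.
have ha := fade_cov_diag_le H n z1.
have a0 : 0 <= cRe (fade_cov H z n n).
  by rewrite fade_cov_diag; apply: sumr_ge0 => k _; rewrite mulr_ge0 ?power_ge0 ?nsq_ge0.
have hs : K%:R * (\sum_k phi_real k) = K%:R * (\sum_k phi_real k * nsq (input_at z (n.+1%:Z - k%:Z))) +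
   K%:R * \sum_k phi_real k * (1 - nsq (input_at z (n.+1%:Z - k%:Z))).
  rewrite -mulrDr -big_split /=; congr (_ * _); apply: eq_bigr => k _; ring.
rewrite hs.
have hl := ln1D_le_cubic x0.
move: hrow hdef ha a0 hl x0; clear hs.
set Off := \sum_(m < N | _) _; set X1 := K%:R * _; set X2 := K%:R * _; set a := cRe _.
move=> hrow hdef ha a0 hl x0.
have r2 : 0 <= rho ^+ 2 by exact: sqr_ge0.
have hx : (rho * t) / (1 + rho * t) >= rho * t - (rho * t) ^+ 2.
  by rewrite ler_pdivlMr; [have := exprn_ge0 3 x0; nra|lra].
have h1 : (rho * t - (rho * t) ^+ 2) * (1 + rho * a) <= rho * t / (1 + rho * t) * (1 + rho * a).
  by rewrite ler_wpM2r// addr_ge0// mulr_ge0.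
have h2 : rho * a * (rho * t) ^+ 2 <= (rho * t) ^+ 3.
  by rewrite [leRHS]exprS ler_wpM2r ?sqr_ge0// ler_wpM2l.
have h3 := ler_wpM2l r2 hrow; have h4 := ler_wpM2l r2 hdef.
have e1 : (rho * t - (rho * t) ^+ 2) * (1 + rho * a) = rho * t - (rho * t) ^+ 2 + rho ^+ 2 * (t * a) - rho * a * (rho * t) ^+ 2 by ring.
have e2 : (rho * t) ^+ 2 = rho ^+ 2 * t ^+ 2 by ring.
have e3 : rho ^+ 2 * (t - a) ^+ 2 = rho ^+ 2 * t ^+ 2 - 2 * (rho ^+ 2 * (t * a)) + rho ^+ 2 * a ^+ 2 by ring.
have e4 : rho ^+ 2 / 2 * (a ^+ 2 + 2 * Off) = rho ^+ 2 * a ^+ 2 / 2 + rho ^+ 2 * Off by field.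
rewrite e4 mulrDr; lra.
Qed.

End upper_bound.

(** * Superadditivity and existence of the limit *)

Section admissibility.
Variables (R : realType) (N : nat).
Local Notation C := R[i].
Implicit Types mu : probability (N.-tuple C) R.

Lemma measurable_nsq_gt1 i : measurable [set z : N.-tuple C | 1 < nsq (tnth z i)].
Proof.
have := @measurable_fun_ltr _ _ _ setT (cst 1) (fun z : N.-tuple C => nsq (tnth z i))
  (measurable_cst _) (measurable_fun_nsq (measurable_tnth i)) measurableT [set true].
rewrite setTI (_ : _ @^-1` _ = [set z : N.-tuple C | 1 < nsq (tnth z i)]); first exact.
by apply/seteqP; split.
Qed.

Lemma normc_le1 (x : C) : (Normc.normc x <= 1) = (nsq x <= 1).
Proof.
by rewrite nsq_normc expr_le1// /Normc.normc; case: x => a b; exact: sqrtr_ge0.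
Qed.

(** For beta = 1 the bound on the mean energy follows from the peak constraint, which is restated
    through measurable null sets. *)
Lemma admissible_inputP mu : admissible_input 1 mu <->
  forall i, mu [set z : N.-tuple C | 1 < nsq (tnth z i)] = 0%E.
Proof.
split=> [[h _] i|h].
- have [S [mS S0 HS]] := h i.
  apply/eqP; rewrite eq_le measure_ge0 andbT -S0; apply: le_measure => //.
  + by apply/mem_set; exact: measurable_nsq_gt1.
  + by apply/mem_set.
  + by move=> z /= zi; apply: HS => /=; rewrite normc_le1 leNgt zi.
- have ae1 i : {ae mu, forall z, Normc.normc (tnth z i) <= 1}.
    exists [set z : N.-tuple C | 1 < nsq (tnth z i)]; split => //; first exact: measurable_nsq_gt1.
    by move=> z /= /negP; rewrite normc_le1 -ltNge.
  split=> // i; rewrite invr1 -(integral_prob_cst mu 1).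
  apply: ae_ge0_le_integral => //.
  + by move=> z _; rewrite lee_fin sqr_ge0.
  + under eq_fun do rewrite -nsq_normc.
    by apply/measurable_EFinP; apply: measurable_fun_nsq; exact: measurable_tnth.
  + have [S [mS S0 HS]] := ae1 i; exists S; split => // z /= Hz; apply: HS => /= z1; apply: Hz => _.
    by rewrite lee_fin -nsq_normc -normc_le1.
Qed.

End admissibility.

Section concatenation.
Variables (R : realType) (K N1 N2 : nat).
Local Notation C := R[i].
Local Notation N := (N1 + (K.-1 + N2))%N.
Implicit Types (z : (N1.-tuple C * N2.-tuple C)%type).

(* The [K - 1] zeros in between keep the echoes of the first block out of the second. *)
Definition concat z : N.-tuple C :=
  [tuple (if (i < N1)%N then nth 0 z.1 i
          else if (N1 + K.-1 <= i)%N then nth 0 z.2 (i - (N1 + K.-1)) else 0) | i < N].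

Definition first_block (y : N.-tuple C) : N1.-tuple C := [tuple tnth y (lshift _ i) | i < N1].

Definition second_block (y : N.-tuple C) : N2.-tuple C :=
  [tuple tnth y (rshift N1 (rshift K.-1 i)) | i < N2].

Lemma nth_concat z i : nth 0 (concat z) i = (if (i < N1)%N then nth 0 z.1 i
          else if (N1 + K.-1 <= i)%N then nth 0 z.2 (i - (N1 + K.-1)) else 0).
Proof.
have [iN|Ni] := ltnP i N; first by rewrite -(tnth_nth 0 _ (Ordinal iN)) tnth_mktuple.
rewrite nth_default ?size_tuple//.
case: ltnP => h1; first by rewrite nth_default ?size_tuple//; lia.
by case: ifP => h2 //; rewrite nth_default ?size_tuple//; lia.
Qed.

Lemma first_block_concat z : first_block (concat z) = z.1.
Proof.
apply: eq_from_tnth => i; rewrite tnth_mktuple !(tnth_nth 0) nth_concat /=.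
by rewrite ltn_ord.
Qed.

Lemma second_block_concat z : second_block (concat z) = z.2.
Proof.
apply: eq_from_tnth => i; rewrite tnth_mktuple !(tnth_nth 0) nth_concat /=.
rewrite ifF; last by lia.
by rewrite ifT; [congr nth; lia|lia].
Qed.

Lemma measurable_first_block : measurable_fun [set: N.-tuple C] first_block.
Proof.
apply/measurable_fun_tnthP => i.
have -> : (fun x : N1.-tuple C => tnth x i) \o first_block = (fun y => tnth y (lshift _ i)).
  by apply/funext => y /=; rewrite tnth_mktuple.
exact: measurable_tnth.
Qed.

Lemma measurable_second_block : measurable_fun [set: N.-tuple C] second_block.
Proof.
apply/measurable_fun_tnthP => i.
have -> : (fun x : N2.-tuple C => tnth x i) \o second_block = (fun y => tnth y (rshift N1 (rshift K.-1 i))).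
  by apply/funext => y /=; rewrite tnth_mktuple.
exact: measurable_tnth.
Qed.

Lemma measurable_nth n d (T : measurableType d) (f : T -> n.-tuple C) i :
  measurable_fun [set: T] f -> measurable_fun [set: T] (fun x => nth 0 (f x) i).
Proof.
by move=> mf; exact: (measurable_fun_input_at i.+1%:Z mf).
Qed.

Lemma measurable_concat : measurable_fun [set: N1.-tuple C * N2.-tuple C] concat.
Proof.
apply/measurable_fun_tnthP => i.
have -> : (fun x : N.-tuple C => tnth x i) \o concat = (fun z => nth 0 (concat z) i).
  by apply/funext => y /=; rewrite (tnth_nth 0).
under eq_fun do rewrite nth_concat.
have [_|_] := boolP (i < N1)%N; first by apply: measurable_nth; exact: measurable_fst.
by have [_|_] := boolP (N1 + K.-1 <= i)%N; [apply: measurable_nth; exact: measurable_snd|exact: measurable_cst].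
Qed.

HB.instance Definition _ := isMeasurableFun.Build _ _ _ _ concat measurable_concat.

Lemma clamp_concat z : clamp (concat z) = concat (clamp z.1, clamp z.2).
Proof.
have cl0 : unit_disk_part (0 : C) = 0 by rewrite /unit_disk_part; case: ifP.
have nthc n (x : n.-tuple C) j : nth 0 (clamp x) j = unit_disk_part (nth 0 x j).
  have [jn|nj] := ltnP j n; first by rewrite -(tnth_nth 0 _ (Ordinal jn)) tnth_mktuple (tnth_nth 0).
  by rewrite !nth_default ?size_tuple.
apply: eq_from_tnth => i; rewrite !(tnth_nth 0) nthc !nth_concat !nthc.
by case: ifP => // _; case: ifP.
Qed.

Lemma input_at_concat_first z (m : int) : m <= N1%:Z -> input_at (concat z) m = input_at z.1 m.
Proof.
case: m => [[|j]|j] //= h; rewrite nth_concat ifT//.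
Qed.

Lemma input_at_nat n (x : n.-tuple C) (m : int) :
  input_at x m = if 0 < m then nth 0 x `|m - 1| else 0.
Proof. by case: m => [[|j]|j] //=; rewrite subn1. Qed.

Lemma input_at_concat_second z (m : int) : - (K.-1)%:Z < m ->
  input_at (concat z) ((N1 + K.-1)%N%:Z + m) = input_at z.2 m.
Proof.
move=> h; rewrite !input_at_nat ifT; last by lia.
rewrite nth_concat ifF; last by lia.
case: ifP => m0.
  by rewrite ifT; [congr nth; lia|lia].
by case: ifP => h1 //; lia.
Qed.

End concatenation.

Section superadditivity.
Context d (T : measurableType d) (R : realType) (P : probability T R) (K N1 N2 : nat).
Local Notation C := R[i].
Variables (H : 'I_K -> int -> {RV P >-> C}) (W : int -> {RV P >-> C}).
Hypothesis HW : rayleigh_channel H W.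
Variable rho : R.
Hypothesis rho0 : 0 <= rho.
Local Notation N := (N1 + (K.-1 + N2))%N.
Variables (mu1 : probability (N1.-tuple C) R) (mu2 : probability (N2.-tuple C) R).
Hypotheses (adm1 : admissible_input 1 mu1) (adm2 : admissible_input 1 mu2).

Local Notation mu12 := (mu1 \x mu2)%E.

Definition concat_input : probability (N.-tuple C) R := distribution mu12 (@concat R K N1 N2).

Lemma concat_admissible : admissible_input 1 concat_input.
Proof.
apply/admissible_inputP => i.
have [lt1|ge1] := ltnP i N1.
- have /admissible_inputP/(_ (Ordinal lt1)) h := adm1.
  transitivity (mu12 ([set z | 1 < nsq (tnth z (Ordinal lt1))] `*` [set: N2.-tuple C])).
    congr (mu12 _); apply/seteqP; split => z /=; rewrite !(tnth_nth 0) nth_concat lt1 //.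
    by case.
  transitivity (mu1 [set z | (1 < nsq (tnth z (Ordinal lt1)))%R] * mu2 [set: N2.-tuple C])%E.
    by apply: product_measure1E => //; exact: measurable_nsq_gt1.
  by rewrite h mul0e.
- have [ge2|lt2] := leqP (N1 + K.-1)%N i.
  + have i2 : (i - (N1 + K.-1) < N2)%N by have := ltn_ord i; lia.
    have /admissible_inputP/(_ (Ordinal i2)) h := adm2.
    transitivity (mu12 ([set: N1.-tuple C] `*` [set z | 1 < nsq (tnth z (Ordinal i2))])).
      congr (mu12 _); apply/seteqP; split => z /=; rewrite !(tnth_nth 0) nth_concat ltnNge ge1 ge2 //.
      by case.
    transitivity (mu1 [set: N1.-tuple C] * mu2 [set z | (1 < nsq (tnth z (Ordinal i2)))%R])%E.
      by apply: product_measure1E => //; exact: measurable_nsq_gt1.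
    by rewrite h mule0.
  + transitivity (mu12 set0); last exact: measure0.
    congr (mu12 _); apply/seteqP; split => z //=; rewrite (tnth_nth 0) nth_concat ltnNge ge1 leqNgt lt2 /=.
    by rewrite /nsq /= expr0n /= addr0 ltr10.
Qed.

Lemma first_block_out (z : N1.-tuple C * N2.-tuple C) w :
  first_block (channel_out H W 0 rho (clamp (concat K z)) w) = channel_out H W 0 rho (clamp z.1) w.
Proof.
apply: eq_from_tnth => i; rewrite clamp_concat !tnth_mktuple /channel_output /fade /=.
congr (_ * _ + _); apply: eq_bigr => k _; rewrite input_at_concat_first//.
by have := ltn_ord i; lia.
Qed.

Lemma second_block_out (z : N1.-tuple C * N2.-tuple C) w :
  second_block (channel_out H W 0 rho (clamp (concat K z)) w) =
  channel_out H W (N1 + K.-1)%N%:Z rho (clamp z.2) w.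
Proof.
apply: eq_from_tnth => i; rewrite clamp_concat !tnth_mktuple /channel_output /fade /=.
have -> : 0 + (N1 + (K.-1 + i)).+1%:Z = (N1 + K.-1)%N%:Z + i.+1%:Z by lia.
congr (_ * _ + _); apply: eq_bigr => k _; congr (_ * _).
rewrite -(@input_at_concat_second R K N1 N2 (clamp z.1, clamp z.2)); last by have := ltn_ord k; lia.
by congr input_at; lia.
Qed.

Local Notation V := (@block_output d T R P K _ H W rho).
Local Notation q := (@block_density d T R P K _ H rho).
Local Notation id1 := (information_density mu1 q).
Local Notation id2 := (information_density mu2 q).

Let mV n : measurable_fun [set: n.-tuple C * T] V := @measurable_block_output _ _ _ _ _ _ H W rho.
Let mu12T (g1 : N1.-tuple C -> \bar R) (g2 : N2.-tuple C -> \bar R) :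
  measurable_fun setT g1 -> measurable_fun setT g2 -> (forall z, 0 <= g1 z)%E -> (forall z, 0 <= g2 z)%E ->
  (\int[mu12]_z g1 z.1 = \int[mu1]_z g1 z /\ \int[mu12]_z g2 z.2 = \int[mu2]_z g2 z)%E.
Proof.
move=> m1 m2 p1 p2; split.
- rewrite fubini_tonelli1//; last exact: measurableT_comp m1 measurable_fst.
  apply: eq_integral => z _; rewrite /fubini_F /= integral_cst//=.
  by rewrite [X in (_ * X)%E](@probability_setT _ _ _ mu2) mule1.
- rewrite fubini_tonelli2//; last exact: measurableT_comp m2 measurable_snd.
  apply: eq_integral => z _; rewrite /fubini_G /= integral_cst//=.
  by rewrite [X in (_ * X)%E](@probability_setT _ _ _ mu1) mule1.
Qed.

Let first_map (u : N.-tuple C * T) := (first_block u.1, first_block (V u)).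
Let second_map (u : N.-tuple C * T) := (second_block u.1, second_block (V u)).

Let mfirst : measurable_fun [set: N.-tuple C * T] first_map.
Proof.
apply: measurable_fun_pair; last exact: (measurableT_comp (@measurable_first_block R K N1 N2) (@mV N)).
exact: (measurableT_comp (@measurable_first_block R K N1 N2) measurable_fst).
Qed.

Let msecond : measurable_fun [set: N.-tuple C * T] second_map.
Proof.
apply: measurable_fun_pair; last exact: (measurableT_comp (@measurable_second_block R K N1 N2) (@mV N)).
exact: (measurableT_comp (@measurable_second_block R K N1 N2) measurable_fst).
Qed.

Let mtr n : measurable_fun [set: n.-tuple C * T] (transmission V).
Proof. exact: (measurable_transmission (@mV n)). Qed.

Let integral_concat_input (f : N.-tuple C -> \bar R) : measurable_fun setT f -> (forall z, 0 <= f z)%E ->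
  (\int[concat_input]_z f z = \int[mu12]_z f (concat K z))%E.
Proof. by move=> mf f0; rewrite ge0_integral_pushforward// preimage_setT. Qed.

Let concat_integral (g : N.-tuple C * T -> R) : measurable_fun setT g -> (forall u, 0 <= g u) ->
  (\int[(concat_input \x P)%E]_u (g u)%:E = \int[mu12]_z \int[P]_w (g (concat K z, w))%:E)%E.
Proof.
move=> mg g0; rewrite (tonelli12 _ _ mg g0).
rewrite integral_concat_input//; first exact: (measurable_integral_right P mg).
by move=> z; apply: integral_ge0 => w _; rewrite lee_fin.
Qed.

Let section_integral_ge0 n (g : n.-tuple C * T -> R) : (forall u, 0 <= g u) ->
  forall z, (0 <= \int[P]_w (g (z, w))%:E)%E.
Proof. by move=> g0 z; apply: integral_ge0 => w _; rewrite lee_fin. Qed.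

Lemma first_block_law : same_law (concat_input \x P)%E (mu1 \x P)%E first_map (transmission V).
Proof.
apply: (same_law_of_ge0 mfirst (@mtr N1)) => f mf f0.
rewrite (concat_integral (measurableT_comp mf mfirst) (fun u => f0 _)).
have m1 := measurableT_comp mf (@mtr N1).
rewrite (tonelli12 mu1 P m1 (fun u => f0 _)).
have [<- _] := mu12T (measurable_integral_right P m1 (fun u => f0 _)) (measurable_cst 0%E)
  (section_integral_ge0 (fun u => f0 _)) (fun=> lexx _).
apply: eq_integral => z _; apply: eq_integral => w _ /=.
by rewrite /first_map /= first_block_concat /block_output /= first_block_out.
Qed.

(** The second block sees the fading and the noise with offset N1 + K - 1. Applying [density_change]
    at this offset and at 0 removes the offset. *)
Lemma second_block_law : same_law (concat_input \x P)%E (mu2 \x P)%E second_map (transmission V).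
Proof.
apply: (same_law_of_ge0 msecond (@mtr N2)) => f mf f0.
rewrite (concat_integral (measurableT_comp mf msecond) (fun u => f0 _)).
have m2 := measurableT_comp mf (@mtr N2).
rewrite (tonelli12 mu2 P m2 (fun u => f0 _)).
have [_ <-] := mu12T (measurable_cst 0%E) (measurable_integral_right P m2 (fun u => f0 _))
  (fun=> lexx _) (section_integral_ge0 (fun u => f0 _)).
apply: eq_integral => z _.
have mfz : measurable_fun setT (fun y => f (z.2, y)) by exact: (measurable_section_right mf).
have h1 := density_change HW (N1 + K.-1)%N%:Z (clamp z.2) rho0 mfz (fun=> f0 _).
have h2 := density_change HW 0 (clamp z.2) rho0 mfz (fun=> f0 _).
rewrite /transmission /block_output /=; rewrite h2 -h1; apply: eq_integral => w _ /=.
by rewrite /second_map /= second_block_concat /block_output /= second_block_out.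
Qed.

Lemma energy_first_second (y : N.-tuple C) : energy (first_block y) + energy (second_block y) <= energy y.
Proof.
rewrite /energy big_split_ord /= lerD//.
  by apply: ler_sum => i _; rewrite tnth_mktuple.
rewrite big_split_ord /= -[leLHS]add0r lerD//.
  by apply: sumr_ge0 => i _; exact: nsq_ge0.
by apply: ler_sum => i _; rewrite tnth_mktuple.
Qed.

Let A n := rho * (n%:R * total_power H).
Let A0 n : 0 <= A n. Proof. exact: block_A0. Qed.
Let md n : measurable_fun [set: n.-tuple C * n.-tuple C] q := @measurable_block_density _ _ _ _ _ n H rho.
Let d0 n (u : n.-tuple C * n.-tuple C) : 0 < q u := block_density_gt0 HW rho0 u.
Let bd n (z y : n.-tuple C) : - A n <= ln (q (z, y)) <= energy y := block_density_bounds HW rho0 z y.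
Let m1 : measurable_fun setT id1 := measurable_information_density mu1 (@md N1) (@d0 N1).
Let m2 : measurable_fun setT id2 := measurable_information_density mu2 (@md N2) (@d0 N2).
Let b1 := information_density_dominated mu1 (@md N1) (@d0 N1) (@energy_ge0 R N1) (A0 N1) (@bd N1).
Let b2 := information_density_dominated mu2 (@md N2) (@d0 N2) (@energy_ge0 R N2) (A0 N2) (@bd N2).

(** The product of the two joint-to-product densities, one per block. For a fixed output its mean
    over the independent inputs is 1, so it is a test function of zero cost. *)
Let joint_density (u : N.-tuple C * N.-tuple C) : R :=
  expR (id1 (first_block u.1, first_block u.2) + id2 (second_block u.1, second_block u.2)).

Let mpair1 : measurable_fun [set: N.-tuple C * N.-tuple C] (fun u => (first_block u.1, first_block u.2)).
Proof.
apply: measurable_fun_pair; apply: (measurableT_comp (@measurable_first_block R K N1 N2)).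
  exact: measurable_fst.
exact: measurable_snd.
Qed.

Let mpair2 : measurable_fun [set: N.-tuple C * N.-tuple C] (fun u => (second_block u.1, second_block u.2)).
Proof.
apply: measurable_fun_pair; apply: (measurableT_comp (@measurable_second_block R K N1 N2)).
  exact: measurable_fst.
exact: measurable_snd.
Qed.

Let mjoint : measurable_fun [set: N.-tuple C * N.-tuple C] joint_density.
Proof.
apply: (measurableT_comp (@measurable_expR R)).
apply: measurable_funD; [exact: measurableT_comp m1 mpair1|exact: measurableT_comp m2 mpair2].
Qed.

Let joint_dominated z y : `|ln (joint_density (z, y))| <=
  ((2 * A N1 + 2) + (2 * A N2 + 2)) * (1 + energy y).
Proof.
rewrite expRK /=; apply: le_trans (ler_normD _ _) _.
have := b1 (first_block z) (first_block y); have := b2 (second_block z) (second_block y).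
have := energy_first_second y; have := energy_ge0 (first_block y); have := energy_ge0 (second_block y).
have := A0 N1; have := A0 N2.
set e := energy y; set e1 := energy (first_block y); set e2 := energy (second_block y).
set x1 := `| _ |; set x2 := `| _ |; set a1 := A N1; set a2 := A N2.
move=> a20 a10 e20 e10 ee hx2 hx1.
have h1 : (2 * a1 + 2) * (1 + e1) <= (2 * a1 + 2) * (1 + e) by rewrite ler_wpM2l; lra.
have h2 : (2 * a2 + 2) * (1 + e2) <= (2 * a2 + 2) * (1 + e) by rewrite ler_wpM2l; lra.
rewrite mulrDl; lra.
Qed.

Let joint_mean y : (\int[concat_input]_z (joint_density (z, y))%:E <= 1%:E)%E.
Proof.
have mjy : measurable_fun setT (fun z => joint_density (z, y)) by exact: measurable_section_left.
rewrite integral_concat_input; last 2 first.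
- exact/measurable_EFinP.
- by move=> z; rewrite lee_fin expR_ge0.
pose F (z : N1.-tuple C * N2.-tuple C) := expR (id1 (z.1, first_block y)) * expR (id2 (z.2, second_block y)).
have mF : measurable_fun setT F.
  apply: measurable_funM; apply: (measurableT_comp (@measurable_expR R)).
    exact: (measurableT_comp (measurable_section_left m1 (first_block y)) measurable_fst).
  exact: (measurableT_comp (measurable_section_left m2 (second_block y)) measurable_snd).
have F0 u : 0 <= F u by rewrite mulr_ge0 ?expR_ge0.
have -> : (\int[mu12]_z (joint_density (concat K z, y))%:E = \int[mu12]_z (F z)%:E)%E.
  apply: eq_integral => z _; congr EFin.
  by rewrite /joint_density /= first_block_concat second_block_concat expRD.
rewrite (tonelli12 mu1 mu2 mF F0).
under eq_integral => z _.
  rewrite /F /=; under eq_integral do rewrite EFinM.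
  rewrite ge0_integralZl//; last first.
  - apply/measurable_EFinP; apply: (measurableT_comp (@measurable_expR R)).
    exact: (measurable_section_left m2 (second_block y)).
  rewrite (information_density_mean mu2 (@md N2) (@d0 N2) (@bd N2)) mule1.
  over.
by rewrite /= (information_density_mean mu1 (@md N1) (@d0 N1) (@bd N1)).
Qed.

(** The variational bound with [joint_density] as test function. The two block outputs may well be
    dependent through the memory of the fading; only the law of each block with its own input
    enters. The outputs in the guard interval are ignored by the test function. *)
Lemma block_info_superadditive : block_info H W rho mu1 + block_info H W rho mu2 <= block_info H W rho concat_input.
Proof.
have eta1 : (\int[(concat_input \x P)%E]_u (1 : R)%:E <= (1 + 0)%:E)%E.
  by rewrite integral_prob_cst addr0.
have := @information_ge _ _ _ _ _ _ _ concat_input P _ _ _ _ _ _ (@mV N) (@measurable_noise _ _ _ _ N W)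
  (@md N) (@measurable_energy R N) (@d0 N) (@energy_ge0 R N) (@block_law _ _ _ _ _ N _ _ HW _ rho0) (A0 N) (@bd N)
  (@block_growth _ _ _ _ _ N _ _ HW _ rho0) joint_density (fun=> 1) _ 0 mjoint (fun u => expR_gt0 _)
  joint_dominated (measurable_cst _) (fun=> ler01) joint_mean eta1.
rewrite subr0; apply: le_trans.
have i1 := @rintegrable_dominated _ _ _ _ _ _ _ mu1 P _ _ _ (@mV N1) (@measurable_energy R N1) (@energy_ge0 R N1) (@block_growth _ _ _ _ _ N1 _ _ HW _ rho0) _ _ m1 b1.
have i2 := @rintegrable_dominated _ _ _ _ _ _ _ mu2 P _ _ _ (@mV N2) (@measurable_energy R N2) (@energy_ge0 R N2) (@block_growth _ _ _ _ _ N2 _ _ HW _ rho0) _ _ m2 b2.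
have j1 := same_law_rintegrable mfirst (@mtr N1) first_block_law m1 i1.
have j2 := same_law_rintegrable msecond (@mtr N2) second_block_law m2 i2.
have e1 := same_law_Rintegral first_block_law mfirst (@mtr N1) m1.
have e2 := same_law_Rintegral second_block_law msecond (@mtr N2) m2.
rewrite /block_info /information -e1 -e2 -RintegralD//.
by under [leRHS]eq_Rintegral do rewrite expRK.
Qed.

End superadditivity.

(** * Fekete's lemma with gaps, and the capacity as a limit *)

Section fekete.
Variables (R : realType) (k : nat) (a : nat -> R) (B : R).
Hypothesis a0 : forall n, 0 <= a n.
Hypothesis aB : forall n, a n <= n%:R * B.
Hypothesis aS : forall m n, a m + a n <= a (m + (k + n))%N.

Lemma superadditive_iter m r j : j%:R * a m <= a (r + j * (m + k))%N.
Proof.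
elim: j => [|j IH]; first by rewrite mul0r mul0n addn0.
rewrite -natr1 mulrDl mul1r.
have := aS (r + j * (m + k))%N m; rewrite (_ : (_ + (k + m))%N = (r + j.+1 * (m + k))%N); last by lia.
by apply: le_trans; rewrite lerD2r.
Qed.

Let rate := [set a m / (m + k)%:R | m in [set m | (0 < m)%N]].

Let B0 : 0 <= B. Proof. by have := le_trans (a0 1) (aB 1); rewrite mul1r. Qed.

Let rate_le m : a m / (m + k)%:R <= B.
Proof.
have [->|m0] := posnP (m + k)%N; first by rewrite invr0 mulr0.
rewrite ler_pdivrMr ?ltr0n//; apply: le_trans (aB m) _.
by rewrite mulrC ler_wpM2l// ler_nat leq_addr.
Qed.

Let rate_sup : has_sup rate.
Proof.
split; first by exists (a 1 / (1 + k)%:R), 1%N.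
by exists B => _ [m _ <-]; exact: rate_le.
Qed.

(** The limit is the supremum of a_m / (m + k): repeating a block of length m costs m + k symbols
    each time. The last clause turns every single block into a lower bound for the limit. *)
Lemma fekete : exists L : R, [/\ (fun n : nat => n%:R^-1 * a n) @ \oo --> L, L <= B &
  forall m, a m <= (m + k)%:R * L].
Proof.
pose L := sup rate.
have Lub m : (0 < m)%N -> a m / (m + k)%:R <= L.
  by move=> m0; apply: ub_le_sup; [case: rate_sup|exists m].
have L0 : 0 <= L by apply: le_trans (Lub 1%N isT); rewrite divr_ge0.
have LB : L <= B by apply: ge_sup; [case: rate_sup|move=> _ [m _ <-]; exact: rate_le].
have Lm m : a m <= (m + k)%:R * L.
  have [->|m0] := posnP m.
    by apply: le_trans (aB 0) _; rewrite mul0r mulr_ge0.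
  by rewrite mulrC -ler_pdivrMr ?Lub// ltr0n addn_gt0 m0.
exists L; split=> //.
apply/cvgrPdist_le => e e0.
have e2 : 0 < e / 2 by lra.
have [_ [m m0 <-] hm] := sup_adherent e2 rate_sup.
have D0 : 0 < (m + k)%:R :> R by rewrite ltr0n addn_gt0 m0.
near=> n.
have n0 : 0 < n%:R :> R by rewrite ltr0n; near: n; exact: nbhs_infty_gt.
have h1 : k%:R * B <= e * n%:R.
  rewrite mulrC -ler_pdivrMl// mulrC; apply: ltW; near: n; exact: nbhs_infty_gtr.
have h2 : a m <= e / 2 * n%:R.
  by rewrite -ler_pdivrMl//; apply: ltW; near: n; exact: nbhs_infty_gtr.
have up : n%:R^-1 * a n <= L + e.
  rewrite mulrC ler_pdivrMr//; apply: le_trans (Lm n) _.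
  rewrite natrD mulrDl mulrDl (mulrC L) lerD2l; apply: le_trans h1.
  by rewrite ler_wpM2l.
have dn : L - e <= n%:R^-1 * a n.
  rewrite [leRHS]mulrC ler_pdivlMr//.
  (* Euclidean division of n by m + k; the block formed by the remainder contributes a nonnegative
     amount. *)
  have := superadditive_iter m (n %% (m + k)) (n %/ (m + k)).
  rewrite (addnC (n %% _)%N) -divn_eq; apply: le_trans.
  have j1 : n%:R <= ((n %/ (m + k))%:R + 1) * (m + k)%:R :> R.
    by rewrite natr1 -natrM ler_nat ltnW// ltn_ceil// addn_gt0 m0.
  have j2 : (L - e / 2) * (m + k)%:R <= a m by rewrite -ler_pdivlMr// ltW.
  have j3 : n%:R / (m + k)%:R <= (n %/ (m + k))%:R + 1 :> R by rewrite ler_pdivrMr.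
  have j4 : n%:R / (m + k)%:R * a m <= ((n %/ (m + k))%:R + 1) * a m by rewrite ler_wpM2r.
  have j5 : (L - e / 2) * n%:R <= n%:R / (m + k)%:R * a m.
    rewrite mulrAC ler_pdivlMr// mulrAC (mulrC n%:R) ler_wpM2r//.
  lra.
by rewrite ler_norml; apply/andP; split; lra.
Unshelve. all: end_near. Qed.

End fekete.

Section capacity.
Context d (T : measurableType d) (R : realType) (P : probability T R) (K : nat).
Local Notation C := R[i].
Variables (H : 'I_K -> int -> {RV P >-> C}) (W : int -> {RV P >-> C}).
Hypothesis HW : rayleigh_channel H W.
Hypothesis phi_fin : forall k, (phi (H k) < +oo)%E.
Hypothesis ne : forall k, nonephemeral (H k).
Variable rho : R.
Hypothesis rho0 : 0 <= rho.

Definition capacity_bound : R :=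
  rho ^+ 2 * (K%:R * \sum_k phi_real H k) + 4 / 3 * (rho * total_power H) ^+ 3.

Local Notation cap N := (max_block_information H W N rho 1).

Lemma block_information_le_max N (mu : probability (N.-tuple C) R) : admissible_input 1 mu ->
  ((block_info H W rho mu)%:E <= cap N)%E.
Proof.
move=> adm; apply: ereal_sup_ubound; exists mu => //.
by apply: block_informationE => //; case: adm.
Qed.

Lemma max_block_information_le N (B : \bar R) :
  (forall mu : probability (N.-tuple C) R, admissible_input 1 mu -> ((block_info H W rho mu)%:E <= B)%E) ->
  (cap N <= B)%E.
Proof.
move=> h; apply: ub_ereal_sup => _ [mu adm <-].
by rewrite (block_informationE HW rho0) ?h//; case: adm.
Qed.

(** The variational bound with the constant test function 1. *)
Lemma block_info_ge0 N (mu : probability (N.-tuple C) R) : 0 <= block_info H W rho mu.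
Proof.
have h1 (y : N.-tuple C) : (\int[mu]_z (1 : R)%:E <= 1%:E)%E by rewrite integral_prob_cst.
have h2 : (\int[(mu \x P)%E]_u (1 : R)%:E <= (1 + 0)%:E)%E by rewrite integral_prob_cst addr0.
have h3 (z y : N.-tuple C) : `|ln (1 : R)| <= 0 * (1 + energy y) by rewrite ln1 normr0 mul0r.
have := @information_ge _ _ _ _ _ _ _ mu P _ _ _ _ _ _ (@measurable_block_output _ _ _ _ _ _ H W rho) (@measurable_noise _ _ _ _ N W)
  (@measurable_block_density _ _ _ _ _ N H rho) (@measurable_energy R N) (block_density_gt0 HW rho0) (@energy_ge0 R N)
  (@block_law _ _ _ _ _ N _ _ HW _ rho0) (block_A0 N H rho0) (block_density_bounds HW rho0)
  (@block_growth _ _ _ _ _ N _ _ HW _ rho0) (fun=> 1) (fun=> 1) _ 0 (measurable_cst _) (fun=> ltr01) h3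
  (measurable_cst _) (fun=> ler01) h1 h2.
by rewrite subr0 ln1 Rintegral_prob_cst.
Qed.

(** Zero input: it makes the set of admissible laws nonempty, so that the supremum is nonnegative
    and, with the upper bound, finite. *)
Lemma dirac_admissible N : admissible_input 1 (\d_([tuple 0 | i < N] : N.-tuple C) : probability (N.-tuple C) R).
Proof.
apply/admissible_inputP => i.
have : dirac ([tuple 0 | i < N] : N.-tuple C) [set z : N.-tuple C | 1 < nsq (tnth z i)] = 0%E :> \bar R.
  rewrite diracE memNset//= tnth_mktuple.
  by rewrite /nsq /= expr0n /= addr0 ltNge ler01.
exact.
Qed.

(** The upper bound on block informations provides the linear growth required by Fekete's lemma, so
    it serves both for the existence of the limit and for its size. *)
Lemma capacity_limit : exists L : R, [/\ C_ds H W rho 1 = L%:E, L <= capacity_bound &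
  forall N (mu : probability (N.-tuple C) R), admissible_input 1 mu ->
  block_info H W rho mu <= (N + K.-1)%:R * L].
Proof.
pose a N := fine (cap N).
have c0 N : (0 <= cap N)%E.
  by apply: le_trans (block_information_le_max (dirac_admissible N)); rewrite lee_fin block_info_ge0.
have cB N : (cap N <= (N%:R * capacity_bound)%:E)%E.
  by apply: max_block_information_le => mu adm; rewrite lee_fin; exact: (block_info_upper HW phi_fin mu rho0 ne).
have cE N : cap N = (a N)%:E.
  by rewrite fineK// ge0_fin_numE// (le_lt_trans (cB N))// ltry.
have aI N (mu : probability (N.-tuple C) R) : admissible_input 1 mu -> block_info H W rho mu <= a N.
  by move=> adm; rewrite -lee_fin -cE; exact: block_information_le_max.
have aS m n : a m + a n <= a (m + (K.-1 + n))%N.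
  rewrite -lerBrDr -lee_fin -cE; apply: max_block_information_le => mu1 adm1.
  rewrite lee_fin lerBrDl -lerBrDr -lee_fin -cE; apply: max_block_information_le => mu2 adm2.
  rewrite lee_fin lerBrDl; apply: le_trans (block_info_superadditive HW rho0 mu1 mu2) _.
  by apply: aI; exact: concat_admissible.
have a0 n : 0 <= a n by rewrite -lee_fin -cE.
have aB n : a n <= n%:R * capacity_bound by rewrite -lee_fin -cE.
have [L [cL LB Lm]] := fekete a0 aB aS.
exists L; split => //.
- rewrite /C_ds; apply/cvg_lim => //.
  have -> : (fun N => (N%:R^-1)%:E * cap N)%E = EFin \o (fun N => N%:R^-1 * a N).
    by apply/funext => N /=; rewrite cE EFinM.
  by apply: cvg_EFin => //; exact: nearW.
- by move=> N mu adm; apply: le_trans (aI _ _ adm) (Lm N).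
Qed.

End capacity.

(** * Lower bound: phase inputs *)

Section fourth_moment.
Variable R : realType.

Let ipow n : (n <= 6)%N -> rintegrable (gauss R) (fun x => x ^+ n) := @rintegrable_gauss_pow R n.

Lemma gauss_cube : \int[gauss R]_x (x ^+ 3) = 0.
Proof.
have m3 : measurable_fun [set: measurableTypeR R] (fun x : measurableTypeR R => x ^+ 3 : R) by exact: measurable_funX.
have mo : measurable_fun [set: measurableTypeR R] (fun x : measurableTypeR R => - x : R).
  exact: (@oppr_measurable R setT).
have := same_law_Rintegral (@gauss_opp R) mo (@measurable_id _ _ _) m3.
under eq_Rintegral do rewrite exprNn -signr_odd /= expr1 mulN1r.
by rewrite RintegralN => /eqP; rewrite -subr_eq0 -opprD oppr_eq0 -mulr2n mulrn_eq0 => /eqP.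
Qed.

(** For independent x and y, x + y has the law of sqrt 2 x. Expanding the fourth power gives 2 m + 6
    = 4 m for the moment m. *)
Lemma gauss_fourth : \int[gauss R]_x (x ^+ 4) = 3.
Proof.
have f0 (x : R) : 0 <= x ^+ 4 by rewrite -[4%N]/(2 * 2)%N exprM sqr_ge0.
have mf : measurable_fun [set: R] (fun x => x ^+ 4) by exact: measurable_funX.
have := @gauss_rotation R _ 1 1 ler01 ler01 mf f0.
have i1 := ipow (n := 1) isT; have i2 := ipow (n := 2) isT; have i3 := ipow (n := 3) isT; have i4 := ipow (n := 4) isT.
have inner (y : R) : (\int[gauss R]_x ((1 * x + 1 * y) ^+ 4)%:E)%E =
    (\int[gauss R]_x (x ^+ 4) + (6 * y ^+ 2 + y ^+ 4))%:E.
  have E x : (1 * x + 1 * y) ^+ 4 = x ^+ 4 + (4 * y * x ^+ 3 + (6 * y ^+ 2 * x ^+ 2 + (4 * y ^+ 3 * x ^+ 1 + y ^+ 4))) by ring.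
  under eq_integral do rewrite E.
  have j1 : rintegrable (gauss R) (fun x => 4 * y ^+ 3 * x ^+ 1 + y ^+ 4) by apply: rintegrableD; [exact: rintegrableZ|exact: rintegrable_gauss_cst].
  have j2 : rintegrable (gauss R) (fun x => 6 * y ^+ 2 * x ^+ 2 + (4 * y ^+ 3 * x ^+ 1 + y ^+ 4)) by apply: rintegrableD => //; exact: rintegrableZ.
  have j3 : rintegrable (gauss R) (fun x => 4 * y * x ^+ 3 + (6 * y ^+ 2 * x ^+ 2 + (4 * y ^+ 3 * x ^+ 1 + y ^+ 4))) by apply: rintegrableD => //; exact: rintegrableZ.
  rewrite rintegralE; last exact: rintegrableD.
  congr EFin; rewrite RintegralD//; congr (_ + _).
  rewrite RintegralD//; last exact: rintegrableZ.
  rewrite RintegralD//; last exact: rintegrableZ.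
  rewrite RintegralD//; [|exact: rintegrableZ|exact: rintegrable_gauss_cst].
  have EZ c n : (n <= 6)%N -> \int[gauss R]_x (c * x ^+ n) = c * \int[gauss R]_x (x ^+ n).
    by move=> n6; rewrite RintegralZl//; exact: ipow.
  rewrite !EZ// gauss_cube gauss_square gauss_cst.
  have -> : \int[gauss R]_x (x ^+ 1) = 0 by exact: gauss_mean.
  ring.
under eq_integral do rewrite inner.
have j : rintegrable (gauss R) (fun y => 6 * y ^+ 2 + y ^+ 4) by apply: rintegrableD => //; exact: rintegrableZ.
rewrite rintegralE; last by apply: rintegrableD => //; exact: rintegrable_gauss_cst.
have -> : (\int[gauss R]_x ((Num.sqrt (1 ^+ 2 + 1 ^+ 2) * x) ^+ 4)%:E = (4 * \int[gauss R]_x (x ^+ 4))%:E)%E.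
  under eq_integral do rewrite exprMn -[4%N]/(2 * 2)%N exprM sqr_sqrtr ?addr_ge0 ?sqr_ge0//.
  rewrite rintegralE; last exact: rintegrableZ.
  by rewrite RintegralZl//; congr EFin; rewrite expr1n; congr (_ * _); ring.
move=> [].
rewrite RintegralD//; last exact: rintegrable_gauss_cst.
rewrite RintegralD//; last exact: rintegrableZ.
rewrite RintegralZl// gauss_square gauss_cst.
set m := \int[_]_x _; lra.
Qed.

Lemma centered_gaussian_fourth d (T : measurableType d) (P : probability T R) U v :
  centered_gaussian P U v -> \int[P]_w (U w ^+ 4) = 3 * v ^+ 2.
Proof.
move=> [v0 mU UL].
have ms : measurable_fun [set: measurableTypeR R] (fun x : measurableTypeR R => Num.sqrt v * x : R) by exact: measurable_funM.
have := same_law_Rintegral UL mU ms (measurable_funX 4 (@measurable_id _ _ _)) => ->.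
under eq_Rintegral do rewrite exprMn.
rewrite RintegralZl//; last exact: (ipow (n := 4)).
by rewrite gauss_fourth -[4%N]/(2 * 2)%N exprM sqr_sqrtr// mulrC.
Qed.

End fourth_moment.

(** * Quadratic forms of proper normal vectors *)

Section quadratic_forms.
Context d (T : measurableType d) (R : realType) (P : probability T R) (N : nat).
Local Notation C := R[i].
Local Notation cRe := complex.Re.

Definition quadratic_form (G : 'I_N -> 'I_N -> C) (y : 'I_N -> C) : R :=
  cRe (\sum_m \sum_n conjc (y m) * y n * G m n).

Definition total_nsq (G : 'I_N -> 'I_N -> C) : R := \sum_m \sum_n nsq (G m n).

Lemma total_nsq_ge0 G : 0 <= total_nsq G.
Proof. by apply: sumr_ge0 => m _; apply: sumr_ge0 => n _; exact: nsq_ge0. Qed.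

Variable G : 'I_N -> 'I_N -> C.
Hypothesis herm : forall m n, G n m = conjc (G m n).

(** Each eigenvalue satisfies |l| <= 1 + l^2. The constant is crude, but the block length is fixed
    when rho tends to 0. *)
Lemma quadratic_form_le y : `|quadratic_form G y| <= (1 + total_nsq G) * \sum_n nsq (y n).
Proof.
have [p [l [pp pp' pG]]] := hermitian_spectral herm.
rewrite /quadratic_form (quadratic_form_rotate pG) cRe_sum /= -(sum_nsq_rotate pp') mulr_sumr.
apply: le_trans (ler_norm_sum _ _ _) _; apply: ler_sum => j _.
rewrite normrM (ger0_norm (nsq_ge0 _)) ler_wpM2r ?nsq_ge0//.
have : l j ^+ 2 <= total_nsq G.
  by rewrite /total_nsq (diagonalized_nsq pp pp' pG) (bigD1 j)//= lerDl; apply: sumr_ge0 => i _; exact: sqr_ge0.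
have := sqr_ge0 (`|l j| - 1); rewrite sqrrB1 real_normK ?num_real//.
have := normr_ge0 (l j).
set a := `|_|; set b := _ ^+ 2; lra.
Qed.

Lemma proper_gaussian_sum (X : 'I_N -> T -> C) S (a : 'I_N -> C) : proper_gaussian P X S ->
  rintegrable P (fun w => nsq (\sum_m a m * X m w)) /\
  \int[P]_w nsq (\sum_m a m * X m w) = cRe (\sum_m \sum_n a m * conjc (a n) * S m n).
Proof.
move=> GX.
have GY : proper_gaussian P (fun (_ : 'I_1) w => \sum_m a m * X m w)
    (fun _ _ => \sum_m \sum_n a m * conjc (a n) * S m n).
  move=> e; have := GX (fun m => e ord0 * conjc (a m)); congr centered_gaussian.
    apply/funext => w; rewrite big_ord1 rdot_sumr; apply: eq_bigr => m _.
    by rewrite (mulrC (a m)) rdotMr.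
  rewrite !big_ord1; congr (cRe _ / _); rewrite mulr_sumr; apply: eq_bigr => m _.
  rewrite mulr_sumr; apply: eq_bigr => n _.
  by rewrite rmorphM /= conjcK; ring.
exact: (proper_gaussian_nsq ord0 GY).
Qed.

Lemma quadratic_form_mean (X : 'I_N -> T -> C) S : proper_gaussian P X S ->
  rintegrable P (fun w => quadratic_form G (X^~ w)) /\
  \int[P]_w quadratic_form G (X^~ w) = cRe (\sum_m \sum_n S m n * conjc (G m n)).
Proof.
move=> GX; have [p [l [pp pp' pG]]] := hermitian_spectral herm.
have E w : quadratic_form G (X^~ w) = \sum_j l j * nsq (\sum_m p j m * X m w).
  by rewrite /quadratic_form (quadratic_form_rotate pG) cRe_sum.
have ij j := proper_gaussian_sum (p j) GX.
have iij j : rintegrable P (fun w => l j * nsq (\sum_m p j m * X m w)) by apply: rintegrableZ; exact: (ij j).1.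
split.
  apply: rintegrable_eq (fun w => esym (E w)) _.
  by apply: rintegrable_sum => //; exact: rintegrable_cst.
under eq_Rintegral do rewrite E.
rewrite rintegral_sum//.
transitivity (\sum_j cRe ((l j)%:C%C * \sum_m \sum_n p j m * conjc (p j n) * S m n)).
  apply: eq_bigr => j _; rewrite RintegralZl//; last exact: (ij j).1.
  by rewrite (ij j).2; case: (\sum_m _) => u v /=; ring.
rewrite -cRe_sum; congr cRe.
under eq_bigr do rewrite mulr_sumr.
rewrite exchange_big; apply: eq_bigr => m _ /=.
under eq_bigr do rewrite mulr_sumr.
rewrite exchange_big; apply: eq_bigr => n _ /=.
rewrite -herm pG mulr_sumr; apply: eq_bigr => j _; ring.
Qed.

Hypothesis trG : \sum_n cRe (G n n) = 0.

(** In the eigenbasis this is a second moment of a combination of squares of independent real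
    coordinates. The vanishing trace removes the product of the means, and each eigenvalue
    contributes l^2 / 2 from each of its two real coordinates. *)
Lemma quadratic_form_square (X : 'I_N -> T -> C) : proper_gaussian P X (@white R N) ->
  rintegrable P (fun w => quadratic_form G (X^~ w) ^+ 2) /\
  \int[P]_w (quadratic_form G (X^~ w) ^+ 2) = total_nsq G.
Proof.
move=> GX; have [p [l [pp pp' pG]]] := hermitian_spectral herm.
have cX jb : centered_gaussian P (coordinate X p jb) 2^-1.
  by have := coordinate_centered GX pp (white_diagonal pp') jb; rewrite mul1r.
have mX := measurable_coordinate GX pp (white_diagonal pp').
have iX := coordinate_independence GX pp (white_diagonal pp').
have E w : quadratic_form G (X^~ w) = \sum_jb l jb.1 * coordinate X p jb w ^+ 2.
  rewrite /quadratic_form (quadratic_form_rotate pG) cRe_sum sum_pairE; apply: eq_bigr => j _ /=.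
  by rewrite -mulr_sumr -sum_part_sq.
have E2 w : quadratic_form G (X^~ w) ^+ 2 = \sum_jb \sum_jb' (l jb.1 * l jb'.1) *
    (coordinate X p jb w ^+ 2 * coordinate X p jb' w ^+ 2).
  rewrite E expr2 mulr_suml; apply: eq_bigr => i _; rewrite mulr_sumr; apply: eq_bigr => j _; ring.
have moment (i j : 'I_N * bool) : rintegrable P (fun w => coordinate X p i w ^+ 2 * coordinate X p j w ^+ 2) /\
    (* Coordinates have variance 1/2: independence gives 1/4 off the diagonal, and the fourth moment
       is 3/4 on it. *)
    \int[P]_w (coordinate X p i w ^+ 2 * coordinate X p j w ^+ 2) = 4^-1 + (i == j)%:R / 2.
  have [<-|ij] := eqVneq i j.
    have e4 w : coordinate X p i w ^+ 2 * coordinate X p i w ^+ 2 = coordinate X p i w ^+ 4 by rewrite -exprD.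
    split; first by apply: rintegrable_eq (fun w => esym (e4 w)) _; exact: (centered_gaussian_rintegrable_pow _ (cX i)).
    by under eq_Rintegral do rewrite e4; rewrite (centered_gaussian_fourth (cX i)) /=; field.
  pose h (k : 'I_N * bool) (x : R) := if (k == i) || (k == j) then x ^+ 2 else 1.
  have mh k : measurable_fun [set: R] (h k).
    by rewrite /h; have [_|_] := boolP ((k == i) || (k == j)); [exact: measurable_funX|exact: measurable_cst].
  have h0 k x : 0 <= h k x by rewrite /h; case: ifP => _ //; exact: sqr_ge0.
  have ih k : rintegrable P (fun w => h k (coordinate X p k w)).
    rewrite /h; have [_|_] := boolP ((k == i) || (k == j)); last exact: rintegrable_cst.
    exact: (centered_gaussian_rintegrable_pow _ (cX k)).
  have prodE (f : 'I_N * bool -> R) : (forall k, k != i -> k != j -> f k = 1) -> \prod_k f k = f i * f j.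
    move=> f1; rewrite (bigD1 i)//= (bigD1 j) 1?eq_sym//= big1 ?mulr1// => k /andP[ki kj].
    exact: f1.
  have hE w : \prod_k h k (coordinate X p k w) = coordinate X p i w ^+ 2 * coordinate X p j w ^+ 2.
    rewrite prodE; first by rewrite /h !eqxx orbT.
    by move=> k /negbTE ki /negbTE kj; rewrite /h ki kj.
  have ip := rintegrable_prod_ge0 mX iX mh h0 ih.
  split; first exact: rintegrable_eq hE ip.
  have := prod_expectation_ge0 mX iX mh h0 ih.
  rewrite rintegralE// => -[]; under eq_Rintegral do rewrite hE.
  move=> ->; rewrite prodE; last first.
    by move=> k /negbTE ki /negbTE kj; rewrite /h ki kj Rintegral_prob_cst.
  rewrite /h !eqxx orbT /=.
  have ci k : \int[P]_w (coordinate X p k w ^+ 2) = 2^-1 := centered_gaussian_square (cX k).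
  by rewrite !ci mul0r addr0; field.
have iT i j : rintegrable P (fun w => (l i.1 * l j.1) * (coordinate X p i w ^+ 2 * coordinate X p j w ^+ 2)).
  by apply: rintegrableZ; exact: (moment i j).1.
have iTs i : rintegrable P (fun w => \sum_jb' (l i.1 * l jb'.1) * (coordinate X p i w ^+ 2 * coordinate X p jb' w ^+ 2)).
  by apply: rintegrable_sum => //; exact: rintegrable_cst.
split.
  apply: rintegrable_eq (fun w => esym (E2 w)) _.
  by apply: rintegrable_sum => //; exact: rintegrable_cst.
under eq_Rintegral do rewrite E2.
rewrite rintegral_sum//.
transitivity (\sum_(i : 'I_N * bool) \sum_(j : 'I_N * bool) (l i.1 * l j.1) * (4^-1 + (i == j)%:R / 2)).
  apply: eq_bigr => i _; rewrite rintegral_sum//; apply: eq_bigr => j _.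
  by rewrite RintegralZl ?(moment i j).2//; exact: (moment i j).1.
have l0 : \sum_(i : 'I_N * bool) l i.1 = 0.
  rewrite sum_pairE /=; under eq_bigr do rewrite big_bool /=.
  by rewrite big_split /= -(diagonalized_trace pp pG) trG addr0.
transitivity (\sum_(i : 'I_N * bool) l i.1 ^+ 2 / 2).
  apply: eq_bigr => i _.
  under eq_bigr do rewrite mulrDr.
  rewrite big_split /= -mulr_suml -mulr_sumr l0 mulr0 mul0r add0r.
  rewrite (bigD1 i)//= eqxx big1 ?addr0; last by move=> j; rewrite eq_sym => /negbTE ->; rewrite mul0r mulr0.
  by rewrite /=; field.
rewrite sum_pairE /= /total_nsq (diagonalized_nsq pp pp' pG); apply: eq_bigr => j _.
by rewrite big_bool /=; field.
Qed.

End quadratic_forms.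

(** * Inputs with a uniformly random frequency *)

Section uniform_phase.
Variable R : realType.

Lemma pi_segment : - pi < pi :> R.
Proof. by have := pi_gt0 R; lra. Qed.

Definition uniform_angle : probability (measurableTypeR R) R := uniform_prob pi_segment.

Lemma measurable_cos_affine (a c : R) : measurable_fun [set: measurableTypeR R] (fun x : measurableTypeR R => cos (a * x + c) : R).
Proof. exact: (bounded_measurable_cos a c).1. Qed.

Lemma rintegrable_cos_affine (a c : R) : rintegrable uniform_angle (fun x => cos (a * x + c)).
Proof.
apply: rintegrable_le (rintegrable_cst uniform_angle 1) _; first exact: measurable_cos_affine.
by move=> x; rewrite ler_norml cos_geN1 cos_le1.
Qed.

Lemma sin_shift_int (d : int) (c : R) : sin (d%:~R * pi + c) = sin (d%:~R * - pi + c).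
Proof.
have H n : sin (n%:R * pi + c) = sin (n%:R * - pi + c).
  have -> : n%:R * pi + c = (n%:R * - pi + c) + pi *+ (2 * n) by rewrite -[pi *+ _]mulr_natl natrM; ring.
  by rewrite (alternatingn (@sinDpi R)) exprM sqrrN expr1n expr1n mul1r.
case: d => n; first exact: H.
rewrite NegzE mulrNz !mulNr mulrN opprK -mulrN; exact/esym/H.
Qed.

Lemma uniform_angle_cos (d : int) (c : R) : d != 0 -> \int[uniform_angle]_x cos (d%:~R * x + c) = 0.
Proof.
move=> d0; have a0 : d%:~R != 0 :> R by rewrite intr_eq0.
set a : R := d%:~R in a0 *.
(* The added 1 makes the integrand nonnegative for the integral against the uniform law; its mean is
   subtracted at the end. *)
pose f (x : R) := 1 + cos (a * x + c).
pose F (x : R) := x + a^-1 * sin (a * x + c).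
have f0 x : 0 <= f x by have := cos_geN1 (a * x + c); rewrite /f; lra.
have mf : measurable_fun [set: measurableTypeR R] (f : measurableTypeR R -> R).
  by apply: measurable_funD => //; exact: measurable_cos_affine.
have daff x : is_derive x (1 : R) (fun y : R => a * y + c) a.
  have := is_derive_poly3 c a 0 0 x; rewrite !mulr0 !mul0r !addr0.
  by congr is_derive; apply/funext => y; rewrite expr1 !mul0r !addr0 addrC.
have dF x : is_derive x (1 : R) F (f x).
  have h := @is_derive1_comp R sin (fun y => a * y + c) x _ _ (is_derive_sin (a * x + c)) (daff x).
  apply: is_derive_eq (is_derive_funD (is_derive_id _ _) (is_deriveZ a^-1 h)) _.
  rewrite (_ : a^-1 *: _ = a^-1 * (cos (a * x + c) * a))// (mulrC (cos _)) mulrA mulVf// mul1r.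
  by [].
have Fc x : {for x, continuous F}.
  by apply/differentiable_continuous/derivable1_diffP; have [] := dF x.
have fc : continuous f.
  move=> x; apply: cvgD; first exact: cvg_cst.
  apply: (@continuous_comp _ _ _ (fun x => a * x + c) (@cos R)); last exact: continuous_cos.
  by apply/differentiable_continuous/derivable1_diffP; have [] := daff x.
have FTC : (\int[@lebesgue_measure R]_(x in `[(- pi)%R, pi]) (f x)%:E = (F pi)%:E - (F (- pi)%R)%:E)%E.
  apply: (continuous_FTC2 pi_segment (continuous_subspaceT fc)).
  - split; first by move=> x _; have [] := dF x.
      exact: cvg_at_right_filter (Fc _).
    exact: cvg_at_left_filter (Fc _).
  - by move=> x _; rewrite derive1E; have [_ ->] := dF x.
have If : (\int[uniform_angle]_x (f x)%:E = 1)%E.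
  rewrite (integral_uniform pi_segment); last 2 first.
  - exact/measurable_EFinP.
  - by move=> x; rewrite lee_fin.
  rewrite FTC /F sin_shift_int -EFinB -EFinM; congr EFin.
  have -> : pi + a^-1 * sin (a * - pi + c) - (- pi + a^-1 * sin (a * - pi + c)) = pi - - pi :> R by ring.
  by rewrite mulVf// gt_eqF// subr_gt0 pi_segment.
have : \int[uniform_angle]_x f x = 1 by rewrite /Rintegral If.
rewrite /f RintegralD//; [|exact: rintegrable_cst|exact: rintegrable_cos_affine].
by rewrite Rintegral_prob_cst; lra.
Qed.

Definition cis (x : R) : R[i] := (cos x +i* sin x)%C.

Lemma cisM_conj x y : cis x * conjc (cis y) = cis (x - y).
Proof. by apply/eqP; rewrite eq_complex /= cosB sinB; apply/andP; split; apply/eqP; ring. Qed.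

Lemma nsq_cis x : nsq (cis x) = 1.
Proof. by rewrite /nsq /= cos2Dsin2. Qed.

Lemma uniform_angle_cis (d : int) (u : R[i]) : d != 0 ->
  rintegrable uniform_angle (fun x => complex.Re (u * cis (d%:~R * x))) /\
  \int[uniform_angle]_x complex.Re (u * cis (d%:~R * x)) = 0.
Proof.
move=> d0.
have E (x : measurableTypeR R) : complex.Re (u * cis (d%:~R * x)) =
    complex.Re u * cos (d%:~R * x + 0) + - complex.Im u * cos (d%:~R * x + - (pi / 2)).
  by rewrite addr0 cosBpihalf /cis; case: u => a b /=; ring.
have i1 c k : rintegrable uniform_angle (fun x => k * cos (d%:~R * x + c)).
  by apply: rintegrableZ; exact: rintegrable_cos_affine.
split; first by apply: rintegrable_eq (fun x => esym (E x)) _; apply: rintegrableD; exact: i1.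
under eq_Rintegral do rewrite E.
have EZ k c : \int[uniform_angle]_x (k * cos (d%:~R * x + c)) = 0.
  by rewrite RintegralZl//; [rewrite uniform_angle_cos// mulr0|exact: rintegrable_cos_affine].
by rewrite RintegralD//; [rewrite !EZ addr0|exact: i1|exact: i1].
Qed.

Section phase.
Variable N : nat.

Definition phase (x : measurableTypeR R) : N.-tuple R[i] := [tuple cis (i%:R * x) | i < N].

Lemma measurable_phase : measurable_fun setT phase.
Proof.
apply/measurable_fun_tnthP => i.
have -> : (fun x : N.-tuple R[i] => tnth x i) \o phase = fun x => cis (i%:R * x).
  by apply/funext => x /=; rewrite tnth_mktuple.
apply/measurable_fun_complexP; split => /=.
  by under eq_fun do rewrite -[_ * _]addr0; exact: measurable_cos_affine.
have -> : (fun x : measurableTypeR R => sin (i%:R * x)) = fun x => cos (i%:R * x + - (pi / 2)).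
  by apply/funext => x; rewrite cosBpihalf.
exact: measurable_cos_affine.
Qed.

HB.instance Definition _ := isMeasurableFun.Build _ _ _ _ phase measurable_phase.

Definition phase_input : probability (N.-tuple R[i]) R := distribution uniform_angle phase.

Lemma phase_le1 x i : nsq (tnth (phase x) i) <= 1.
Proof. by rewrite tnth_mktuple nsq_cis. Qed.

Lemma phase_admissible : admissible_input 1 phase_input.
Proof.
apply/admissible_inputP => i.
transitivity (uniform_angle set0); last exact: measure0.
by congr (uniform_angle _); apply/seteqP; split => x //=; rewrite ltNge phase_le1.
Qed.

Lemma phase_input_integral (f : N.-tuple R[i] -> \bar R) : measurable_fun setT f -> (forall z, 0 <= f z)%E ->
  (\int[phase_input]_z f z = \int[uniform_angle]_x f (phase x))%E.
Proof. by move=> mf f0; rewrite ge0_integral_pushforward// preimage_setT. Qed.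

Lemma input_at_phase x (m : int) : 0 < m -> m <= N%:Z -> input_at (phase x) m = cis ((m - 1)%:~R * x).
Proof.
move=> m0 mN; rewrite input_at_nat m0.
have jN : (`|m - 1| < N)%N by lia.
rewrite -(tnth_nth 0 _ (Ordinal jN)) tnth_mktuple /=; congr (cis (_ * _)).
by rewrite -[m - 1 in RHS]gez0_abs //; lia.
Qed.

End phase.
End uniform_phase.

(** * The quadratic test statistic and its moments *)

Section correlation_form.
Context d (T : measurableType d) (R : realType) (P : probability T R) (K N : nat).
Local Notation C := R[i].
Local Notation cRe := complex.Re.
Variables (H : 'I_K -> int -> {RV P >-> C}) (W : int -> {RV P >-> C}).
Hypothesis HW : rayleigh_channel H W.
Variable rho : R.
Hypothesis rho0 : 0 <= rho.
Implicit Types (z y : N.-tuple C).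
Local Notation t := (total_power H).
Local Notation V := (@block_output d T R P K N H W rho).

Definition tap_sum (n : int) : C := \sum_k autocorrelation (H k) n.

(** With indices from 0, all K taps of row m fall inside the block exactly when K - 1 <= m. The
    diagonal is left out so that the form has trace zero and only nonzero frequencies occur. *)
Definition active (m n : 'I_N) : bool := [&& m != n, (K.-1 <= m)%N & (K.-1 <= n)%N].

Definition tap_matrix (m n : 'I_N) : C := if active m n then tap_sum (m%:Z - n%:Z) else 0.

(** For the inputs [phase] it coincides with S(z) on active entries. For every z it is Hermitian
    with entries bounded by those of [tap_matrix], which gives bounds uniform in z. *)
Definition phase_matrix z (m n : 'I_N) : C :=
  tap_matrix m n * (tnth (clamp z) m * conjc (tnth (clamp z) n)).

Definition correlation (zy : N.-tuple C * N.-tuple C) : R :=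
  quadratic_form (phase_matrix zy.1) (tnth zy.2).

Lemma tap_sumN n : tap_sum (- n) = conjc (tap_sum n).
Proof.
rewrite /tap_sum; transitivity (\sum_k conjc (autocorrelation (H k) n)).
  by apply: eq_bigr => k _; rewrite autocorrelation_conj//; exact: (channel_stationary HW).
by apply/esym; exact: (rmorph_sum (@conjc R)).
Qed.

Lemma phase_matrix_conj z m n : phase_matrix z n m = conjc (phase_matrix z m n).
Proof.
have cM (x y : C) : conjc (x * y) = conjc x * conjc y by exact: rmorphM.
rewrite /phase_matrix /tap_matrix /active eq_sym [((K.-1 <= n)%N && _)]andbC.
case: ifP => _; last by rewrite !mul0r conjc0.
by rewrite !cM conjcK -tap_sumN opprB; ring.
Qed.

Lemma phase_matrix_diag z n : phase_matrix z n n = 0.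
Proof. by rewrite /phase_matrix /tap_matrix /active eqxx mul0r. Qed.

Lemma nsq_conjc (x : C) : nsq (conjc x) = nsq x.
Proof. by case: x => a b; rewrite /nsq /= sqrrN. Qed.

Lemma total_phase_matrix_le z : total_nsq (phase_matrix z) <= total_nsq tap_matrix.
Proof.
apply: ler_sum => m _; apply: ler_sum => n _.
rewrite /phase_matrix !nsqM nsq_conjc ler_piMr ?nsq_ge0//.
have := clamp_le1 z m; have := clamp_le1 z n.
have := nsq_ge0 (tnth (clamp z) m); have := nsq_ge0 (tnth (clamp z) n).
set a := nsq _; set b := nsq _ => a0 b0 a1 b1.
by rewrite mulr_ile1.
Qed.

Definition form_bound : R := 1 + total_nsq tap_matrix.

Lemma form_bound_ge1 : 1 <= form_bound.
Proof. by rewrite lerDl total_nsq_ge0. Qed.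

Lemma correlation_le z y : `|correlation (z, y)| <= form_bound * energy y.
Proof.
apply: le_trans (quadratic_form_le (phase_matrix_conj z) (tnth y)) _.
by rewrite ler_wpM2r ?energy_ge0// lerD2l total_phase_matrix_le.
Qed.

Lemma measurable_correlation : measurable_fun [set: N.-tuple C * N.-tuple C] correlation.
Proof.
have conjM d' (S : measurableType d') (f : S -> C) : measurable_fun setT f -> measurable_fun setT (fun x => conjc (f x)).
  move=> /measurable_fun_complexP[mR mI]; apply/measurable_fun_complexP; split.
    by apply: eq_measurable_fun mR => x _ /=; case: (f x).
  by apply: eq_measurable_fun (measurableT_comp (@oppr_measurable R _) mI) => x _ /=; case: (f x).
have my n : measurable_fun setT (fun u : N.-tuple C * N.-tuple C => tnth u.2 n).
  exact: (measurableT_comp (measurable_tnth n) measurable_snd).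
have mz n : measurable_fun setT (fun u : N.-tuple C * N.-tuple C => tnth (clamp u.1) n).
  exact: (measurableT_comp (measurable_tnth n) (measurableT_comp (@measurable_clamp R N) measurable_fst)).
suff : measurable_fun setT (fun u : N.-tuple C * N.-tuple C =>
    \sum_m \sum_n conjc (tnth u.2 m) * tnth u.2 n * phase_matrix u.1 m n).
  by move=> /measurable_fun_complexP[].
apply: measurable_fun_complex_sum => m; apply: measurable_fun_complex_sum => n.
apply: measurable_fun_complexM; first by apply: measurable_fun_complexM => //; exact: conjM.
apply: measurable_fun_complexM; first exact: measurable_cst.
by apply: measurable_fun_complexM => //; exact: conjM.
Qed.

Lemma noise_correlation_square z :
  (\int[P]_w (correlation (z, noise N W w) ^+ 2)%:E <= (total_nsq tap_matrix)%:E)%E.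
Proof.
have tr0 : \sum_n cRe (phase_matrix z n n) = 0 by rewrite big1// => n _; rewrite phase_matrix_diag.
have [h1 h2] := quadratic_form_square (phase_matrix_conj z) tr0 (noise_proper (N := N) HW 0).
have E w : correlation (z, noise N W w) ^+ 2 = quadratic_form (phase_matrix z) ((fun m : 'I_N => W (0 + m.+1%:Z) : T -> C)^~ w) ^+ 2.
  by congr (quadratic_form _ _ ^+ 2); apply/funext => m; rewrite /noise tnth_mktuple.
under eq_integral do rewrite E.
by rewrite rintegralE// h2 lee_fin total_phase_matrix_le.
Qed.

(* 384 = 4^3 * 3!, from (x/4)^3 / 3! <= exp (x/4). *)
Definition cube_constant : R := 384.

Lemma cube_constant_ge0 : 0 <= cube_constant. Proof. exact: ler0n. Qed.

(** The factor 2^N is the mean of exp (|y|^2 / 2) under the noise: up to this factor the exponential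
    is the reference density of variance 2. *)
Definition exponential_moment : R := cube_constant * expR (N%:R * ln 2).

Lemma noise_exponential_moment :
  (\int[P]_w (cube_constant * expR (energy (noise N W w) / 2))%:E = exponential_moment%:E)%E.
Proof.
have refE y : cube_constant * expR (energy y / 2) = exponential_moment * @reference R N 1 y.
  rewrite /exponential_moment -mulrA; congr (_ * _).
  rewrite -[reference 1 y]lnK ?posrE ?reference_gt0// ln_reference// sumrB -mulr_sumr -/(energy y).
  rewrite sumr_const card_ord -[_ *+ N]mulr_natl -expRD; congr expR.
  by rewrite -[1 + 1]/2; field.
under eq_integral do rewrite refE EFinM.
have E0 : 0 <= exponential_moment by exact: mulr_ge0 cube_constant_ge0 (expR_ge0 _).
have mref : measurable_fun setT (fun w => reference 1 (noise N W w)).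
  exact: measurableT_comp (measurable_spectral_gain _ _) (@measurable_noise _ _ _ _ N W).
rewrite ge0_integralZl//; last 2 first.
- exact/measurable_EFinP.
- by move=> w _; rewrite lee_fin ltW// reference_gt0.
by rewrite (reference_integral N HW ler01) mule1.
Qed.

(** Makes the density at most exp (|y|^2 / 4). A cube of the energy costs another exp (|y|^2 / 4),
    and their product exp (|y|^2 / 2) is still integrable under the noise. *)
Hypothesis rho_small : rho * (N%:R * t) <= 4^-1.

Lemma block_density_exp z y : block_density H rho (z, y) <= expR (rho * (N%:R * t) * energy y).
Proof.
rewrite -[block_density _ _ _]lnK ?posrE; last exact: (block_density_gt0 HW).
rewrite ler_expR; have /andP[_] := ln_density_bounds HW (clamp z) y rho0.
move/le_trans; apply; rewrite ler_wpM2r ?energy_ge0// ler_wpM2l//.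
by apply: trace_cov_le => i; exact: clamp_le1.
Qed.

Lemma cube_le_exp (x : R) : 0 <= x -> x ^+ 3 <= cube_constant * expR (x / 4).
Proof.
move=> x0; have := @expR_ge1Dxn R (x / 4) 2; rewrite divr_ge0// => /(_ isT).
rewrite (_ : 3`!%:R = 6)//; set e := expR _ => h.
have -> : x ^+ 3 = cube_constant * ((x / 4) ^+ 3 / 6) by rewrite /cube_constant; field.
by apply: ler_wpM2l; [exact: cube_constant_ge0|lra].
Qed.

Let small_exp y : expR (rho * (N%:R * t) * energy y) <= expR (energy y / 4).
Proof. by rewrite ler_expR (mulrC (energy y)) ler_wpM2r ?energy_ge0. Qed.

Let exp_half y : expR (energy y / 4) * expR (energy y / 4) = expR (energy y / 2).
Proof. by rewrite -expRD; congr expR; field. Qed.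

Lemma block_energy_cube z : (\int[P]_w (energy (V (z, w)) ^+ 3)%:E <= exponential_moment%:E)%E.
Proof.
rewrite (block_law HW rho0 z (f := fun y => energy y ^+ 3)); last 2 first.
- by apply: measurable_funX; exact: measurable_energy.
- by move=> y; rewrite exprn_ge0 ?energy_ge0.
rewrite -noise_exponential_moment; apply: ge0_le_integral => //.
- by move=> w _; rewrite lee_fin mulr_ge0 ?exprn_ge0 ?energy_ge0// ltW// (block_density_gt0 HW).
- apply/measurable_EFinP; apply: measurable_funM.
    exact: measurableT_comp (measurable_section_right (@measurable_block_density _ _ _ _ _ N H rho) z) (@measurable_noise _ _ _ _ N W).
  apply: measurable_funX; exact: measurableT_comp (@measurable_energy R N) (@measurable_noise _ _ _ _ N W).
- apply/measurable_EFinP; apply: measurable_funM => //; apply: (measurableT_comp (@measurable_expR R)).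
  apply: measurable_funM => //; exact: measurableT_comp (@measurable_energy R N) (@measurable_noise _ _ _ _ N W).
- move=> w _; rewrite lee_fin; set y := noise N W w.
  rewrite -exp_half [leRHS]mulrCA; apply: ler_pM.
  + exact/ltW/(block_density_gt0 HW).
  + by rewrite exprn_ge0 ?energy_ge0.
  + exact: le_trans (block_density_exp z y) (small_exp y).
  + by apply: cube_le_exp; exact: energy_ge0.
Qed.

Definition remainder_bound : R := N%:R * t * form_bound ^+ 2 * exponential_moment.

(** The output is produced by z' and tested with an unrelated z, as under the product of the
    marginals. At order zero the output is pure noise; the excess of the density over 1 is of order
    rho and is absorbed by the exponential moment. *)
Lemma block_correlation_square z z' :
  (\int[P]_w (correlation (z, V (z', w)) ^+ 2)%:E <= (total_nsq tap_matrix + rho * remainder_bound)%:E)%E.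
Proof.
have mc := measurable_section_right measurable_correlation z.
rewrite (block_law HW rho0 z' (f := fun y => correlation (z, y) ^+ 2)); last 2 first.
- exact: measurable_funX.
- by move=> y; exact: sqr_ge0.
pose k : R := rho * (N%:R * t) * form_bound ^+ 2.
have k0 : 0 <= k by exact: mulr_ge0 (block_A0 N H rho0) (sqr_ge0 _).
have mn := @measurable_noise _ _ _ _ N W.
have mcn : measurable_fun setT (fun w => correlation (z, noise N W w) ^+ 2).
  by apply: measurable_funX; exact: measurableT_comp mc mn.
have men : measurable_fun setT (fun w => cube_constant * expR (energy (noise N W w) / 2)).
  apply: measurable_funM => //; apply: (measurableT_comp (@measurable_expR R)).
  apply: measurable_funM => //; exact: measurableT_comp (@measurable_energy R N) mn.
apply: (@le_trans _ _ (\int[P]_w ((correlation (z, noise N W w) ^+ 2)%:E + k%:E * (cube_constant * expR (energy (noise N W w) / 2))%:E))%E).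
  apply: ge0_le_integral => //.
  - by move=> w _; rewrite lee_fin mulr_ge0 ?sqr_ge0// ltW// (block_density_gt0 HW).
  - apply/measurable_EFinP; apply: measurable_funM => //.
    exact: measurableT_comp (measurable_section_right (@measurable_block_density _ _ _ _ _ N H rho) z') mn.
  - under eq_fun do rewrite -EFinM -EFinD.
    by apply/measurable_EFinP; apply: measurable_funD => //; exact: measurable_funM.
  - move=> w _; rewrite -EFinM -EFinD lee_fin; set y := noise N W w; set g := correlation _.
    have e0 := energy_ge0 y.
    have a0 := block_A0 N H rho0.
    have hg : g ^+ 2 <= form_bound ^+ 2 * energy y ^+ 2.
      rewrite -exprMn -real_normK ?num_real// lerXn2r ?nnegrE ?mulr_ge0//; last exact: correlation_le.
      exact: le_trans ler01 form_bound_ge1.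
    have hd := block_density_exp z' y; have hs := small_exp y; have hc := cube_le_exp e0.
    have hE := exp_half y.
    move: hd hs; set v := rho * (N%:R * t) * energy y; set q := block_density _ _ _ => hd hs.
    have v0 : 0 <= v by rewrite mulr_ge0.
    (* Rearranged from 1 - v <= exp (- v). *)
    have hv : expR v <= 1 + v * expR v.
      have := expR_ge1Dx (- v); rewrite expRN => h1.
      have ev := expR_gt0 v.
      have : (1 - v) * expR v <= 1 by rewrite -ler_pdivlMr// div1r.
      by rewrite mulrBl mul1r; lra.
    have s1 : q * g ^+ 2 <= (1 + v * expR v) * g ^+ 2.
      by rewrite ler_wpM2r ?sqr_ge0// (le_trans hd hv).
    have s2 : v * expR v * g ^+ 2 <= k * (cube_constant * expR (energy y / 2)).
      apply: (@le_trans _ _ (v * expR (energy y / 4) * (form_bound ^+ 2 * energy y ^+ 2))).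
        apply: ler_pM => //; rewrite ?sqr_ge0//.
          by rewrite mulr_ge0 ?expR_ge0.
        by rewrite ler_wpM2l.
      have -> : v * expR (energy y / 4) * (form_bound ^+ 2 * energy y ^+ 2) =
          k * (energy y ^+ 3 * expR (energy y / 4)) by rewrite /v /k; ring.
      rewrite ler_wpM2l// -hE mulrA ler_wpM2r ?expR_ge0//.
    by rewrite mulrDl mul1r in s1; lra.
have c0 w : 0 <= cube_constant * expR (energy (noise N W w) / 2) by exact: mulr_ge0 cube_constant_ge0 (expR_ge0 _).
rewrite ge0_integralD; [|exact: measurableT|..]; last 4 first.
- by move=> w _; rewrite lee_fin sqr_ge0.
- exact/measurable_EFinP.
- by move=> w _; rewrite -EFinM lee_fin (mulr_ge0 k0 (c0 w)).
- by under eq_fun do rewrite -EFinM; apply/measurable_EFinP; exact: measurable_funM.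
rewrite ge0_integralZl; [|exact: measurableT|..]; last 3 first.
- exact/measurable_EFinP.
- by move=> w _; rewrite lee_fin c0.
- by rewrite lee_fin.
rewrite noise_exponential_moment EFinD; apply: leeD; first exact: noise_correlation_square.
by rewrite -EFinM lee_fin le_eqVlt; apply/orP; left; apply/eqP; rewrite /k /remainder_bound; ring.
Qed.

End correlation_form.

Section fubini_lower.
Context d1 (T1 : measurableType d1) d2 (T2 : measurableType d2) (R : realType)
  (P1 : probability T1 R) (P2 : probability T2 R) (F : T1 * T2 -> R).

Lemma Rintegral_fubini_ge B : rintegrable (P1 \x P2)%E F -> (forall x, rintegrable P2 (fun y => F (x, y))) ->
  (forall x, B <= \int[P2]_y F (x, y)) -> B <= \int[(P1 \x P2)%E]_z F z.
Proof.
move=> iF iF2 H; rewrite -lerN2 -RintegralN.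
have neg d (T : measurableType d) (m : {measure set T -> \bar R}) f : rintegrable m f -> rintegrable m (fun x => - f x).
  by move=> h; apply: rintegrable_eq (rintegrableZ (-1) h) => x; rewrite mulN1r.
apply: Rintegral_fubini_le => [|x|x]; [exact: neg|exact: neg|].
by rewrite RintegralN lerN2.
Qed.

End fubini_lower.

(** * Information carried by the phase input *)

Section phase_information.
Context d (T : measurableType d) (R : realType) (P : probability T R) (K N : nat).
Local Notation C := R[i].
Local Notation cRe := complex.Re.
Variables (H : 'I_K -> int -> {RV P >-> C}) (W : int -> {RV P >-> C}).
Hypothesis HW : rayleigh_channel H W.
Variable rho : R.
Hypothesis rho0 : 0 <= rho.
Local Notation t := (total_power H).
Local Notation V := (@block_output d T R P K N H W rho).
Local Notation corr := (@correlation d T R P K N H).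
Local Notation B := (total_nsq (@tap_matrix d T R P K N H)).
Local Notation ph := (@phase R N).
Hypothesis rho_small : rho * (N%:R * t) <= 4^-1.

Lemma phase_matrix_phase x m n : phase_matrix H (ph x) m n =
  tap_matrix H m n * cis ((m%:Z - n%:Z)%:~R * x).
Proof.
rewrite /phase_matrix clamp_id; last exact: phase_le1.
by rewrite !tnth_mktuple cisM_conj rmorphB mulrBl.
Qed.

(** The phase difference between times m - k and n - k is the same for all taps k, so the
    autocorrelations of the taps add in amplitude; this is where the modulus of a sum over the taps
    comes from. *)
Lemma phase_fade_cov x m n : active K m n -> fade_cov H (ph x) m n = phase_matrix H (ph x) m n.
Proof.
move=> mn; rewrite phase_matrix_phase /tap_matrix mn.
have /and3P[_ hm hn] := mn.
rewrite /tap_sum mulr_suml; apply: eq_bigr => k _.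
have := ltn_ord k; have := ltn_ord m; have := ltn_ord n => nN mN kK.
rewrite !input_at_phase; try lia.
rewrite cisM_conj -mulrBl -rmorphB /=; congr (_ * cis (_%:~R * _)); lia.
Qed.

(** Under the true input the mean is the pairing of the output covariance with the test matrix. The
    white part pairs with a zero diagonal, and rho S(z) pairs with its own active entries. *)
Lemma correlation_mean x :
  rintegrable P (fun w => corr (ph x, V (ph x, w))) /\ \int[P]_w corr (ph x, V (ph x, w)) = rho * B.
Proof.
have [h1 h2] := quadratic_form_mean (phase_matrix_conj HW (ph x)) (output_proper HW 0 (ph x) rho0).
have E w : corr (ph x, V (ph x, w)) =
    quadratic_form (phase_matrix H (ph x)) ((channel_output H W 0 rho (ph x))^~ w).
  rewrite /correlation /block_output /= clamp_id; last exact: phase_le1.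
  by congr quadratic_form; rewrite /channel_out tnth_tuple_rv.
split; first exact: rintegrable_eq (fun w => esym (E w)) h1.
under eq_Rintegral do rewrite E.
rewrite h2 cRe_sum /total_nsq mulr_sumr; apply: eq_bigr => m _.
rewrite cRe_sum mulr_sumr; apply: eq_bigr => n _.
have [mn|mn] := boolP (active K m n).
  rewrite phase_fade_cov// /white; have /and3P[/negbTE -> _ _] := mn; rewrite add0r.
  have -> : nsq (tap_matrix H m n) = nsq (phase_matrix H (ph x) m n).
    by rewrite phase_matrix_phase nsqM nsq_cis mulr1.
  by case: (phase_matrix _ _ _ _) => a b; rewrite /nsq /=; ring.
rewrite phase_matrix_phase /tap_matrix (negbTE mn) mul0r conjc0 mulr0 /=.
by rewrite /nsq /= expr0n /= addr0 mulr0.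
Qed.

Let mcorr := @measurable_correlation d T R P K N H.

Lemma phase_law : same_law (phase_input R N) (uniform_angle R) id ph.
Proof.
by apply: same_law_set => //; exact: measurable_phase.
Qed.

(** For a fixed output, every entry of the form oscillates at the nonzero frequency m - n in theta,
    hence averages to 0. *)
Lemma correlation_average y :
  rintegrable (phase_input R N) (fun z => corr (z, y)) /\ \int[phase_input R N]_z corr (z, y) = 0.
Proof.
have mcy : measurable_fun setT (fun z => corr (z, y)) := measurable_section_left mcorr y.
split.
  apply: rintegrable_le (rintegrable_cst _ (form_bound N H * energy y)) _ => // z.
  exact: (correlation_le HW).
rewrite (same_law_Rintegral phase_law (@measurable_id _ _ _) (@measurable_phase R N) mcy).
have E x : corr (ph x, y) = \sum_m \sum_n
    cRe (conjc (tnth y m) * tnth y n * tap_matrix H m n * cis ((m%:Z - n%:Z)%:~R * x)).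
  rewrite /correlation /quadratic_form cRe_sum; apply: eq_bigr => m _; rewrite cRe_sum.
  by apply: eq_bigr => n _; rewrite phase_matrix_phase mulrA.
have term m n : rintegrable (uniform_angle R) (fun x => cRe (conjc (tnth y m) * tnth y n * tap_matrix H m n * cis ((m%:Z - n%:Z)%:~R * x))) /\
   \int[uniform_angle R]_x cRe (conjc (tnth y m) * tnth y n * tap_matrix H m n * cis ((m%:Z - n%:Z)%:~R * x)) = 0.
  have [mn|mn] := boolP (active K m n).
    apply: uniform_angle_cis; have /and3P[+ _ _] := mn.
    by apply: contra => /eqP h; apply/eqP/ord_inj; lia.
  have Z (x : measurableTypeR R) : 0 = cRe (conjc (tnth y m) * tnth y n * tap_matrix H m n * cis ((m%:Z - n%:Z)%:~R * x)).
    by rewrite /tap_matrix (negbTE mn) mulr0 mul0r.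
  split; first exact: rintegrable_eq Z (rintegrable_cst _ 0).
  by under eq_Rintegral do rewrite -Z; rewrite Rintegral_prob_cst.
have iterm m : rintegrable (uniform_angle R) (fun x => \sum_n cRe (conjc (tnth y m) * tnth y n * tap_matrix H m n * cis ((m%:Z - n%:Z)%:~R * x))).
  by apply: rintegrable_sum => [|n]; [exact: rintegrable_cst|exact: (term m n).1].
under eq_Rintegral do rewrite E.
rewrite rintegral_sum//; apply: big1 => m _.
rewrite rintegral_sum; last by move=> n; exact: (term m n).1.
by apply: big1 => n _; exact: (term m n).2.
Qed.

(** Second order Taylor polynomial of exp (rho corr): positive everywhere, with a cubic error in the
    logarithm, and with an average over the input that involves only the first two moments of the
    form. *)
Definition taylor_test (zy : N.-tuple C * N.-tuple C) : R :=
  1 + rho * corr zy + (rho * corr zy) ^+ 2 / 2.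

Lemma measurable_taylor_test : measurable_fun setT taylor_test.
Proof.
have m1 : measurable_fun setT (fun zy => rho * corr zy) by exact: measurable_funM.
apply: measurable_funD; first exact: measurable_funD.
by apply: measurable_funM => //; exact: measurable_funX.
Qed.

Lemma taylor_test_gt0 zy : 0 < taylor_test zy.
Proof. by apply: lt_le_trans (taylor2_ge_half _); rewrite invr_gt0. Qed.

Lemma taylor_test_dominated z y :
  `|ln (taylor_test (z, y))| <= (1 + 2 * (rho * form_bound N H)) * (1 + energy y).
Proof.
have e0 := energy_ge0 y; have b0 : 0 <= form_bound N H by apply: le_trans ler01 (form_bound_ge1 N H).
have hc := correlation_le HW z y.
have h1 : `|rho * corr (z, y)| <= rho * form_bound N H * energy y.
  by rewrite normrM (ger0_norm rho0) -mulrA ler_wpM2l.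
have hge := taylor2_ge_half (rho * corr (z, y)); have g0 := taylor_test_gt0 (z, y).
set f := rho * corr (z, y) in h1 hge.
have low : -1 <= ln (taylor_test (z, y)).
  have : ln (2^-1) <= ln (taylor_test (z, y)) by rewrite ler_ln ?posrE// invr_gt0.
  rewrite lnV ?posrE//; have : ln (1 + 1 : R) <= 1 by apply: le_ln1Dx; lra.
  by rewrite -[1 + 1 : R]/(2 : R); lra.
have up : ln (taylor_test (z, y)) <= 2 * `|f|.
  have f1 : 0 < 1 + `|f| by have := normr_ge0 f; lra.
  apply: (@le_trans _ _ (ln ((1 + `|f|) ^+ 2))).
    rewrite ler_ln ?posrE ?exprn_gt0// /taylor_test -/f.
    have := ler_norm f; have := real_normK (num_real f); have := normr_ge0 f; have := sqr_ge0 f.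
    by rewrite sqrrD; set a := `|f|; move=> s0 a0 ae fa; rewrite expr1n mul1r -ae -mulr_natl; rewrite -ae in s0; lra.
  rewrite expr2 lnM ?posrE//; have : ln (1 + `|f|) <= `|f| by apply: le_ln1Dx; have := normr_ge0 f; lra.
  lra.
have p1 : 0 <= rho * form_bound N H by rewrite mulr_ge0.
have p2 := mulr_ge0 p1 e0.
have -> : (1 + 2 * (rho * form_bound N H)) * (1 + energy y) =
    1 + energy y + 2 * (rho * form_bound N H) + 2 * (rho * form_bound N H * energy y) by ring.
move: low up h1 p1 p2 e0; clear.
move: (ln _) `|f| (rho * form_bound N H * energy y) (rho * form_bound N H) (energy y) => L a re r e *.
by rewrite ler_norml; apply/andP; split; lra.
Qed.

Local Notation M := (exponential_moment R N).
Local Notation remainder := (remainder_bound N H).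

(** The linear term has mean rho^2 B, and the cubic error of the logarithm is controlled by the
    third moment of the energy. *)
Lemma taylor_test_phase x :
  rho ^+ 2 * B - rho ^+ 3 * (form_bound N H ^+ 3 * M) <= \int[P]_w ln (taylor_test (ph x, V (ph x, w))).
Proof.
have [ic Ec] := correlation_mean x.
have e3 := block_energy_cube HW rho0 rho_small (ph x).
have me : measurable_fun setT (fun w => energy (V (ph x, w)) ^+ 3).
  apply: measurable_funX; apply: (measurableT_comp (@measurable_energy R N)).
  exact: measurable_section_right (@measurable_block_output _ _ _ _ _ _ H W rho) (ph x).
have ie : rintegrable P (fun w => energy (V (ph x, w)) ^+ 3).
  apply/integrableP; split; first exact/measurable_EFinP.
  under eq_integral do rewrite /= ger0_norm ?exprn_ge0 ?energy_ge0//.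
  by apply: le_lt_trans e3 _; rewrite ltry.
have e3' : \int[P]_w (energy (V (ph x, w)) ^+ 3) <= M by rewrite -lee_fin -rintegralE.
have il := @rintegrable_dominated_section _ _ _ _ _ _ _ P _ _ _ (@measurable_block_output _ _ _ _ _ _ H W rho)
   (@measurable_energy R N) (@energy_ge0 R N) (@block_growth _ _ _ _ _ N _ _ HW _ rho0) _ _ (ph x)
   (measurableT_comp (@measurable_ln R) measurable_taylor_test) taylor_test_dominated.
pose b := form_bound N H.
have b0 : 0 <= b by apply: le_trans ler01 (form_bound_ge1 N H).
apply: (@le_trans _ _ (\int[P]_w (rho * corr (ph x, V (ph x, w)) - rho ^+ 3 * b ^+ 3 * energy (V (ph x, w)) ^+ 3))).
  rewrite RintegralB//; [|exact: rintegrableZ|exact: rintegrableZ].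
  rewrite !RintegralZl// Ec.
  have := ler_wpM2l (mulr_ge0 (exprn_ge0 3 rho0) (exprn_ge0 3 b0)) e3'.
  by rewrite /b !mulrA -expr2; lra.
apply: le_Rintegral => //.
  by apply: rintegrableB; exact: rintegrableZ.
move=> w _; apply: le_trans (ln_taylor2_ge _).
rewrite lerD2l lerN2 -!exprMn lerXn2r ?nnegrE ?normr_ge0//.
  by rewrite !mulr_ge0 ?energy_ge0.
rewrite normrM (ger0_norm rho0) -mulrA ler_wpM2l//.
exact: (correlation_le HW).
Qed.

(** After averaging over theta the test function is [eta], without a linear term, so its mean under
    the product of the marginals exceeds 1 by about rho^2 B / 2; subtracted from the gain rho^2 B
    this leaves half of it. *)
Lemma phase_information_ge :
  rho ^+ 2 * B / 2 - rho ^+ 3 * (form_bound N H ^+ 3 * M + remainder / 2) <=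
  block_info H W rho (phase_input R N).
Proof.
pose mu := phase_input R N.
pose S y := \int[mu]_z (corr (z, y) ^+ 2).
pose eta y := 1 + rho ^+ 2 / 2 * S y.
have S0 y : 0 <= S y by apply: Rintegral_ge0 => z _; exact: sqr_ge0.
have mc2 : measurable_fun setT (fun zy : N.-tuple C * N.-tuple C => corr zy ^+ 2) by exact: measurable_funX.
have mS : measurable_fun setT S by apply: (measurable_Rintegral_left mu mc2) => z; exact: sqr_ge0.
have meta : measurable_fun setT eta by apply: measurable_funD => //; exact: measurable_funM.
have r2 : 0 <= rho ^+ 2 / 2 by rewrite divr_ge0// sqr_ge0.
have eta0 y : 0 <= eta y by rewrite addr_ge0// mulr_ge0.
have iS y : rintegrable mu (fun z => corr (z, y) ^+ 2).
  apply: rintegrable_le (rintegrable_cst mu ((form_bound N H * energy y) ^+ 2)) _.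
    exact: (measurable_section_left mc2 y).
  move=> z; rewrite ger0_norm ?sqr_ge0// -real_normK ?num_real// lerXn2r ?nnegrE//.
    by rewrite mulr_ge0 ?energy_ge0// (le_trans ler01)// form_bound_ge1.
  exact: (correlation_le HW).
have etaE y : (\int[mu]_z (taylor_test (z, y))%:E <= (eta y)%:E)%E.
  have [i1 E1] := correlation_average y.
  have i2 : rintegrable mu (fun z => 1 + rho * corr (z, y)).
    by apply: rintegrableD; [exact: rintegrable_cst|exact: rintegrableZ].
  have E z : 1 + rho * corr (z, y) + rho ^+ 2 / 2 * corr (z, y) ^+ 2 = taylor_test (z, y).
    by rewrite /taylor_test; congr (_ + _); rewrite exprMn; field.
  have i3 : rintegrable mu (fun z => rho ^+ 2 / 2 * corr (z, y) ^+ 2) by exact: rintegrableZ.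
  rewrite rintegralE; last exact: rintegrable_eq E (rintegrableD i2 i3).
  rewrite lee_fin; under eq_Rintegral do rewrite -E.
  rewrite RintegralD// RintegralD//; [|exact: rintegrable_cst|exact: rintegrableZ].
  have -> : \int[mu]_z (rho * corr (z, y)) = rho * \int[mu]_z corr (z, y) by rewrite RintegralZl.
  have -> : \int[mu]_z (rho ^+ 2 / 2 * corr (z, y) ^+ 2) = rho ^+ 2 / 2 * S y by rewrite RintegralZl//; exact: iS.
  by rewrite Rintegral_prob_cst E1 mulr0 addr0.
pose e := rho ^+ 2 / 2 * (B + rho * remainder).
(* Two independent copies of the input occur: one in the test statistic, one producing the output.
   Tonelli reduces to a fixed pair of inputs, where the bound is uniform. *)
have SV : (\int[(mu \x P)%E]_u (S (V u))%:E <= (B + rho * remainder)%:E)%E.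
  pose F (v : N.-tuple C * (N.-tuple C * T)) := corr (v.1, V v.2) ^+ 2.
  have mF : measurable_fun setT F.
    apply: (measurableT_comp mc2); apply: measurable_fun_pair; first exact: measurable_fst.
    exact: measurableT_comp (@measurable_block_output _ _ _ _ _ _ H W rho) measurable_snd.
  have F0 v : 0 <= F v by exact: sqr_ge0.
  have -> : (\int[(mu \x P)%E]_u (S (V u))%:E = \int[(mu \x P)%E]_u \int[mu]_z (F (z, u))%:E)%E.
    apply: eq_integral => u _; apply/esym; exact: (rintegralE (iS (V u))).
  rewrite -(tonelli21 mu (mu \x P)%E mF F0) (tonelli12 mu (mu \x P)%E mF F0).
  rewrite -[leRHS](integral_prob_cst mu); apply: ge0_le_integral => //.
  - by move=> z _; apply: integral_ge0 => u _; rewrite lee_fin.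
  - exact: (measurable_integral_right (mu \x P)%E mF F0).
  - move=> z _.
    have mFz : measurable_fun setT (fun u => F (z, u)) := measurable_section_right mF z.
    rewrite (tonelli12 mu P mFz (fun u => F0 _)) -[leRHS](integral_prob_cst mu).
    apply: ge0_le_integral => //.
    + by move=> z' _; apply: integral_ge0 => u _; rewrite lee_fin.
    + exact: (measurable_integral_right P mFz (fun u => F0 _)).
    + by move=> z' _; exact: (block_correlation_square HW rho0 rho_small z z').
have etaV : (\int[(mu \x P)%E]_u (eta (V u))%:E <= (1 + e)%:E)%E.
  have mSV : measurable_fun setT (fun u => S (V u)) := measurableT_comp mS (@measurable_block_output _ _ _ _ _ _ H W rho).
  have -> : (\int[(mu \x P)%E]_u (eta (V u))%:E = \int[(mu \x P)%E]_u ((1 : R)%:E + (rho ^+ 2 / 2)%:E * (S (V u))%:E))%E.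
    by apply: eq_integral => u _; rewrite -EFinM -EFinD.
  rewrite ge0_integralD; [|exact: measurableT|..]; last 4 first.
  - by [].
  - exact: measurable_cst.
  - by move=> u _; rewrite -EFinM lee_fin mulr_ge0.
  - by under eq_fun do rewrite -EFinM; apply/measurable_EFinP; exact: measurable_funM.
  rewrite integral_prob_cst ge0_integralZl; [|exact: measurableT|..]; last 3 first.
  - exact/measurable_EFinP.
  - by move=> u _; rewrite lee_fin.
  - by rewrite lee_fin.
  by rewrite EFinD; apply: leeD => //; rewrite /e (EFinM (rho ^+ 2 / 2)); apply: lee_wpmul2l.
have := @information_ge _ _ _ _ _ _ _ mu P _ _ _ _ _ _ (@measurable_block_output _ _ _ _ _ _ H W rho) (@measurable_noise _ _ _ _ N W)
  (@measurable_block_density _ _ _ _ _ N H rho) (@measurable_energy R N) (block_density_gt0 HW rho0) (@energy_ge0 R N)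
  (@block_law _ _ _ _ _ N _ _ HW _ rho0) (block_A0 N H rho0) (block_density_bounds HW rho0)
  (@block_growth _ _ _ _ _ N _ _ HW _ rho0) taylor_test eta _ e measurable_taylor_test taylor_test_gt0
  taylor_test_dominated meta eta0 etaE etaV.
apply: le_trans; rewrite lerBrDr.
have mlt : measurable_fun setT (fun u => ln (taylor_test u)) := measurableT_comp (@measurable_ln R) measurable_taylor_test.
have mtr : measurable_fun setT (transmission V) := measurable_transmission (@measurable_block_output _ _ _ _ _ _ H W rho).
have mphT : measurable_fun setT (fun u : measurableTypeR R * T => (ph u.1, u.2)).
  apply: measurable_fun_pair; last exact: measurable_snd.
  exact: measurableT_comp (@measurable_phase R N) measurable_fst.
have L : same_law (mu \x P)%E (uniform_angle R \x P)%E id (fun u => (ph u.1, u.2)).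
  apply: same_law_of_ge0 => // f mf f0.
  rewrite (tonelli12 mu P mf f0) (tonelli12 _ P (measurableT_comp mf mphT) (fun u => f0 _)).
  rewrite phase_input_integral//; first exact: (measurable_integral_right P mf f0).
  by move=> z; apply: integral_ge0 => w _; rewrite lee_fin.
have mg := measurableT_comp mlt mtr.
rewrite (same_law_Rintegral L (@measurable_id _ _ _) mphT mg).
have gr z := @block_growth _ _ _ _ _ N _ _ HW _ rho0 z.
have ig := rintegrable_dominated mu (@measurable_block_output _ _ _ _ _ _ H W rho) (@measurable_energy R N) (@energy_ge0 R N) gr mlt taylor_test_dominated.
have igs z := rintegrable_dominated_section (@measurable_block_output _ _ _ _ _ _ H W rho) (@measurable_energy R N) (@energy_ge0 R N) gr z mlt taylor_test_dominated.
apply: (@le_trans _ _ (rho ^+ 2 * B - rho ^+ 3 * (form_bound N H ^+ 3 * M))).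
  by rewrite /e le_eqVlt; apply/orP; left; apply/eqP; field.
have Ls : same_law (uniform_angle R \x P)%E (mu \x P)%E (fun u => (ph u.1, u.2)) id by move=> f bf; rewrite L.
apply: (Rintegral_fubini_ge (F := fun u => ln (taylor_test (transmission V (ph u.1, u.2))))).
- exact: (same_law_rintegrable mphT (@measurable_id _ _ _) Ls mg ig).
- by move=> x; exact: (igs (ph x)).
- by move=> x; exact: (taylor_test_phase x).
Qed.

End phase_information.

(** * Limits at zero *)

Section limits_at_zero.
Variables (R : realType) (f : R -> \bar R) (e : R) (B : \bar R).
Hypothesis e0 : 0 < e.

Let near_interval : (0 : R)^'+ [set x | 0 < x < e].
Proof.
near=> x; apply/andP; split; near: x; first exact: nbhs_right_gt.
exact: nbhs_right_lt.
Unshelve. all: end_near. Qed.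

Lemma limf_esup_le : (forall x, 0 < x < e -> (f x <= B)%E) -> (limf_esup f (0^'+) <= B)%E.
Proof.
move=> h; rewrite limf_esupE.
apply: (@le_trans _ _ (ereal_sup (f @` [set x | 0 < x < e]))).
  by apply: ereal_inf_lbound; exists [set x | 0 < x < e].
by apply: ub_ereal_sup => _ [x xe <-]; exact: h.
Qed.

Lemma limf_einf_ge : (forall x, 0 < x < e -> (B <= f x)%E) -> (B <= limf_einf f (0^'+))%E.
Proof.
move=> h; rewrite limf_einfE.
apply: (@le_trans _ _ (ereal_inf (f @` [set x | 0 < x < e]))).
  by apply: le_ereal_inf_tmp => _ [x xe <-]; exact: h.
by apply: ereal_sup_ubound; exists [set x | 0 < x < e].
Qed.

End limits_at_zero.

Section tap_energy.
Context d (T : measurableType d) (R : realType) (P : probability T R) (K : nat).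
Local Notation C := R[i].
Variables (H : 'I_K -> int -> {RV P >-> C}) (W : int -> {RV P >-> C}).
Hypothesis HW : rayleigh_channel H W.

Definition tap_energy (D : nat) : R := \sum_(1 <= n < D.+1) nsq (tap_sum H n%:Z).

Lemma tap_energy_ge0 D : 0 <= tap_energy D.
Proof. by apply: sumr_ge0 => n _; exact: nsq_ge0. Qed.

(** A column far enough from both ends of the block meets all lags from 1 to D. *)
Lemma tap_row N D (n : 'I_N) : (K.-1 <= n)%N -> (n + D < N)%N ->
  tap_energy D <= \sum_(m < N | (n < m)%N) nsq (tap_matrix H m n).
Proof.
move=> Kn nD.
rewrite (eq_bigr (fun m : 'I_N => nsq (tap_sum H (m - n)%N%:Z))); last first.
  move=> m nm; rewrite /tap_matrix /active Kn (leq_trans Kn (ltnW nm)) -val_eqE /= (gtn_eqF nm) /=.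
  by rewrite subzn// ltnW.
rewrite (sum_shift (fun e => nsq (tap_sum H e%:Z))).
rewrite [leRHS](big_cat_nat (n := D.+1)) //=; last by lia.
by rewrite lerDl; apply: sumr_ge0 => i _; exact: nsq_ge0.
Qed.

(** All but K - 1 + D of the columns are complete below the diagonal, and Hermitian symmetry doubles
    their contribution, which cancels the factor 1/2 in the information. *)
Lemma total_tap_matrix N D : 2 * ((N - (K.-1 + D))%N%:R * tap_energy D) <= total_nsq (@tap_matrix d T R P K N H).
Proof.
have sym (m n : 'I_N) : nsq (tap_matrix H m n) = nsq (tap_matrix H n m).
  rewrite /tap_matrix /active eq_sym [((K.-1 <= m)%N && _)]andbC; case: ifP => _ //.
  by rewrite -opprB (tap_sumN HW) nsq_conjc.
pose U (m n : 'I_N) := if (n < m)%N then nsq (tap_matrix H m n) else 0.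
have half : (N - (K.-1 + D))%N%:R * tap_energy D <= \sum_n \sum_m U m n.
  apply: (@le_trans _ _ (\sum_(n < N | (K.-1 <= n)%N && (n + D < N)%N) tap_energy D)).
    rewrite (eq_bigl (fun n : 'I_N => (K.-1 <= n) && (n < N - D))%N); last by move=> n; lia.
    rewrite -(big_ord_widen_cond N (fun i => K.-1 <= i)%N (fun=> tap_energy D)) ?leq_subr//.
    have <- : \sum_(K.-1 <= i < N - D) tap_energy D = \sum_(i < N - D | (K.-1 <= i)%N) tap_energy D.
      by rewrite big_geq_mkord.
    rewrite sumr_const_nat -[leRHS]mulr_natl (_ : (N - D - K.-1)%N = (N - (K.-1 + D))%N)//.
    by lia.
  rewrite [leRHS](bigID (fun n : 'I_N => (K.-1 <= n)%N && (n + D < N)%N)) /=.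
  rewrite -[leLHS]addr0 lerD//.
    apply: ler_sum => n /andP[h1 h2]; apply: le_trans (tap_row h1 h2) _.
    by rewrite big_mkcond; apply: ler_sum => m _; rewrite /U.
  by apply: sumr_ge0 => n _; apply: sumr_ge0 => m _; rewrite /U; case: ifP => // _; exact: nsq_ge0.
rewrite mulrDl mul1r; apply: (@le_trans _ _ (\sum_n \sum_m U m n + \sum_m \sum_n U n m)).
  by rewrite lerD.
rewrite [X in X + _]exchange_big /= -big_split /total_nsq; apply: ler_sum => m _ /=.
rewrite -big_split; apply: ler_sum => n _ /=.
by rewrite /U (sym n m); case: (ltngtP m n) => mn; rewrite ?addr0 ?add0r ?nsq_ge0.
Qed.

End tap_energy.

Section main_theorem.
Context d (T : measurableType d) (R : realType) (P : probability T R) (K : nat).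
Local Notation C := R[i].
Variables (H : 'I_K -> int -> {RV P >-> C}) (W : int -> {RV P >-> C}).
Hypothesis HW : rayleigh_channel H W.
Hypothesis phi_fin : forall k, (phi (H k) < +oo)%E.
Hypothesis ne : forall k, nonephemeral (H k).
Local Notation t := (total_power H).

Lemma capacity_limsup :
  (limf_esup (fun rho : R => C_ds H W rho 1 * ((rho ^+ 2)^-1)%:E) (0^'+) <= K%:R%:E * \sum_(k < K) phi (H k))%E.
Proof.
have -> : (K%:R%:E * \sum_(k < K) phi (H k) = (K%:R * \sum_k phi_real H k)%:E)%E.
  by rewrite EFinM -sumEFin; congr (_ * _)%E; apply: eq_bigr => k _; exact: phi_realE.
set L0 := K%:R * _; apply/lee_addgt0Pr => e e0.
have t0 : 0 <= t ^+ 3 by rewrite exprn_ge0// total_power_ge0.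
(* The coefficient of the cubic remainder, increased by 1 so that e / c is defined even when t =
   0. *)
pose c := 4 / 3 * t ^+ 3 + 1.
have c0 : 0 < c by rewrite /c; lra.
apply: (@limf_esup_le _ _ (e / c)); first by rewrite divr_gt0.
move=> rho /andP[r0 re].
have [L [-> LB _]] := capacity_limit HW phi_fin ne (ltW r0).
rewrite -EFinM -EFinD lee_fin ler_pdivrMr ?exprn_gt0//; apply: le_trans LB _.
rewrite /capacity_bound -/L0.
have -> : 4 / 3 * (rho * t) ^+ 3 = rho ^+ 2 * (rho * (4 / 3 * t ^+ 3)) by field.
rewrite (mulrDl L0 e) (mulrC L0) (mulrC e) lerD2l ler_wpM2l ?sqr_ge0//.
move: re; rewrite ltr_pdivlMr// => re.
by apply: le_trans (ltW re); apply: ler_wpM2l; [exact: ltW|rewrite /c; lra].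
Qed.

Lemma capacity_liminf_block N D : (0 < N + K.-1)%N ->
  (((N - (K.-1 + D))%N%:R * tap_energy H D / (N + K.-1)%:R)%:E <=
   limf_einf (fun rho : R => C_ds H W rho 1 * ((rho ^+ 2)^-1)%:E) (0^'+))%E.
Proof.
move=> n0; have n0' : 0 < (N + K.-1)%:R :> R by rewrite ltr0n.
set B := _ * tap_energy H D.
pose c := form_bound N H ^+ 3 * exponential_moment R N + remainder_bound N H / 2.
have c0 : 0 <= `|c| by [].
apply/lee_subgt0Pr => e e0.
have Nt : 0 <= N%:R * t by rewrite mulr_ge0 ?total_power_ge0.
(* The first bound makes the cubic term smaller than e after division by rho^2 (N + K - 1); the
   second enforces the smallness condition of the exponential moments. *)
pose delta := Num.min (e * (N + K.-1)%:R / (`|c| + 1)) (4^-1 / (N%:R * t + 1)).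
have d0 : 0 < delta.
  by rewrite lt_min !divr_gt0 ?mulr_gt0//; lra.
apply: (@limf_einf_ge _ _ delta) => // rho /andP[r0]; rewrite lt_min => /andP[re rs].
have [L [-> _ LI]] := capacity_limit HW phi_fin ne (ltW r0).
have small : rho * (N%:R * t) <= 4^-1.
  move: rs; rewrite ltr_pdivlMr; last by lra.
  by rewrite mulrDr mulr1; lra.
have := LI _ _ (phase_admissible R N).
have := phase_information_ge HW (ltW r0) small.
have := total_tap_matrix HW N D.
rewrite -/B -/c; set TB := total_nsq _ => hB h1 h2.
have r2 : 0 < rho ^+ 2 by rewrite exprn_gt0.
rewrite -EFinM -EFinB lee_fin ler_pdivlMr//.
have hL : rho ^+ 2 * TB / 2 - rho ^+ 3 * c <= (N + K.-1)%:R * L by exact: le_trans h1 h2.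
have hBr : rho ^+ 2 * B <= rho ^+ 2 * TB / 2 by rewrite -mulrA; apply: ler_wpM2l; [exact: ltW|lra].
have hc : rho ^+ 3 * c <= rho ^+ 2 * (e * (N + K.-1)%:R).
  rewrite exprSr -mulrA; apply: ler_wpM2l; first exact: ltW.
  move: re; rewrite ltr_pdivlMr; last by lra.
  move=> re; apply: le_trans (ltW re).
  by apply: ler_wpM2l; [exact: ltW|have := ler_norm c; lra].
have gen (n : R) : 0 < n -> (B / n - e) * rho ^+ 2 = (rho ^+ 2 * B - rho ^+ 2 * (e * n)) / n.
  by move=> np; field; exact: lt0r_neq0.
rewrite gen//.
rewrite ler_pdivrMr// (mulrC L); lra.
Qed.

Lemma capacity_liminf :
  (\sum_(1 <= n <oo) ((Normc.normc (\sum_(k < K) autocorrelation (H k) n%:Z)) ^+ 2)%:E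
     <= limf_einf (fun rho : R => C_ds H W rho 1 * ((rho ^+ 2)^-1)%:E) (0^'+))%E.
Proof.
apply: lime_le.
  by apply: is_cvg_nneseries => n _ _; rewrite lee_fin sqr_ge0.
apply: nearW => D'.
(* The partial sum of the series stops before D', while [tap_energy] includes the lag D'. *)
apply: (@le_trans _ _ (tap_energy H D')%:E).
  rewrite sumEFin lee_fin /tap_energy.
  under eq_bigr do rewrite -nsq_normc.
  have [D1|D0] := leqP 1 D'; last by rewrite big_geq ?tap_energy_ge0//; lia.
  by rewrite big_nat_recr//= lerDl nsq_ge0.
set D := D'; apply/lee_subgt0Pr => e e0.
have S0 := tap_energy_ge0 H D.
set S := tap_energy H D in S0 *.
(* [m] complete columns among N + K - 1 = m + D + 2 (K - 1) symbols lose the fraction (D + 2 (K -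
   1)) / (N + K - 1) of S, which this choice makes at most e. *)
pose m := (Num.truncn (S * (K.-1 + D + K.-1).+1%:R / e)).+1.
have hm : S * (K.-1 + D + K.-1).+1%:R / e < m%:R.
  by rewrite /m; apply: truncnS_gt.
pose N := (m + (K.-1 + D))%N.
have n0 : (0 < N + K.-1)%N by rewrite /N; lia.
apply: le_trans (capacity_liminf_block D n0); rewrite -EFinB lee_fin -/S.
have n0' : 0 < (N + K.-1)%:R :> R by rewrite ltr0n.
rewrite ler_pdivlMr// mulrBl.
have -> : (N - (K.-1 + D))%N = m by rewrite /N addnK.
have -> : (N + K.-1)%:R = m%:R + (K.-1 + D + K.-1)%:R :> R by rewrite -natrD /N; congr _%:R; lia.
move: hm; rewrite ltr_pdivrMr// => hm.
have h1 : S * (K.-1 + D + K.-1)%:R <= S * (K.-1 + D + K.-1).+1%:R by rewrite ler_wpM2l// ler_nat.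
have h2 : 0 <= e * (K.-1 + D + K.-1)%:R by rewrite mulr_ge0// ltW.
rewrite !mulrDr (mulrC m%:R); lra.
Qed.

End main_theorem.

Theorem mainTheorem6 (R : realType) (d : measure_display) (T : measurableType d)
    (P : probability T R) (K : nat)
    (H : 'I_K -> int -> {RV P >-> R[i]}) (W : int -> {RV P >-> R[i]}) :
  (0 < K)%N ->
  rayleigh_channel H W ->
  (forall k : 'I_K, (phi (H k) < +oo)%E) ->
  (forall k : 'I_K, nonephemeral (H k)) ->
  (limf_esup (fun rho : R => C_ds H W rho 1 * ((rho ^+ 2)^-1)%:E) (0^'+)
     <= K%:R%:E * \sum_(k < K) phi (H k))%E /\
  (\sum_(1 <= n <oo)
      ((Normc.normc (\sum_(k < K) autocorrelation (H k) n%:Z)) ^+ 2)%:E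
     <= limf_einf (fun rho : R => C_ds H W rho 1 * ((rho ^+ 2)^-1)%:E)
                  (0^'+))%E.
Proof.
move=> _ HW phi_fin ne.
by split; [exact: capacity_limsup|exact: capacity_liminf].
Qed.
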